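(* There exists a unique surjective $\mathcal A$-algebra homomorphism $\phi_d:\mathbf K^{\jmath}\to\mathbf S^{\jmath}$ such that for all $R\ge0$, $i\in[1,n]$ and $\lambda\in\tilde\Xi^{\mathrm{diag}}$: $\phi_d([\lambda+RE^\theta_{i,i+1}])$ equals $[\lambda+RE^\theta_{i,i+1}]$ if $\lambda+RE^\theta_{i,i+1}\in\Xi_d$ and $0$ otherwise; and $\phi_d([\lambda+RE^\theta_{i+1,i}])$ equals $[\lambda+RE^\theta_{i+1,i}]$ if $\lambda+RE^\theta_{i+1,i}\in\Xi_d$ and $0$ otherwise. Hence there is a surjective $\mathcal A$-algebra homomorphism $\phi_d\circ\aleph:{}_{\mathcal A}\dot{\mathbf U}^{\jmath}\to\mathbf S^{\jmath}$.
   Context: Let $\mathcal A=\mathbb Z[v,v^{-1}]$, $n,d\ge1$, $N=2n+1$; $\mathbb N=\{0,1,2,\dots\}$, $|U|=\dim U$. Put $D=2d+1$. For an odd prime power $q$ equip $\mathbb F_q^D$ with a nondegenerate symmetric bilinear form with isometry group $O(D)$, and let $X$ be the set of flags $V=(0=V_0\subseteq V_1\subseteq\cdots\subseteq V_N=\mathbb F_q^D)$ with $V_i=V_{N-i}^\perp$ for all $i$. Let $\Xi_d$ be the set of $N\times N$ matrices $A=(a_{ij})$ over $\mathbb N$ with $\sum a_{ij}=D$ and $a_{ij}=a_{N+1-i,N+1-j}$. The $O(D)$-orbits $\mathcal O_A$ on $X\times X$ are indexed by $A\in\Xi_d$: $(V,V')\in\mathcal O_A$ iff $a_{ij}=|(V_{i-1}+V_i\cap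 V'_j)/(V_{i-1}+V_i\cap V'_{j-1})|$ for all $i,j$. The Schur algebra $\mathbf S^{\jmath}$ (depending on $d$) is the free $\mathcal A$-module with basis the characteristic functions $e_A$ ($A\in\Xi_d$) with convolution product $e_A*e_{A'}=\sum_{A''}g_{A,A',A''}e_{A''}$, where $g_{A,A',A''}\in\mathbb Z[v^2]$ is the polynomial whose value at $v=\sqrt q$, for all odd prime powers $q$, is the number of $V\in X$ with $(V_1,V)\in\mathcal O_A$, $(V,V_2)\in\mathcal O_{A'}$ for fixed $(V_1,V_2)\in\mathcal O_{A''}$. Its standard basis is $[A]=v^{-d_A}e_A$, where $$d_A=\sum_{i>k,\,j<l,\,i+k<N+1}a_{ij}a_{kl}+\sum_{j<l,\ (i<n+1\text{ or }j<N+1-l)}a_{ij}a_{il}+\sum_{i\ge n+1>j}\frac{a_{ij}(a_{ij}-1)}2 .$$ $\tilde\Xi$ is the set of $N\times N$ integer matrices $A=(a_{ij})$ with $a_{ij}\ge0$ for $i\ne j$, $a_{n+1,n+1}$ odd, and $a_{ij}=a_{N+1-i,N+1-j}$; $\tilde\Xi^{\mathrm{diag}}$ is its subset of diagonal matrices $\lambda=\mathrm{diag}(\lambda_1,\dots,\lambda_N)$. $E^\theta_{ij}=E_{ij}+E_{N+1-i,N+1-j}$. $\mathbf K^{\jmath}$ is the free $\mathcal A$-module with basis $[A]$, $A\in\tilde\Xi$, with the associative product (no unit): for $A_1,\dots,A_f\in\tilde\Xi$ such that the column sums of $A_i$ equal the row sums of $A_{i+1}$ for all $i$, there are $Z_i\in\tilde\Xi$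 and $G_i(v,v')\in\mathbb Q(v)[v']$ with $[A_1+2pI]*\cdots*[A_f+2pI]=\sum_iG_i(v,v^{-2p})[Z_i+2pI]$ in the Schur algebras (for varying $d$) for all $p\gg0$, and $[A_1]\cdots[A_f]:=\sum_iG_i(v,1)[Z_i]$ (the product is $0$ for non-composable matrices). $\mathbf U^{\jmath}$ is the $\mathbb Q(v)$-algebra generated by $e_i,f_i$ $(1\le i\le n)$, $d_a^{\pm1}$ $(1\le a\le n+1)$ with relations (where $\llbracket2\rrbracket=v+v^{-1}$): $d_ad_a^{-1}=d_a^{-1}d_a=1$; $d_ad_b=d_bd_a$; $d_ae_jd_a^{-1}=v^{-\delta_{a,j+1}-\delta_{N+1-a,j+1}+\delta_{a,j}}e_j$; $d_af_jd_a^{-1}=v^{-\delta_{a,j}+\delta_{a,j+1}+\delta_{N+1-a,j+1}}f_j$; $e_if_j-f_je_i=\delta_{i,j}\frac{d_id_{i+1}^{-1}-d_i^{-1}d_{i+1}}{v-v^{-1}}$ unless $i=j=n$; $e_i^2e_j+e_je_i^2=\llbracket2\rrbracket e_ie_je_i$ and $f_i^2f_j+f_jf_i^2=\llbracket2\rrbracket f_if_jf_i$ if $|i-j|=1$; $e_ie_j=e_je_i$ and $f_if_j=f_jf_i$ if $|i-j|>1$; $f_n^2e_n+e_nf_n^2=\llbracket2\rrbracket\big(f_ne_nf_n-(vd_nd_{n+1}^{-1}+v^{-1}d_n^{-1}d_{n+1})f_n\big)$; $e_n^2f_n+f_ne_n^2=\llbracket2\rrbracket\big(e_nf_ne_n-e_n(vd_nd_{n+1}^{-1}+v^{-1}d_n^{-1}d_{n+1})\big)$.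 Its modified form is $\dot{\mathbf U}^{\jmath}=\bigoplus_{\lambda,\lambda'\in\tilde\Xi^{\mathrm{diag}}}\mathbf U^{\jmath}/\big(\sum_a(d_a-v^{-\lambda_a})\mathbf U^{\jmath}+\sum_a\mathbf U^{\jmath}(d_a-v^{-\lambda'_a})\big)$ with Lusztig's product, orthogonal idempotents $D_\lambda$ (image of $1$ in the $(\lambda,\lambda)$ summand) and $\dot{\mathbf U}^{\jmath}=\sum_\lambda\mathbf U^{\jmath}D_\lambda$. There is a $\mathbb Q(v)$-algebra isomorphism $\aleph:\dot{\mathbf U}^{\jmath}\to\mathbb Q(v)\otimes_{\mathcal A}\mathbf K^{\jmath}$ with $D_\lambda\mapsto[\lambda]$, $e_iD_\lambda\mapsto[\lambda-E^\theta_{i,i}+E^\theta_{i+1,i}]$, $f_iD_\lambda\mapsto[\lambda-E^\theta_{i+1,i+1}+E^\theta_{i,i+1}]$; put ${}_{\mathcal A}\dot{\mathbf U}^{\jmath}=\aleph^{-1}(\mathbf K^{\jmath})$. *)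

(* Defs.v *)
From HB Require Import structures.
From mathcomp Require Import all_boot all_order all_algebra zify.
From mathcomp Require Import finmap boolp.
From mathcomp Require Import monalg.

Set Implicit Arguments.
Unset Strict Implicit.
Unset Printing Implicit Defensive.

Import GRing.Theory Num.Theory.

Local Open Scope ring_scope.
Local Open Scope quotient_scope.

(* Rows, columns and generators are numbered from 0: the index i of the       *)
(* mathematical text (1 <= i <= N) is the ordinal i - 1, and the involution   *)
(* i |-> N + 1 - i is rev_ord.                                                *)

Definition Qv : fieldType := {fraction {poly rat}}.
Definition v : Qv := FracField.tofrac ('X : {poly rat}).

Lemma v_neq0 : v != 0.
Proof. by rewrite tofrac_eq0 polyX_eq0. Qed.

(* Z[v, v^-1], as a subring of Q(v) *)
Definition laurent_pred : {pred Qv} := fun x =>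
  `[< exists k (p : {poly int}), x = v ^- k * (map_poly intr p).[v] >].

Lemma laurent_subring : subring_closed laurent_pred.
Proof.
split.
- apply/asboolP; exists 0%N, 1.
  by rewrite rmorph1 hornerC expr0 invr1 mul1r.
- move=> _ _ /asboolP[k [p ->]] /asboolP[l [r ->]]; apply/asboolP.
  exists (k + l)%N, ('X^l * p - 'X^k * r).
  rewrite rmorphB !rmorphM /= !map_polyXn !hornerE /=.
  rewrite mulrBr exprD invfM; congr (_ - _).
    by rewrite -!mulrA; congr (_ * _); rewrite mulKf ?expf_neq0 ?v_neq0.
  by rewrite [v ^- k * _]mulrC -!mulrA; congr (_ * _);
     rewrite mulKf ?expf_neq0 ?v_neq0.
- move=> _ _ /asboolP[k [p ->]] /asboolP[l [r ->]]; apply/asboolP.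
  exists (k + l)%N, (p * r).
  by rewrite !rmorphM /= hornerM exprD invfM mulrACA.
Qed.
HB.instance Definition _ :=
  GRing.isSubringClosed.Build Qv laurent_pred laurent_subring.

Record laurent :=
  Laurent { laurent_val :> Qv; laurentP : laurent_val \in laurent_pred }.
HB.instance Definition _ := [isSub for laurent_val].
HB.instance Definition _ := [Choice of laurent by <:].
HB.instance Definition _ := [SubChoice_isSubComNzRing of laurent by <:].

Lemma vexp_subproof (z : int) : v ^ z \in laurent_pred.
Proof.
apply/asboolP; case: z => k.
  by exists 0%N, 'X^k; rewrite map_polyXn hornerXn expr0 invr1 mul1r.
by exists k.+1, 1; rewrite rmorph1 hornerC mulr1.
Qed.
Definition vexp (z : int) : laurent := Laurent (vexp_subproof z).

Definition N n := n.*2.+1.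
Definition dimD d := d.*2.+1.

Definition theta_sym n (T : eqType) (A : 'M[T]_(N n)) : bool :=
  [forall i, forall j, A i j == A (rev_ord i) (rev_ord j)].

(* Xi_d. The entries of such a matrix are at most D, so bounding them loses   *)
(* nothing and makes Xi_d a finite type.                                      *)
Definition Xi_pred n d : pred 'M['I_(dimD d).+1]_(N n) := fun A =>
  (\sum_i \sum_j (A i j : nat) == dimD d)%N && theta_sym A.
Definition Xi n d : finType := {A : 'M['I_(dimD d).+1]_(N n) | Xi_pred A}.

Definition Xi_entry n d (A : Xi n d) (i j : 'I_(N n)) : nat := val A i j.
Definition Xi_mx n d (A : Xi n d) : 'M[int]_(N n) := \matrix_(i, j) (Xi_entry A i j)%:Z.
Definition in_Xi n d (M : 'M[int]_(N n)) : bool := [exists A : Xi n d, Xi_mx A == M].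

Definition mid n : 'I_(N n) := inord n.

Definition Xit_pred n : pred 'M[int]_(N n) := fun A =>
  [&& [forall i, forall j, (i != j) ==> (0 <= A i j)],
      odd `|A (mid n) (mid n)|%N & theta_sym A].
Definition Xit n : choiceType := {A : 'M[int]_(N n) | Xit_pred A}.

Definition Xitdiag n : choiceType := {A : 'M[int]_(N n) | Xit_pred A && is_diag_mx A}.

Definition row_sum n (A : 'M[int]_(N n)) (i : 'I_(N n)) : int := \sum_j A i j.
Definition col_sum n (A : 'M[int]_(N n)) (j : 'I_(N n)) : int := \sum_i A i j.

(* E^theta_{k+1,l+1} *)
Definition Etheta n (k l : nat) : 'M[int]_(N n) :=
  delta_mx (inord k) (inord l) + delta_mx (rev_ord (inord k)) (rev_ord (inord l)).

(* A subspace of F^D is represented by its canonical generating matrix, i.e.  *)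
(* by a matrix W with <<W>> = W, so that flags form a finite set.             *)
Section Flags.
Variables (F : finFieldType) (n d : nat).

Definition flag : finType := {ffun 'I_(N n).+1 -> 'M[F]_(dimD d)}.

(* orthogonal of the row space of W for the form (x, y) |-> x B y^T *)
Definition orth (B W : 'M[F]_(dimD d)) : 'M[F]_(dimD d) := kermx (B *m W^T).

Definition is_flag (B : 'M[F]_(dimD d)) (V : flag) : bool :=
  [&& [forall i, <<V i>>%MS == V i],
      [forall i : 'I_(N n), (V (inord i) <= V (inord i.+1))%MS],
      V ord0 == 0, (1%:M <= V ord_max)%MS
    & [forall i, (V i == orth B (V (rev_ord i)))%MS]].

(* dim (V_{i-1} + V_i cap V'_j) / (V_{i-1} + V_i cap V'_{j-1}) *)
Definition relpos (V V' : flag) (i j : 'I_(N n)) : nat :=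
  (\rank (V (inord i) + V (inord i.+1) :&: V' (inord j.+1))
   - \rank (V (inord i) + V (inord i.+1) :&: V' (inord j)))%N.

(* (V, V') belongs to the O(D)-orbit indexed by A *)
Definition in_orbit (A : Xi n d) (V V' : flag) : bool :=
  [forall i, forall j, relpos V V' i j == Xi_entry A i j].

End Flags.

Definition structure_constants n :=
  forall d, Xi n d -> Xi n d -> Xi n d -> {poly int}.

(* Nondegeneracy of the form is invertibility of its Gram matrix B.           *)
(* g A A' A'' is the polynomial in q = v^2 counting, over every finite field  *)
(* of odd cardinality q, the flags in position A from V1 and A' to V2.        *)
Definition counts_flags n d (g : Xi n d -> Xi n d -> Xi n d -> {poly int}) : Prop :=
  forall (F : finFieldType) (B : 'M[F]_(dimD d)),
    odd #|F| -> B^T = B -> B \in unitmx ->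
  forall (A A' A'' : Xi n d) (V1 V2 : flag F n d),
    is_flag B V1 -> is_flag B V2 -> in_orbit A'' V1 V2 ->
  (g A A' A'').[#|F|%:Z] =
  #|[set V : flag F n d | [&& is_flag B V, in_orbit A V1 V & in_orbit A' V V2]]|%:Z.

(* the free module on Xi_d; << A >> is the characteristic function e_A *)
Definition schur n d : lmodType laurent := {malg laurent[Xi n d]}.
Definition schur_e n d (A : Xi n d) : schur n d := << A >>.

Definition schur_mul n (g : structure_constants n) d (x y : schur n d) : schur n d :=
  \sum_A \sum_A' \sum_A''
    (x@_A * y@_A' * (map_poly intr (g d A A' A'')).[vexp 2]) *: schur_e A''.

(* With indices starting at 0, i + k < N + 1 becomes i + k + 1 < N, j < N + 1 *)
(* - l becomes j + l + 1 < N, and i >= n + 1 > j becomes i >= n > j.          *)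
Definition dA n d (A : Xi n d) : nat :=
  let a := Xi_entry A in
  ((\sum_(i < N n) \sum_(j < N n) \sum_(k < N n | k < i)
      \sum_(l < N n | (j < l) && (i + k + 1 < N n)) a i j * a k l)
   + (\sum_(i < N n) \sum_(j < N n)
      \sum_(l < N n | (j < l) && ((i < n) || (j + l + 1 < N n))) a i j * a i l)
   + (\sum_(i < N n | n <= i) \sum_(j < N n | j < n) (a i j * (a i j).-1) %/ 2))%N.

(* the standard basis element [M] for M in Xi_d; 0 for other matrices *)
Definition schur_std n d (M : 'M[int]_(N n)) : schur n d :=
  if [pick A : Xi n d | Xi_mx A == M] is Some A
  then vexp (- (dA A)%:Z) *: schur_e A else 0.

Definition toQ (I : choiceType) (x : {malg laurent[I]}) : {malg Qv[I]} :=
  [malg k in msupp x => laurent_val x@_k].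

(* the inverse of toQ on its image *)
Definition ofQ (I : choiceType) (y : {malg Qv[I]}) : {malg laurent[I]} :=
  [malg k in msupp y => insubd (0 : laurent) y@_k].

Definition K n : lmodType laurent := {malg laurent[Xit n]}.
Definition KQ n : lmodType Qv := {malg Qv[Xit n]}.

(* the basis element [M] for M in the index set; 0 for other matrices *)
Definition K_std n (M : 'M[int]_(N n)) : K n :=
  if insub M is Some A then << (A : Xit n) >> else 0.

(* the bilinear products on K^j and on its extension to Q(v) such that        *)
(* [A][B] = m A B                                                             *)
Definition K_mul n (m : Xit n -> Xit n -> K n) (x y : K n) : K n :=
  \sum_(A <- msupp x) \sum_(B <- msupp y) (x@_A * y@_B) *: m A B.
Definition KQ_mul n (m : Xit n -> Xit n -> K n) (x y : KQ n) : KQ n :=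
  \sum_(A <- msupp x) \sum_(B <- msupp y) (x@_A * y@_B) *: toQ (m A B).

Definition composable n : rel (Xit n) := fun A B =>
  [forall i, col_sum (val A) i == row_sum (val B) i].

Definition shift n (p : nat) (A : Xit n) : 'M[int]_(N n) := val A + (2 * p)%:Z%:M.

(* m is the product of K^j on basis elements, obtained from the Schur         *)
(* algebras by stabilization. ZG lists the pairs (Z_i, G_i); an element of    *)
(* Q(v)[v'] is a polynomial over Q(v).                                        *)
Definition is_stabilization n (g : structure_constants n)
    (m : Xit n -> Xit n -> K n) : Prop :=
  [/\ associative (K_mul m),
      forall A B, ~~ composable A B -> m A B = 0
    & forall (A : Xit n) (s : seq (Xit n)), path (@composable n) A s ->
      exists ZG : seq (Xit n * {poly Qv}),
        (exists p0 : nat, forall p, (p0 <= p)%N -> exists d : nat,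
           [/\ (0 < d)%N,
               all (fun B => in_Xi d (shift p B)) (A :: s),
               all (fun z => in_Xi d (shift p z.1)) ZG
             & toQ (foldl (@schur_mul n g d) (schur_std d (shift p A))
                          [seq schur_std d (shift p B) | B <- s])
               = \sum_(z <- ZG) z.2.[v ^- (2 * p)] *: toQ (schur_std d (shift p z.1))])
        /\ toQ (foldl (K_mul m) << A >> [seq << B >> | B <- s])
           = \sum_(z <- ZG) z.2.[1] *: << z.1 >>].

Section TwoSidedIdeal.
Variables (R : pzRingType) (S : R -> Prop).

Inductive ideal_gen : R -> Prop :=
| ideal_gen0 : ideal_gen 0
| ideal_genM x r y : S r -> ideal_gen (x * r * y)
| ideal_genB a b : ideal_gen a -> ideal_gen b -> ideal_gen (a - b).

Lemma ideal_gen_mull x a : ideal_gen a -> ideal_gen (x * a).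
Proof.
elim=> [|y r z Sr|b c _ Hb _ Hc]; first by rewrite mulr0; exact: ideal_gen0.
  by rewrite !mulrA; exact: ideal_genM.
by rewrite mulrBr; exact: ideal_genB.
Qed.

Lemma ideal_gen_mulr x a : ideal_gen a -> ideal_gen (a * x).
Proof.
elim=> [|y r z Sr|b c _ Hb _ Hc]; first by rewrite mul0r; exact: ideal_gen0.
  by rewrite -mulrA; exact: ideal_genM.
by rewrite mulrBl; exact: ideal_genB.
Qed.

Definition ideal_pred : {pred R} := fun x => `[< ideal_gen x >].

Lemma ideal_pred_zmod : zmod_closed ideal_pred.
Proof.
split; first exact/asboolP/ideal_gen0.
by move=> x y /asboolP hx /asboolP hy; apply/asboolP/ideal_genB.
Qed.
HB.instance Definition _ := GRing.isZmodClosed.Build R ideal_pred ideal_pred_zmod.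

End TwoSidedIdeal.

(* the quotient of an algebra by the two-sided ideal generated by S *)
Section QuotientAlgebra.
Variables (k : pzRingType) (R : lalgType k) (S : R -> Prop).

Definition quot_alg : Type := Quotient.quot (ideal_pred S).
HB.instance Definition _ := GRing.Zmodule.on quot_alg.

Definition quot_pi (x : R) : quot_alg := \pi_(Quotient.quot (ideal_pred S)) x.
Definition quot_repr (x : quot_alg) : R := repr (x : Quotient.quot (ideal_pred S)).

Lemma quot_reprK : cancel quot_repr quot_pi.
Proof. exact: reprK. Qed.

Lemma quot_piP x y : quot_pi x = quot_pi y <-> ideal_gen S (x - y).
Proof.
split=> [/eqP|H]; last apply/eqP; rewrite /quot_pi -Quotient.idealrBE.
  by move/asboolP.
exact/asboolP.
Qed.

Lemma quot_piB : zmod_morphism quot_pi.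
Proof. by move=> x y; rewrite /quot_pi !piE. Qed.

Lemma repr_piP x : ideal_gen S (quot_repr (quot_pi x) - x).
Proof. by apply/quot_piP; rewrite quot_reprK. Qed.

Definition quot_one : quot_alg := quot_pi 1.
Definition quot_mul (x y : quot_alg) := quot_pi (quot_repr x * quot_repr y).
Definition quot_scale (c : k) (x : quot_alg) := quot_pi (c *: quot_repr x).

Lemma quot_piM x y : quot_pi (x * y) = quot_mul (quot_pi x) (quot_pi y).
Proof.
apply/esym/quot_piP.
have -> : quot_repr (quot_pi x) * quot_repr (quot_pi y) - x * y =
  (quot_repr (quot_pi x) - x) * quot_repr (quot_pi y)
  - (x * - (quot_repr (quot_pi y) - y)).
  by rewrite mulrN opprK mulrBl mulrBr addrA subrK.
apply: ideal_genB; first exact/ideal_gen_mulr/repr_piP.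
apply: ideal_gen_mull; rewrite -[- _]sub0r.
by apply: ideal_genB; [exact: ideal_gen0|exact: repr_piP].
Qed.

Lemma quot_piZ c x : quot_pi (c *: x) = quot_scale c (quot_pi x).
Proof.
apply/esym/quot_piP; rewrite -scalerBr -[X in _ *: X]mul1r scalerAl.
exact/ideal_gen_mull/repr_piP.
Qed.

Lemma quot_piD x y : quot_pi (x + y) = quot_pi x + quot_pi y.
Proof. by rewrite /quot_pi piE. Qed.

Lemma quot_mulA : associative quot_mul.
Proof.
move=> x y z; rewrite -[x]quot_reprK -[y]quot_reprK -[z]quot_reprK.
by rewrite -!quot_piM mulrA.
Qed.
Lemma quot_mul1l : left_id quot_one quot_mul.
Proof. by move=> x; rewrite -[x]quot_reprK -quot_piM mul1r. Qed.
Lemma quot_mul1r : right_id quot_one quot_mul.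
Proof. by move=> x; rewrite -[x]quot_reprK -quot_piM mulr1. Qed.
Lemma quot_mulDl : left_distributive quot_mul +%R.
Proof.
move=> x y z; rewrite -[x]quot_reprK -[y]quot_reprK -[z]quot_reprK.
by rewrite -quot_piD -!quot_piM -quot_piD mulrDl.
Qed.
Lemma quot_mulDr : right_distributive quot_mul +%R.
Proof.
move=> x y z; rewrite -[x]quot_reprK -[y]quot_reprK -[z]quot_reprK.
by rewrite -quot_piD -!quot_piM -quot_piD mulrDr.
Qed.
HB.instance Definition _ := GRing.Zmodule_isPzRing.Build quot_alg
  quot_mulA quot_mul1l quot_mul1r quot_mulDl quot_mulDr.

Lemma quot_scaleA a b x : quot_scale a (quot_scale b x) = quot_scale (a * b) x.
Proof. by rewrite -[x]quot_reprK -!quot_piZ scalerA. Qed.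
Lemma quot_scale1 : left_id 1 quot_scale.
Proof. by move=> x; rewrite -[x]quot_reprK -quot_piZ scale1r. Qed.
Lemma quot_scaleDr : right_distributive quot_scale +%R.
Proof.
move=> a x y; rewrite -[x]quot_reprK -[y]quot_reprK.
by rewrite -quot_piD -!quot_piZ -quot_piD scalerDr.
Qed.
Lemma quot_scaleDl x : {morph quot_scale^~ x : a b / a + b}.
Proof. by move=> a b; rewrite -[x]quot_reprK -!quot_piZ -quot_piD scalerDl. Qed.
HB.instance Definition _ := GRing.Zmodule_isLmodule.Build k quot_alg
  quot_scaleA quot_scale1 quot_scaleDr quot_scaleDl.
End QuotientAlgebra.

(* the quotient of a module by the submodule generated by S *)
Section QuotientModule.
Variables (k : pzRingType) (V : lmodType k) (S : V -> Prop).

Inductive span_gen : V -> Prop :=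
| span_gen0 : span_gen 0
| span_genZ c x : S x -> span_gen (c *: x)
| span_genB a b : span_gen a -> span_gen b -> span_gen (a - b).

Lemma span_gen_scale c a : span_gen a -> span_gen (c *: a).
Proof.
elim=> [|b x Sx|x y _ Hx _ Hy]; first by rewrite scaler0; exact: span_gen0.
  by rewrite scalerA; exact: span_genZ.
by rewrite scalerBr; exact: span_genB.
Qed.

Definition span_pred : {pred V} := fun x => `[< span_gen x >].

Lemma span_pred_zmod : zmod_closed span_pred.
Proof.
split; first exact/asboolP/span_gen0.
by move=> x y /asboolP hx /asboolP hy; apply/asboolP/span_genB.
Qed.
HB.instance Definition _ := GRing.isZmodClosed.Build V span_pred span_pred_zmod.

Definition quot_mod : Type := Quotient.quot span_pred.
HB.instance Definition _ := GRing.Zmodule.on quot_mod.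

Definition mod_pi (x : V) : quot_mod := \pi_(Quotient.quot span_pred) x.
Definition mod_repr (x : quot_mod) : V := repr (x : Quotient.quot span_pred).

Lemma mod_reprK : cancel mod_repr mod_pi.
Proof. exact: reprK. Qed.

Lemma mod_piP x y : mod_pi x = mod_pi y <-> span_gen (x - y).
Proof.
split=> [/eqP|H]; last apply/eqP; rewrite /mod_pi -Quotient.idealrBE.
  by move/asboolP.
exact/asboolP.
Qed.

Lemma mod_piD x y : mod_pi (x + y) = mod_pi x + mod_pi y.
Proof. by rewrite /mod_pi piE. Qed.

Definition mod_scale (c : k) (x : quot_mod) := mod_pi (c *: mod_repr x).

Lemma mod_piZ c x : mod_pi (c *: x) = mod_scale c (mod_pi x).
Proof.
apply/mod_piP; rewrite -scalerBr; apply: span_gen_scale.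
by apply/mod_piP; rewrite mod_reprK.
Qed.

Lemma mod_scaleA a b x : mod_scale a (mod_scale b x) = mod_scale (a * b) x.
Proof. by rewrite -[x]mod_reprK -!mod_piZ scalerA. Qed.
Lemma mod_scale1 : left_id 1 mod_scale.
Proof. by move=> x; rewrite -[x]mod_reprK -mod_piZ scale1r. Qed.
Lemma mod_scaleDr : right_distributive mod_scale +%R.
Proof.
move=> a x y; rewrite -[x]mod_reprK -[y]mod_reprK.
by rewrite -mod_piD -!mod_piZ -mod_piD scalerDr.
Qed.
Lemma mod_scaleDl x : {morph mod_scale^~ x : a b / a + b}.
Proof. by move=> a b; rewrite -[x]mod_reprK -!mod_piZ -mod_piD scalerDl. Qed.
HB.instance Definition _ := GRing.Zmodule_isLmodule.Build k quot_mod
  mod_scaleA mod_scale1 mod_scaleDr mod_scaleDl.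
End QuotientModule.

(* the direct sum of copies of V indexed by I *)
Section DirectSum.
Variables (k : pzRingType) (V : lmodType k) (I : choiceType).

Definition dsum : Type := {malg V[I]}.
HB.instance Definition _ := GRing.Zmodule.on dsum.

Definition dsum_scale (c : k) (x : dsum) : dsum := [malg i in msupp x => c *: x@_i].

Lemma dsum_scaleE c x i : (dsum_scale c x)@_i = c *: x@_i.
Proof. by rewrite mcoeffE; case: msuppP => // _; rewrite scaler0. Qed.

Lemma dsum_scaleA a b x : dsum_scale a (dsum_scale b x) = dsum_scale (a * b) x.
Proof. by apply/malgP => i; rewrite !dsum_scaleE scalerA. Qed.
Lemma dsum_scale1 : left_id 1 dsum_scale.
Proof. by move=> x; apply/malgP => i; rewrite dsum_scaleE scale1r. Qed.
Lemma dsum_scaleDr : right_distributive dsum_scale +%R.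
Proof.
by move=> a x y; apply/malgP => i; rewrite !(dsum_scaleE, mcoeffD) scalerDr.
Qed.
Lemma dsum_scaleDl x : {morph dsum_scale^~ x : a b / a + b}.
Proof.
by move=> a b; apply/malgP => i; rewrite !(dsum_scaleE, mcoeffD) scalerDl.
Qed.
HB.instance Definition _ := GRing.Zmodule_isLmodule.Build k dsum
  dsum_scaleA dsum_scale1 dsum_scaleDr dsum_scaleDl.
End DirectSum.

Definition gen n : choiceType := ('I_n + 'I_n + ('I_n.+1 + 'I_n.+1))%type.

(* the free Q(v)-algebra on the generators *)
Definition free_alg n : lalgType Qv := {malg Qv[{fmonom gen n}]}.

Definition gE n (i : 'I_n) : free_alg n := << fmu (inl (inl i) : gen n) >>.
Definition gF n (i : 'I_n) : free_alg n := << fmu (inl (inr i) : gen n) >>.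
Definition gD n (a : 'I_n.+1) : free_alg n := << fmu (inr (inl a) : gen n) >>.
(* d_a^{-1} *)
Definition gD' n (a : 'I_n.+1) : free_alg n := << fmu (inr (inr a) : gen n) >>.

Definition quantum2 : Qv := v + v^-1.

(* d_a e_j d_a^{-1} = v^(weight a j) e_j *)
Definition weight n (a : 'I_n.+1) (j : 'I_n) : int :=
  (a == j :> nat)%:Z - (a == j.+1 :> nat)%:Z - ((n.*2 - a)%N == j.+1)%:Z.

(* the elements that are set to 0 in U^j *)
Inductive Uj_rel n : free_alg n -> Prop :=
| rel_dd' a : Uj_rel (gD a * gD' a - 1)
| rel_d'd a : Uj_rel (gD' a * gD a - 1)
| rel_dC a b : Uj_rel (gD a * gD b - gD b * gD a)
| rel_de a j : Uj_rel (gD a * gE j * gD' a - v ^ weight a j *: gE j)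
| rel_df a j : Uj_rel (gD a * gF j * gD' a - v ^ (- weight a j) *: gF j)
| rel_ef (i j : 'I_n) : ~~ ((i == j) && (i.+1 == n)) ->
    let d := gD (inord i) in let d' := gD' (inord i) in
    let d1 := gD (inord i.+1) in let d1' := gD' (inord i.+1) in
    Uj_rel (gE i * gF j - gF j * gE i
            - (if i == j then (v - v^-1)^-1 *: (d * d1' - d' * d1) else 0))
| rel_eSerre (i j : 'I_n) : (i.+1 == j) || (j.+1 == i) ->
    Uj_rel (gE i ^+ 2 * gE j + gE j * gE i ^+ 2 - quantum2 *: (gE i * gE j * gE i))
| rel_fSerre (i j : 'I_n) : (i.+1 == j) || (j.+1 == i) ->
    Uj_rel (gF i ^+ 2 * gF j + gF j * gF i ^+ 2 - quantum2 *: (gF i * gF j * gF i))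
| rel_eC (i j : 'I_n) : (i.+1 < j)%N || (j.+1 < i)%N ->
    Uj_rel (gE i * gE j - gE j * gE i)
| rel_fC (i j : 'I_n) : (i.+1 < j)%N || (j.+1 < i)%N ->
    Uj_rel (gF i * gF j - gF j * gF i)
| rel_fnen (i : 'I_n) : i.+1 = n ->
    let e := gE i in let f := gF i in
    let h := v *: (gD (inord i) * gD' (inord n))
             + v^-1 *: (gD' (inord i) * gD (inord n)) in
    Uj_rel (f ^+ 2 * e + e * f ^+ 2 - quantum2 *: (f * e * f - h * f))
| rel_enfn (i : 'I_n) : i.+1 = n ->
    let e := gE i in let f := gF i in
    let h := v *: (gD (inord i) * gD' (inord n))
             + v^-1 *: (gD' (inord i) * gD (inord n)) in
    Uj_rel (e ^+ 2 * f + f * e ^+ 2 - quantum2 *: (e * f * e - e * h)).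

Definition Uj n := quot_alg (@Uj_rel n).
HB.instance Definition _ n := GRing.PzRing.on (Uj n).
HB.instance Definition _ n := GRing.Lmodule.on (Uj n).

Definition Uj_pi n (x : free_alg n) : Uj n := quot_pi (@Uj_rel n) x.
Definition Ue n (i : 'I_n) : Uj n := Uj_pi (gE i).
Definition Uf n (i : 'I_n) : Uj n := Uj_pi (gF i).
Definition Ud n (a : 'I_n.+1) : Uj n := Uj_pi (gD a).
Definition Ud' n (a : 'I_n.+1) : Uj n := Uj_pi (gD' a).

(* lambda_{a+1}, for 0 <= a <= n *)
Definition lam n (l : Xitdiag n) (a : 'I_n.+1) : int := val l (inord a) (inord a).

(* The direct sum over (l, l') of the quotients of U by                       *)
(* sum_a (d_a - v^{-l_a}) U + sum_a U (d_a - v^{-l'_a}), as a quotient of the *)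
(* direct sum of copies of U.                                                 *)
Definition Uj_sum n : lmodType Qv := dsum (Uj n) (Xitdiag n * Xitdiag n)%type.

Definition in_summand n (p : Xitdiag n * Xitdiag n) (u : Uj n) : Uj_sum n :=
  << u *g p >>.

Inductive Udot_rel n : Uj_sum n -> Prop :=
| Udot_rel_l (p : Xitdiag n * Xitdiag n) a (u : Uj n) :
    Udot_rel (in_summand p (Ud a * u - v ^ (- lam p.1 a) *: u))
| Udot_rel_r (p : Xitdiag n * Xitdiag n) a (u : Uj n) :
    Udot_rel (in_summand p (u * Ud a - v ^ (- lam p.2 a) *: u)).

Definition Udot n : lmodType Qv := quot_mod (@Udot_rel n).
Definition Udot_pi n (x : Uj_sum n) : Udot n := mod_pi (@Udot_rel n) x.

(* the image of u in the summand (l, l') *)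
Definition Udot_class n (l l' : Xitdiag n) (u : Uj n) : Udot n :=
  Udot_pi (in_summand (l, l') u).

(* u is homogeneous of degree p.1 - p.2 *)
Definition homogeneous n (p : Xitdiag n * Xitdiag n) (u : Uj n) : Prop :=
  forall a, Ud a * u * Ud' a = v ^ (lam p.2 a - lam p.1 a) *: u.

(* Every element of Udot has a representative all of whose components are     *)
(* homogeneous, and the product below does not depend on its choice.          *)
Definition homog_repr n (x : Udot n) : Uj_sum n :=
  choose (fun y : Uj_sum n =>
            `[< Udot_pi y = x /\ forall p, homogeneous p (mcoeff p y) >])
         (mod_repr x).

(* Lusztig's product: (image of t in the summand (l, l')) times (image of s   *)
(* in the summand (m, m')) is the image of t s in the summand (l, m') if      *)
(* l' = m, and 0 otherwise, for t and s homogeneous of the right degrees.     *)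
Definition Udot_mul n (x y : Udot n) : Udot n :=
  let tx := homog_repr x in let ty := homog_repr y in
  \sum_(p <- msupp tx) \sum_(r <- msupp ty | p.2 == r.1)
    Udot_class p.1 r.2 (tx@_p * ty@_r).

Definition Dlam n (l : Xitdiag n) : Udot n := Udot_class l l 1.

Lemma Xitdiag_shift_subproof n (l : Xitdiag n) (k : nat) (z : int) :
  let M := val l + z *: Etheta n k k in Xit_pred M && is_diag_mx M.
Proof.
case: l => A /=; rewrite /Xit_pred.
case/andP=> /and3P[/'forall_forallP A0 oddA /'forall_forallP symA] /is_diag_mxP Ad.
set t : 'I_(N n) := inord k.
have revE (i j : 'I_(N n)) : (rev_ord i == j) = (i == rev_ord j).
  by rewrite (can2_eq (@rev_ordK _) (@rev_ordK _)).
have EE i j : Etheta n k k i j =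
    ((i == t) && (j == t))%:R + ((i == rev_ord t) && (j == rev_ord t))%:R.
  by rewrite /Etheta !mxE.
have E0 (i j : 'I_(N n)) : i != j -> Etheta n k k i j = 0.
  move=> ij; rewrite EE; case: (i =P t) => [e|_] /=; last first.
    case: (i =P _) => [e|_] //=; move: ij; rewrite e eq_sym => /negPf->.
    by [].
  move: (ij); rewrite e eq_sym => /negPf-> /=.
  by case: (t =P _) => //= e'; move: ij; rewrite e {1}e' eq_sym => /negPf->.
have ED i j : (A + z *: Etheta n k k) i j = A i j + z * Etheta n k k i j.
  by rewrite mxE [X in _ + X]mxE.
apply/andP; split; last first.
  by apply/is_diag_mxP => i j ij; rewrite ED Ad // E0 ?mulr0 ?addr0.
apply/and3P; split.
- apply/'forall_forallP => i j; apply/implyP => ij; rewrite ED E0 // mulr0 addr0.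
  exact: (implyP (A0 i j)).
- have rmid : rev_ord (mid n) = mid n.
    by apply: val_inj; rewrite /= /mid inordK /N; lia.
  by rewrite ED EE -!revE rmid; move: oddA; case: (_ == _) => /=; lia.
apply/'forall_forallP => i j.
by rewrite !ED !EE !revE !rev_ordK (eqP (symA i j)) addrC [X in _ * X]addrC addrC.
Qed.

Definition Xitdiag_shift n (k : nat) (z : int) (l : Xitdiag n) : Xitdiag n :=
  exist (fun A : 'M[int]_(N n) => is_true (Xit_pred A && is_diag_mx A)) _
    (Xitdiag_shift_subproof l k z).

(* Lusztig's e_i D_l and f_i D_l: the image of e_i (resp. f_i) in the unique  *)
(* summand (l', l) for which it is homogeneous of the right degree.           *)
Definition eD n (i : 'I_n) (l : Xitdiag n) : Udot n :=
  Udot_class (Xitdiag_shift i (-1) (Xitdiag_shift i.+1 1 l)) l (Ue i).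
Definition fD n (i : 'I_n) (l : Xitdiag n) : Udot n :=
  Udot_class (Xitdiag_shift i 1 (Xitdiag_shift i.+1 (-1) l)) l (Uf i).

(* Algebra homomorphisms are not required to preserve units: K^j has none.    *)
Definition is_phi n (g : structure_constants n) (m : Xit n -> Xit n -> K n) d
    (phi : K n -> schur n d) : Prop :=
  [/\ {morph phi : x y / K_mul m x y >-> schur_mul g x y},
      (forall s : schur n d, exists x : K n, phi x = s),
      (forall (R : nat) (i : 'I_n) (l : Xitdiag n),
         let M := val l + Etheta n i i.+1 *+ R in
         phi (K_std M) = if in_Xi d M then schur_std d M else 0)
    & (forall (R : nat) (i : 'I_n) (l : Xitdiag n),
         let M := val l + Etheta n i.+1 i *+ R in
         phi (K_std M) = if in_Xi d M then schur_std d M else 0)].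

Definition is_aleph n (m : Xit n -> Xit n -> K n) (aleph : Udot n -> KQ n) : Prop :=
  [/\ bijective aleph,
      {morph aleph : x y / Udot_mul x y >-> KQ_mul m x y},
      (forall l : Xitdiag n, aleph (Dlam l) = toQ (K_std (val l))),
      (forall (i : 'I_n) (l : Xitdiag n),
         aleph (eD i l) = toQ (K_std (val l - Etheta n i i + Etheta n i.+1 i)))
    & (forall (i : 'I_n) (l : Xitdiag n),
         aleph (fD i l) = toQ (K_std (val l - Etheta n i.+1 i.+1 + Etheta n i i.+1)))].

(* aleph^{-1}(K^j), K^j being identified with its image in KQ *)
Definition AUdot n (aleph : Udot n -> KQ n) : {pred Udot n} :=
  fun x => aleph x \is a monalgOver laurent_pred.

(* Main.v *)
(* The homomorphism sends [A] to [A] if A lies in Xi_d and to 0 otherwise.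

   Over Q(v), K^j is generated by the diagonal [l] and by the [B] such that
   B - E^theta_{h,h-1} is diagonal (0 < h < N, indices from 0; h > n gives the
   matrices with E^theta_{i,i+1}). Indeed, let A be nondiagonal, p its first
   column with a nonzero entry below the diagonal and (h, p) such an entry. If
   A' is A with this entry moved up to (h - 1, p), rotated copy included, then
   [B][A'] is a nonzero multiple of [A] plus terms in which
   sum_{i,j} (i - j)^2 a_ij is smaller. As the Schur algebra is associative and
   torsion free, multiplicativity and uniqueness reduce to the products [B][A].

   In the Schur algebra, the coefficient of e_C in e_B * e_A counts the flags V
   with V_h = V1_h + <x> and prescribed position with respect to V2, for
   (V1, V2) in O_C; the position of V depends only on the first column c with
   x in V1_h + V2_c. For h <> n every line of V1_{h+1} / V1_h is allowed,
   for h = n the isotropic ones are, and in both cases the count is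
   (q^w' - q^w) / (q - 1) with w, w' partial sums of row h of C (corrected by
   1 past the middle column if h = n). It is enough to do this for coordinate
   flags over the prime fields.

   Replacing A by A + 2pI turns these coefficients into sums of c v^(z p), and
   G(v, v^(-2p)) is another such sum. They agree for large p, hence at p = 0,
   which gives the product [B][A] in K^j without computing any exponent.
   Finally, a coefficient at C in Xi_d vanishes unless A and B lie in Xi_d. *)

From HB Require Import structures.
Require Import Defs.
From mathcomp Require Import all_boot all_order all_algebra zify ring.
From mathcomp Require Import finmap monalg finfield mxabelem.

Set Implicit Arguments.
Unset Strict Implicit.
Unset Printing Implicit Defensive.

Import Order.TTheory GRing.Theory Num.Theory.
Local Open Scope ring_scope.

(* fingraph's in_orbit shadows the one of Defs *)
Local Notation in_orbit := Defs.in_orbit.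

(** * Index matrices *)

(** The vanishing of coefficients outside [Xi n d] rests on an exact match. The count (q^w' - q^w) /
    (q - 1) is zero iff w = w', that is, iff the entry (h, c) of C is 0, or is 1 in case h = c = n.
    Passing from C to A takes 1 off this entry, but 2 off the middle one, which is its own rotated
    copy. The middle entry being odd, the coefficient at C in Xi_d is zero exactly when A would get
    a negative entry. The lower exponent for h = n has a geometric source: V_n and V_{n+1} =
    V_n^perp move together, so the added line must be isotropic, and in odd characteristic a
    quadratic form of odd rank on F_q^k has q^(k-1) zeros. Coordinate flags suffice because g makes
    the count depend on the orbit only, and prime fields because infinitely many values determine a
    polynomial. The leading coefficient of [B][A'] is in general not a unit of Z[v, v^-1]. The
    induction therefore allows division by nonzero scalars, and this is where torsion freeness
    enters. *)

Lemma Posz_sum (I : finType) (P : pred I) (F : I -> nat) :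
  (\sum_(i | P i) F i)%N%:Z = \sum_(i | P i) (F i)%:Z.
Proof. exact: (big_morph _ PoszD (erefl 0%:Z)). Qed.

Lemma andb_natr (b b' : bool) : (b && b')%:R = b%:R * b'%:R :> int.
Proof. by case: b; case: b'. Qed.

Lemma leq_natr (i j : nat) : (i <= j)%N%:R = (j == i)%:R + (i < j)%N%:R :> int.
Proof. by case: ltngtP. Qed.

Lemma predn_ltn (k i : nat) : (0 < k)%N -> (k.-1 < i)%N = (k <= i)%N.
Proof. by case: k. Qed.

Section PartialSums.
Variable n : nat.
Implicit Types (M : 'M[int]_(N n)) (i j : nat).

(** For the matrix of the relative position of two flags this is dim (V_i cap V'_j), by
    [psum_relpos]. Orbits are compared through these intersections rather than through the
    subquotients of [relpos]. *)
Definition psum M i j : int :=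
  \sum_(a < N n | (a < i)%N) \sum_(b < N n | (b < j)%N) M a b.

Lemma psumD M M' i j : psum (M + M') i j = psum M i j + psum M' i j.
Proof.
rewrite /psum -big_split; apply: eq_bigr => a _.
by rewrite -big_split; apply: eq_bigr => b _; rewrite mxE.
Qed.

Lemma psumN M i j : psum (- M) i j = - psum M i j.
Proof.
rewrite /psum -sumrN; apply: eq_bigr => a _.
by rewrite -sumrN; apply: eq_bigr => b _; rewrite mxE.
Qed.

Lemma psumB M M' i j : psum (M - M') i j = psum M i j - psum M' i j.
Proof. by rewrite psumD psumN. Qed.

Lemma psum_delta (a b : 'I_(N n)) i j :
  psum (delta_mx a b) i j = ((a < i)%N && (b < j)%N)%:R.
Proof.
rewrite /psum; case: (ltnP a i) => ai; last first.
  rewrite big1 // => a' a'i; rewrite big1 // => b' _; rewrite mxE.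
  by case: eqP => // e; move: a'i; rewrite e ltnNge ai.
rewrite (bigD1 a) //= [X in _ + X]big1 ?addr0; last first.
  by move=> a' /andP[_ /negPf a'a]; rewrite big1 // => b' _; rewrite mxE a'a.
case: (ltnP b j) => bj; last first.
  rewrite big1 // => b' b'j; rewrite mxE andbC.
  by case: eqP => // e; move: b'j; rewrite e ltnNge bj.
rewrite (bigD1 b) //= big1 ?mxE ?eqxx ?addr0 //.
by move=> b' /andP[_ /negPf b'b]; rewrite mxE b'b andbF.
Qed.

Lemma psum_Etheta (k l : nat) i j : (k < N n)%N -> (l < N n)%N ->
  psum (Etheta n k l) i j =
  ((k < i)%N && (l < j)%N)%:R + ((N n - k.+1 < i)%N && (N n - l.+1 < j)%N)%:R.
Proof. by move=> hk hl; rewrite psumD !psum_delta /= !inordK. Qed.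

Lemma sum_ordS (F : 'I_(N n) -> int) (a : 'I_(N n)) :
  \sum_(b < N n | (b < a.+1)%N) F b = \sum_(b < N n | (b < a)%N) F b + F a.
Proof.
rewrite (bigD1 a) //= addrC; congr (_ + _); apply: eq_bigl => b.
by rewrite ltnS [in RHS]ltn_neqAle andbC.
Qed.

Lemma psumSl M (a : 'I_(N n)) j :
  psum M a.+1 j = psum M a j + \sum_(b < N n | (b < j)%N) M a b.
Proof. exact: sum_ordS. Qed.

Lemma psum_diff M (a b : 'I_(N n)) :
  M a b = psum M a.+1 b.+1 - psum M a b.+1 - psum M a.+1 b + psum M a b.
Proof. by rewrite !psumSl sum_ordS; ring. Qed.

Lemma psum_inj M M' :
  (forall i j, (i <= N n)%N -> (j <= N n)%N -> psum M i j = psum M' i j) -> M = M'.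
Proof.
move=> E; apply/matrixP => a b; rewrite !psum_diff.
by rewrite !E //; apply: ltnW.
Qed.

Lemma psum_row M i : psum M i (N n) = \sum_(a < N n | (a < i)%N) row_sum M a.
Proof. by apply: eq_bigr => a _; apply: eq_bigl => b; rewrite ltn_ord. Qed.

Lemma psum_col M j : psum M (N n) j = \sum_(b < N n | (b < j)%N) col_sum M b.
Proof.
rewrite /psum exchange_big /=; apply: eq_bigr => b _.
by apply: eq_bigl => a; rewrite ltn_ord.
Qed.

Lemma row_sum_psum M (a : 'I_(N n)) : row_sum M a = psum M a.+1 (N n) - psum M a (N n).
Proof. by rewrite !psum_row sum_ordS addrC addKr. Qed.

Lemma col_sum_psum M (a : 'I_(N n)) : col_sum M a = psum M (N n) a.+1 - psum M (N n) a.
Proof. by rewrite !psum_col sum_ordS addrC addKr. Qed.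

Lemma psum_diag M i j : is_diag_mx M ->
  psum M i j = \sum_(a < N n | (a < minn i j)%N) M a a.
Proof.
move/is_diag_mxP => dM.
rewrite (eq_bigl (fun a : 'I_(N n) => (a < i)%N && (a < j)%N)); last first.
  by move=> a; rewrite ltn_min.
rewrite /psum big_mkcondr; apply: eq_bigr => a _; case: ifP => aj.
  rewrite (bigD1 a) //= big1 ?addr0 // => b /andP[_ ba].
  by rewrite dM // eq_sym; apply: contraNN ba => /eqP/val_inj->.
rewrite big1 // => b bj; rewrite dM //; apply: contraFN aj => /eqP e.
by rewrite e.
Qed.
End PartialSums.

Section XiMatrices.
Variables n d : nat.

Lemma theta_symP (T : eqType) (A : 'M[T]_(N n)) :
  reflect (forall i j, A i j = A (rev_ord i) (rev_ord j)) (theta_sym A).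
Proof.
apply: (iffP 'forall_forallP) => h i j; first exact/eqP/h.
by apply/eqP/h.
Qed.

Lemma Xi_mxE (A : Xi n d) i j : Xi_mx A i j = (Xi_entry A i j)%:Z.
Proof. by rewrite mxE. Qed.

Lemma Xi_mx_inj : injective (@Xi_mx n d).
Proof.
move=> A A' /matrixP E; apply: val_inj; apply/matrixP => i j; apply: val_inj.
by have := E i j; rewrite !Xi_mxE => -[].
Qed.

Lemma Xi_mx_ge0 (A : Xi n d) i j : 0 <= Xi_mx A i j.
Proof. by rewrite Xi_mxE. Qed.

Lemma Xi_mx_sym (A : Xi n d) : theta_sym (Xi_mx A).
Proof.
apply/theta_symP => i j; case: A => A /= hA; rewrite !Xi_mxE /Xi_entry /=.
by case/andP: hA => _ /theta_symP ->.
Qed.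

Lemma Xi_mx_sum (A : Xi n d) : \sum_i \sum_j Xi_mx A i j = (dimD d)%:Z.
Proof.
have /andP[/eqP E _] := valP A; rewrite -[in RHS]E Posz_sum; apply: eq_bigr => i _.
by rewrite Posz_sum; apply: eq_bigr => j _; rewrite Xi_mxE.
Qed.

Lemma in_XiP (M : 'M[int]_(N n)) : reflect (exists A : Xi n d, Xi_mx A = M) (in_Xi d M).
Proof. by apply: (iffP existsP) => -[A /eqP]; exists A => //; apply/eqP. Qed.

Lemma in_Xi_mx (A : Xi n d) : in_Xi d (Xi_mx A).
Proof. by apply/in_XiP; exists A. Qed.

(** Nonnegative entries with sum D are at most D, so the bound built into [Xi] comes for free. *)
Lemma in_Xi_intro (M : 'M[int]_(N n)) : (forall i j, 0 <= M i j) -> theta_sym M ->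
  \sum_i \sum_j M i j = (dimD d)%:Z -> in_Xi d M.
Proof.
move=> M0 /theta_symP Ms Msum.
have sumE : (\sum_i \sum_j `|M i j|%N)%N = dimD d.
  have : (\sum_i \sum_j `|M i j|%N)%N%:Z = (dimD d)%:Z; last by case.
  rewrite -Msum Posz_sum; apply: eq_bigr => i _; rewrite Posz_sum.
  by apply: eq_bigr => j _; rewrite gez0_abs.
have leM i j : (`|M i j| < (dimD d).+1)%N.
  rewrite ltnS -sumE (bigD1 i) //= (bigD1 j) //= -!addnA; exact: leq_addr.
pose A : 'M['I_(dimD d).+1]_(N n) := \matrix_(i, j) Ordinal (leM i j).
have hA : Xi_pred A.
  apply/andP; split; last first.
    by apply/theta_symP => i j; apply: val_inj; rewrite !mxE /= Ms.
  by apply/eqP/(etrans _ sumE); apply: eq_bigr => i _; apply: eq_bigr => j _; rewrite mxE.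
apply/in_XiP; exists (exist _ A hA); apply/matrixP => i j.
by rewrite Xi_mxE /Xi_entry /= mxE /= gez0_abs.
Qed.

Lemma in_Xi_sum (M : 'M[int]_(N n)) : in_Xi d M -> \sum_i \sum_j M i j = (dimD d)%:Z.
Proof. by case/in_XiP => A <-; exact: Xi_mx_sum. Qed.

Lemma rev_mid : rev_ord (mid n) = mid n.
Proof. by apply: val_inj; rewrite /= /mid inordK /N; lia. Qed.

End XiMatrices.

(** * Isotropic flags *)

Section OrthogonalSpaces.
Variables (F : finFieldType) (d : nat) (B : 'M[F]_(dimD d)).
Hypotheses (Bsym : B^T = B) (Bunit : B \in unitmx).
Implicit Types U W : 'M[F]_(dimD d).

Lemma sub_orth m (U : 'M[F]_(m, dimD d)) W :
  (U <= orth B W)%MS = (U *m B *m W^T == 0).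
Proof. by rewrite sub_kermx mulmxA. Qed.

Lemma sub_orthC U W : (U <= orth B W)%MS = (W <= orth B U)%MS.
Proof.
rewrite !sub_orth -(inj_eq (@trmx_inj _ _ _)) trmx0.
by rewrite !trmx_mul trmxK Bsym mulmxA.
Qed.

Lemma rank_orth W : (\rank (orth B W) + \rank W)%N = dimD d.
Proof.
rewrite mxrank_ker -[\rank (B *m _)]mxrank_tr trmx_mul trmxK Bsym.
by rewrite mxrankMfree ?row_free_unit // subnK // rank_leq_col.
Qed.

Lemma orthS U W : (U <= W)%MS -> (orth B W <= orth B U)%MS.
Proof. by move=> UW; rewrite sub_orthC (submx_trans UW) // sub_orthC. Qed.

Lemma orthK W : (orth B (orth B W) :=: W)%MS.
Proof.
apply/eqmx_sym/eqmxP; rewrite -mxrank_leqif_eq; last by rewrite sub_orthC.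
have := rank_orth W; have := rank_orth (orth B W); lia.
Qed.

(** The intersection of the two orthogonals is the orthogonal of [U + W]. *)
Lemma rank_cap_orth U W :
  (\rank (orth B U :&: orth B W) + \rank U + \rank W = dimD d + \rank (U :&: W))%N.
Proof.
have -> : \rank (orth B U :&: orth B W) = \rank (orth B (U + W)%MS).
  apply/eqP; rewrite eqn_leq !mxrankS // ?sub_capmx.
    by rewrite !orthS ?addsmxSl ?addsmxSr.
  rewrite sub_orthC addsmx_sub; apply/andP.
  by split; rewrite sub_orthC ?capmxSl ?capmxSr.
have := rank_orth (U + W)%MS; have := mxrank_sum_cap U W; lia.
Qed.
End OrthogonalSpaces.

Section Flags.
Variables (F : finFieldType) (n d : nat) (B : 'M[F]_(dimD d)).
Hypotheses (Bsym : B^T = B) (Bunit : B \in unitmx).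
Implicit Types V : flag F n d.

Definition fl V (i : nat) : 'M[F]_(dimD d) := V (inord i).
Definition rho V V' i j : nat := \rank (fl V i :&: fl V' j)%MS.

Lemma flE V (i : 'I_(N n).+1) : V i = fl V i.
Proof. by rewrite /fl inord_val. Qed.

Lemma flag_ext V V' : (forall i, (i <= N n)%N -> fl V i = fl V' i) -> V = V'.
Proof. by move=> E; apply/ffunP => i; rewrite !flE E // -ltnS. Qed.

Lemma is_flagP V :
  reflect [/\ forall i, (i <= N n)%N -> <<fl V i>>%MS = fl V i,
              forall i, (i < N n)%N -> (fl V i <= fl V i.+1)%MS,
              fl V 0 = 0, \rank (fl V (N n)) = dimD d
            & forall i, (i <= N n)%N -> (fl V i :=: orth B (fl V (N n - i)))%MS]
          (is_flag B V).
Proof.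
have revE (i : 'I_(N n).+1) : V (rev_ord i) = fl V (N n - i).
  by rewrite flE /= subSS.
apply: (iffP and5P) => [[/forallP h1 /forallP h2 /eqP h3 h4 /forallP h5]|[h1 h2 h3 h4 h5]].
  split=> [i hi|i hi|||i hi].
  - by have /eqP := h1 (inord i).
  - by have := h2 (Ordinal hi).
  - by rewrite -[RHS]h3 flE.
  - by apply/eqP; rewrite -[_ == _]/(row_full _) -sub1mx; move: h4; rewrite flE.
  - by have /eqmxP := h5 (inord i); rewrite revE inordK.
split.
- by apply/forallP => i; rewrite flE h1 // -ltnS.
- by apply/forallP => i; apply: h2.
- by rewrite flE h3.
- by rewrite flE sub1mx /row_full h4.
- by apply/forallP => i; apply/eqmxP; rewrite revE flE; apply: h5; rewrite -ltnS.
Qed.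

Section OneFlag.
Variables (V : flag F n d) (hV : is_flag B V).

Lemma flag_gen i : (i <= N n)%N -> <<fl V i>>%MS = fl V i.
Proof. by case/is_flagP: hV => h *; apply: h. Qed.
Lemma flag_sub i j : (i <= j)%N -> (j <= N n)%N -> (fl V i <= fl V j)%MS.
Proof.
case/is_flagP: hV => _ h _ _ _; elim: j => [|j IH] ij jN.
  by move: ij; rewrite leqn0 => /eqP->.
move: ij; rewrite leq_eqVlt => /orP[/eqP->//|ij].
by apply: submx_trans (h _ jN); apply: IH => //; apply: ltnW.
Qed.
Lemma flag0 : fl V 0 = 0. Proof. by case/is_flagP: hV. Qed.
Lemma flagN : \rank (fl V (N n)) = dimD d. Proof. by case/is_flagP: hV. Qed.
Lemma flag_orth i : (i <= N n)%N -> (fl V i :=: orth B (fl V (N n - i)))%MS.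
Proof. by case/is_flagP: hV => _ _ _ _ h /h. Qed.
Lemma flag_subN i m (W : 'M[F]_(m, dimD d)) : (i = N n)%N -> (W <= fl V i)%MS.
Proof. by move=> ->; apply: submx_full; rewrite /row_full flagN. Qed.

(** Flags store canonical generating matrices, so equal row spaces give equal matrices. *)
Lemma flag_eqP i W : (i <= N n)%N -> <<W>>%MS = W -> (fl V i :=: W)%MS -> fl V i = W.
Proof. by move=> iN <- /eq_genmx; rewrite genmx_id flag_gen. Qed.

Lemma rank_flag_dual i : (i <= N n)%N ->
  (\rank (fl V (N n - i)) + \rank (fl V i) = dimD d)%N.
Proof.
move=> iN; have iN' : (N n - i <= N n)%N by apply: leq_subr.
by rewrite (flag_orth iN') subKn // rank_orth.
Qed.
End OneFlag.

Section TwoFlags.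
Variables (V V' : flag F n d) (hV : is_flag B V) (hV' : is_flag B V').

Lemma rho0l j : rho V V' 0 j = 0%N.
Proof. by rewrite /rho (flag0 hV) cap0mx mxrank0. Qed.
Lemma rho0r i : rho V V' i 0 = 0%N.
Proof. by rewrite /rho (flag0 hV') capmx0 mxrank0. Qed.
Lemma rhoNl j : rho V V' (N n) j = \rank (fl V' j).
Proof.
apply/eqP; rewrite eqn_leq !mxrankS ?capmxSr //.
by rewrite sub_capmx submx_refl (flag_subN hV).
Qed.
Lemma rhoNr i : rho V V' i (N n) = \rank (fl V i).
Proof.
apply/eqP; rewrite eqn_leq !mxrankS ?capmxSl //.
by rewrite sub_capmx submx_refl (flag_subN hV').
Qed.

(** V_{N-i} cap V'_{N-j} is the orthogonal of V_i + V'_j. This is the source of the rotation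
    symmetry of relative positions. *)
Lemma rho_dual i j : (i <= N n)%N -> (j <= N n)%N ->
  (rho V V' (N n - i) (N n - j) + \rank (fl V i) + \rank (fl V' j) =
   dimD d + rho V V' i j)%N.
Proof.
move=> iN jN; rewrite -(rank_cap_orth Bsym Bunit) /rho.
congr (_ + _ + _)%N; apply/eqmx_rank/eqmxP/cap_eqmx.
  by apply: eqmx_trans (flag_orth hV (leq_subr _ _)) _; rewrite subKn.
by apply: eqmx_trans (flag_orth hV' (leq_subr _ _)) _; rewrite subKn.
Qed.

(** Since V_i lies in V_{i+1}, dim (V_i + V_{i+1} cap V'_k) = dim V_i + dim (V_{i+1} cap V'_k) - dim
    (V_i cap V'_k). *)
Lemma relposE (i j : 'I_(N n)) :
  (relpos V V' i j)%:Z = (rho V V' i.+1 j.+1)%:Z - (rho V V' i j.+1)%:Z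
                         - (rho V V' i.+1 j)%:Z + (rho V V' i j)%:Z.
Proof.
have key k : (k <= N n)%N -> (\rank (fl V i + fl V i.+1 :&: fl V' k)%MS + rho V V' i k
    = \rank (fl V i) + rho V V' i.+1 k)%N.
  move=> kN; rewrite -(mxrank_sum_cap (fl V i)); congr (_ + _)%N.
  apply/eqmx_rank/eqmxP; rewrite capmxA; apply: cap_eqmx => //.
  apply/eqmx_sym/eqmxP; rewrite capmxSl sub_capmx submx_refl.
  exact: (flag_sub hV).
have le : (\rank (fl V i + fl V i.+1 :&: fl V' j)%MS <=
           \rank (fl V i + fl V i.+1 :&: fl V' j.+1)%MS)%N.
  by apply: mxrankS; apply: addsmxS => //; apply: capmxS => //; apply: (flag_sub hV').
have k1 := key j.+1 (ltn_ord j); have k0 := key j (ltnW (ltn_ord j)).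
rewrite /relpos -!/(fl _ _); clear -k0 k1 le; lia.
Qed.

Lemma psum_relpos i j : (i <= N n)%N -> (j <= N n)%N ->
  psum (\matrix_(a, b) (relpos V V' a b)%:Z) i j = (rho V V' i j)%:Z.
Proof.
move=> iN jN; rewrite /psum.
have rowE (a : 'I_(N n)) : \sum_(b < N n | (b < j)%N) (relpos V V' a b)%:Z =
    (rho V V' a.+1 j)%:Z - (rho V V' a j)%:Z.
  elim: j jN => [|j IH] jN; first by rewrite big_pred0_eq !rho0r.
  by rewrite (sum_ordS _ (Ordinal jN)) (IH (ltnW jN)) relposE /=; ring.
elim: i iN => [|i IH] iN; first by rewrite big_pred0_eq rho0l.
rewrite (sum_ordS _ (Ordinal iN)) (IH (ltnW iN)) /=.
under eq_bigr do rewrite mxE.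
by rewrite rowE /=; ring.
Qed.

Lemma in_orbitP (A : Xi n d) :
  reflect (forall i j, (i <= N n)%N -> (j <= N n)%N ->
             psum (Xi_mx A) i j = (rho V V' i j)%:Z)
          (in_orbit A V V').
Proof.
apply: (iffP 'forall_forallP) => [h i j iN jN|h i j].
  rewrite -psum_relpos //; congr psum; apply/matrixP => a b.
  by rewrite !mxE (eqP (h a b)).
have : Xi_mx A = \matrix_(a, b) (relpos V V' a b)%:Z.
  by apply: psum_inj => a b aN bN; rewrite h // psum_relpos.
by move/matrixP/(_ i j); rewrite !mxE => -[->].
Qed.

Lemma in_orbit_ex : exists A : Xi n d, in_orbit A V V'.
Proof.
pose M : 'M[int]_(N n) := \matrix_(a, b) (relpos V V' a b)%:Z.
have : in_Xi d M.
  apply: in_Xi_intro => [i j||].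
  - by rewrite mxE.
  - apply/theta_symP => i j; rewrite !mxE !relposE /=.
    have := rho_dual (ltn_ord i) (ltn_ord j).
    have := rho_dual (ltnW (ltn_ord i)) (ltn_ord j).
    have := rho_dual (ltn_ord i) (ltnW (ltn_ord j)).
    have := rho_dual (ltnW (ltn_ord i)) (ltnW (ltn_ord j)).
    rewrite !subnSK //; lia.
  - have := psum_relpos (leqnn (N n)) (leqnn (N n)).
    rewrite rhoNl (flagN hV') psum_row => <-.
    by apply: eq_bigl => a; rewrite ltn_ord.
case/in_XiP => A EA; exists A; apply/in_orbitP => i j iN jN.
by rewrite EA psum_relpos.
Qed.

Lemma in_orbit_inj (A A' : Xi n d) : in_orbit A V V' -> in_orbit A' V V' -> A = A'.
Proof.
move=> /in_orbitP h /in_orbitP h'; apply: Xi_mx_inj.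
by apply: psum_inj => i j iN jN; rewrite h ?h'.
Qed.
End TwoFlags.
End Flags.

(** * Flags that differ from a given one by a line *)

Section Steps.
Variable n : nat.

(** The change of position relative to a flag V2 when the space V_h of the first flag gains a line
    that enters at column c ([near_rho]): a box moves from row h to row h - 1, and its rotated copy
    moves along. *)
Definition step (h : nat) (c : 'I_(N n)) : 'M[int]_(N n) :=
  Etheta n h.-1 c - Etheta n h c.

(** Moving a box between adjacent rows affects the partial sums only at the boundary between them;
    the rotated box affects those at N - h. *)
Lemma psum_step h c i j : (0 < h < N n)%N ->
  psum (step h c) i j = ((i == h) && (c < j)%N)%:R
                        - ((i == N n - h)%N && (N n - c.+1 < j)%N)%:R.
Proof.
move=> /andP[h0 hN]; have hN' := leq_ltn_trans (leq_pred h) hN.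
rewrite psumB !psum_Etheta //.
have -> : (N n - h.+1 < i)%N = (N n - h <= i)%N by rewrite subnS predn_ltn ?subn_gt0.
by rewrite (prednK h0) !andb_natr (leq_natr h) (leq_natr (N n - h)); ring.
Qed.

(** As N is odd, h and N - h differ, so the partial sums up to row h see c alone. *)
Lemma step_inj h c c' : (0 < h < N n)%N -> step h c = step h c' -> c = c'.
Proof.
move=> hh E; apply: val_inj; apply/eqP.
have key j : (c < j)%N = (c' < j)%N.
  have := congr1 (fun M => psum M h j) E; rewrite !psum_step // eqxx /=.
  have -> : (h == N n - h)%N = false by apply/eqP; rewrite /N; lia.
  by rewrite !subr0; do 2!case: (_ < j)%N.
by rewrite /= eqn_leq leqNgt -key ltnn leqNgt key ltnn.
Qed.
End Steps.

Section Near.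
Variables (F : finFieldType) (n d : nat) (B : 'M[F]_(dimD d)).
Hypotheses (Bsym : B^T = B) (Bunit : B \in unitmx).
Variables (h : nat) (hh : (0 < h < N n)%N).
Implicit Types V : flag F n d.

(** V_{N-h} is not mentioned because duality determines it from V_h. *)
Definition near V1 V : Prop :=
  [/\ forall i, (i <= N n)%N -> i != h -> i != (N n - h)%N -> fl V i = fl V1 i,
      (fl V1 h <= fl V h)%MS
    & \rank (fl V h) = (\rank (fl V1 h)).+1].

Lemma rank_capl m1 m2 p (U : 'M[F]_(m1, p)) (W : 'M[F]_(m2, p)) :
  \rank (U :&: W)%MS = \rank U -> (U <= W)%MS.
Proof.
by move=> E; apply/capmx_idPl/eqmxP; rewrite -mxrank_leqif_eq ?capmxSl // E.
Qed.

(** For i distinct from h and N - h, the partial sum of [B0] at (i, i) equals both marginals, which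
    forces V_i = V1_i. Conversely, the spaces of two near flags are pairwise nested, so that the
    partial sums only record dimensions. *)
Lemma near_orbit (l : 'M[int]_(N n)) (B0 : Xi n d) V1 V : is_diag_mx l ->
  Xi_mx B0 = l + Etheta n h h.-1 -> is_flag B V1 -> is_flag B V ->
  in_orbit B0 V1 V <->
  (forall i, (i <= N n)%N -> psum (Xi_mx B0) i (N n) = (\rank (fl V1 i))%:Z) /\
  near V1 V.
Proof.
move=> ld E hV1 hV.
pose s i := \sum_(a < N n | (a < i)%N) l a a.
have hNh : (N n - h <> h)%N by rewrite /N; lia.
have [h0 hN'] := andP hh; have hN := ltnW hN'.
have psE i j : psum (Xi_mx B0) i j = s (minn i j) + ((h < i) && (h <= j))%N%:R
      + ((N n - h <= i)%N && (N n - h < j)%N)%:R.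
  have hpN := leq_ltn_trans (leq_pred h) hN'; rewrite E psumD psum_diag // psum_Etheta //.
  by rewrite (prednK h0) addrA subnS predn_ltn ?subn_gt0.
split=> [/(in_orbitP hV1 hV) o|[r [nE nS nR]]].
  have r1 i : (i <= N n)%N -> psum (Xi_mx B0) i (N n) = (\rank (fl V1 i))%:Z.
    by move=> iN; rewrite o // (rhoNr V1 hV).
  have r2 i : (i <= N n)%N -> psum (Xi_mx B0) (N n) i = (\rank (fl V i))%:Z.
    by move=> iN; rewrite o // (rhoNl V hV1).
  split=> //; split=> [i iN ih ih'||].
  - have := r1 i iN; have := r2 i iN; have := o i i iN iN.
    have b1 : ((h < i) && (h <= i))%N = (h <= i)%N by rewrite (leq_eqVlt h) eq_sym (negPf ih) andbb.
    have b2 : ((N n - h <= i) && (N n - h < i))%N = (N n - h < i)%N.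
      by rewrite (leq_eqVlt (N n - h)) eq_sym (negPf ih') andbb.
    have b3 : ((h < i) && (h <= N n))%N = (h <= i)%N by rewrite hN andbT (leq_eqVlt h) eq_sym (negPf ih).
    have b4 : ((N n - h <= i) && (N n - h < N n))%N = (N n - h < i)%N.
      by rewrite (leq_eqVlt (N n - h)) eq_sym (negPf ih') ltn_subrL h0 andbT.
    have b5 : ((h < N n) && (h <= i))%N = (h <= i)%N by rewrite hN'.
    have b6 : ((N n - h <= N n) && (N n - h < i))%N = (N n - h < i)%N by rewrite leq_subr.
    rewrite !psE minnn (minn_idPl iN) (minn_idPr iN) b1 b2 b3 b4 b5 b6 => e1 e2 e3.
    have [e4 e5] : rho V1 V i i = \rank (fl V1 i) /\ rho V1 V i i = \rank (fl V i).
      by move: e1 e2 e3; clear; lia.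
    apply: (flag_eqP hV iN (flag_gen hV1 iN)); apply/eqmxP/andP.
    by split; apply: rank_capl; rewrite // -e5 /rho capmxC.
  - have := r1 h hN; have := o h h hN hN; rewrite !psE minnn (minn_idPl hN).
    have b1 : (N n - h < h)%N = (N n - h <= h)%N by rewrite (leq_eqVlt (N n - h)) (introF eqP hNh).
    rewrite ltnn b1 andbb ltn_subrL h0 (leq_ltn_trans _ hN') // andbT => e1 e2.
    by apply: rank_capl; rewrite -/(rho _ _ _ _); move: e1 e2; clear; lia.
  have := r1 h hN; have := r2 h hN; rewrite !psE (minn_idPl hN) (minn_idPr hN).
  have b1 : (N n - h < h)%N = (N n - h <= h)%N by rewrite (leq_eqVlt (N n - h)) (introF eqP hNh).
  rewrite ltnn leqnn hN' leq_subr b1 ltn_subrL h0 (leq_ltn_trans _ hN') // andbT.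
  by clear; lia.
apply/(in_orbitP hV1 hV) => i j iN jN.
have nR' : (\rank (fl V1 (N n - h))) = (\rank (fl V (N n - h))).+1.
  have := rank_flag_dual Bsym Bunit hV hN; have := rank_flag_dual Bsym Bunit hV1 hN.
  by rewrite nR; clear; lia.
have nS' : (fl V (N n - h) <= fl V1 (N n - h))%MS.
  rewrite (flag_orth hV) ?leq_subr // (flag_orth hV1) ?leq_subr // subKn //.
  exact: (orthS Bsym).
have rkV k : (k <= N n)%N -> (\rank (fl V k))%:Z =
    (\rank (fl V1 k))%:Z + (k == h)%:R - (k == N n - h)%N%:R.
  move=> kN; have [->|kh] := eqVneq k h.
    by rewrite nR eq_sym (introF eqP hNh); clear; lia.
  have [->|kh'] := eqVneq k (N n - h)%N; first by rewrite nR'; clear; lia.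
  by rewrite nE //; clear; lia.
have rE k : (k <= N n)%N -> (\rank (fl V1 k))%:Z =
   s k + (h < k)%N%:R + (N n - h <= k)%N%:R.
  by move=> kN; rewrite -r // psE (minn_idPl kN) hN ltn_subrL h0 (leq_ltn_trans _ hN') // !andbT.
(* For i <= j, V1_i lies in V_j except at (N - h, N - h); for j <= i, V_j lies in V1_i except at (h,
   h). Hence every intersection is one of the two spaces. *)
have subl : (i <= j)%N -> ~~ ((i == N n - h)%N && (j == N n - h)%N) ->
    (fl V1 i <= fl V j)%MS.
  move=> ij; have [je|jh] := eqVneq j h.
    rewrite je => _; apply: submx_trans nS; apply: (flag_sub hV1); lia.
  have [je|jh'] := eqVneq j (N n - h)%N; last first.
    by rewrite (nE j) // => _; apply: (flag_sub hV1).
  rewrite je andbT => ij'.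
  have [ih|ih] := eqVneq i h.
    rewrite ih (submx_trans nS) //; apply: (flag_sub hV); lia.
  rewrite -(nE i) //; apply: (flag_sub hV); lia.
have subr : (j <= i)%N -> ~~ ((i == h)%N && (j == h)%N) ->
    (fl V j <= fl V1 i)%MS.
  move=> ij; have [je|jh] := eqVneq j h.
    rewrite je andbT => ih.
    have [ih'|ih'] := eqVneq i (N n - h)%N; last first.
      rewrite -(nE i) //; apply: (flag_sub hV); lia.
    rewrite ih' (submx_trans _ nS') //; apply: (flag_sub hV); lia.
  have [je|jh'] := eqVneq j (N n - h)%N.
    rewrite je => _; rewrite (submx_trans nS') //; apply: (flag_sub hV1); lia.
  by rewrite (nE j) // => _; apply: (flag_sub hV1).
have rl : (fl V1 i <= fl V j)%MS -> rho V1 V i j = \rank (fl V1 i).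
  by move=> ss; apply/eqmx_rank/andP; rewrite capmxSl sub_capmx submx_refl.
have rr : (fl V j <= fl V1 i)%MS -> rho V1 V i j = \rank (fl V j).
  by move=> ss; apply/eqmx_rank/andP; rewrite capmxSr sub_capmx submx_refl andbT.
rewrite psE; case: (leqP i j) => ij.
  have [/andP[/eqP ie /eqP je]|ne] := boolP ((i == N n - h)%N && (j == N n - h)%N).
    rewrite rr; last by rewrite ie je.
    rewrite ie je rkV ?leq_subr // rE ?leq_subr // leqnn ltnn eqxx (introF eqP hNh).
    have -> : ((h < N n - h) && (h <= N n - h))%N = (h < N n - h)%N.
      by rewrite (leq_eqVlt h) eq_sym (introF eqP hNh) andbb.
    by clear; lia.
  rewrite rl ?rE //; last exact: subl.
  have -> : ((h < i) && (h <= j))%N = (h < i)%N by move: ij; clear; lia.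
  have -> // : ((N n - h <= i) && (N n - h < j))%N = (N n - h <= i)%N.
  by move: ij ne; move: (N n - h)%N => k; clear; lia.
rewrite rr ?rkV ?rE //; last by apply: subr; [exact: ltnW|move: ij; clear; lia].
have -> : ((h < i) && (h <= j))%N = (h <= j)%N by move: ij; clear; lia.
have -> : ((N n - h <= i) && (N n - h < j))%N = (N n - h < j)%N.
  by move: ij; move: (N n - h)%N => k; clear; lia.
by rewrite (leq_natr h) (leq_natr (N n - h)); ring.
Qed.
End Near.

Section NearFlags.
Variables (F : finFieldType) (n d : nat) (B : 'M[F]_(dimD d)).
Hypotheses (Bsym : B^T = B) (Bunit : B \in unitmx).
Variables (h : nat) (hh : (0 < h < N n)%N).
Implicit Types (V : flag F n d) (x : 'rV[F]_(dimD d)).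

Lemma rank_addrow m p (W : 'M[F]_(m, p)) (x : 'rV[F]_p) :
  \rank (W + x)%MS = (\rank W + ~~ (x <= W)%MS)%N.
Proof.
case: (boolP (x <= W)%MS) => xW /=.
  by rewrite addn0; apply/eqmx_rank/andP; rewrite addsmxSl addsmx_sub submx_refl.
have x1 : \rank x = 1%N.
  apply/eqP; rewrite eqn_leq rank_leq_row lt0n mxrank_eq0.
  by apply: contraNN xW => /eqP->; exact: sub0mx.
have := mxrank_sum_cap W x; have := rank_capl (U := x) (W := W); rewrite capmxC x1.
have := mxrankS (capmxSr W x); rewrite x1.
case E: (\rank (W :&: x)%MS) => [|[|//]] _; first by clear; lia.
by move=> /(_ erefl) xW'; rewrite xW' in xW.
Qed.

Lemma iso_addrow (W : 'M[F]_(dimD d)) x :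
  (x <= orth B W)%MS -> x *m B *m x^T = 0 -> (x <= orth B (W + x)%MS)%MS.
Proof.
rewrite !sub_orth => /eqP xW xx.
have E m (U : 'M[F]_(m, dimD d)) : (U <= kermx (x *m B)^T)%MS = (x *m B *m U^T == 0).
  by rewrite sub_kermx -(inj_eq (@trmx_inj _ _ _)) trmx_mul trmxK trmx0.
by rewrite -E addsmx_sub !E xW xx !eqxx.
Qed.

(** The jump of a monotone Boolean function: it gives the column at which a vector enters an
    increasing chain of spaces. *)
Lemma threshold (b : nat -> bool) m : b 0%N = false -> b m ->
  (forall i j, (i <= j)%N -> (j <= m)%N -> b i -> b j) ->
  exists c : 'I_m, forall j, (j <= m)%N -> b j = (c < j)%N.
Proof.
move=> b0 bm mono; case: (ex_minnP (ex_intro _ m bm)) => p bp pmin.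
have p0 : (0 < p)%N by case: p bp {pmin} => //; rewrite b0.
have pm : (p.-1 < m)%N by rewrite prednK // pmin.
exists (Ordinal pm) => j jm /=; rewrite prednK //.
by apply/idP/idP => [/pmin//|pj]; apply: mono bp.
Qed.

Lemma near_add V1 V x : near h V1 V -> (x <= fl V h)%MS -> ~~ (x <= fl V1 h)%MS ->
  (fl V h :=: fl V1 h + x)%MS.
Proof.
case=> _ nS nR xV xV1; apply/eqmx_sym/eqmxP; rewrite -mxrank_leqif_eq.
  by rewrite rank_addrow xV1 nR addn1.
by rewrite addsmx_sub nS.
Qed.

(** V_h + V2_j is spanned by V1_h + V2_j and x, so it is larger iff x lies outside V1_h + V2_j. The
    dimension formula turns this into the change of V_h cap V2_j, and duality gives the row N -
    h. *)
Lemma near_rho V1 V2 V x : is_flag B V1 -> is_flag B V2 -> is_flag B V ->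
  near h V1 V -> (x <= fl V h)%MS -> ~~ (x <= fl V1 h)%MS ->
  exists c : 'I_(N n),
    (forall j, (j <= N n)%N -> (x <= fl V1 h + fl V2 j)%MS = (c < j)%N) /\
    (forall i j, (i <= N n)%N -> (j <= N n)%N ->
      (rho V V2 i j)%:Z = (rho V1 V2 i j)%:Z + psum (step h c) i j).
Proof.
move=> hV1 hV2 hV hn xV xV1; have Vx := near_add hn xV xV1; have [nE nS nR] := hn.
have hN : (h <= N n)%N by case/andP: hh => _ /ltnW.
have [c cP] : exists c : 'I_(N n), forall j, (j <= N n)%N ->
    (x <= fl V1 h + fl V2 j)%MS = (c < j)%N.
  apply: threshold => [||i j ij jN].
  - by rewrite (flag0 hV2) addsmx0; apply: negbTE.
  - by rewrite (submx_trans (flag_subN hV2 x (erefl _))) // addsmxSr.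
  - by move/submx_trans; apply; apply: addsmxS => //; apply: (flag_sub hV2).
exists c; split=> // i j iN jN; rewrite psum_step //.
have key k : (k <= N n)%N -> rho V V2 h k = (rho V1 V2 h k + (c < k)%N)%N.
  move=> kN; have := mxrank_sum_cap (fl V h) (fl V2 k).
  have := mxrank_sum_cap (fl V1 h) (fl V2 k).
  have -> : \rank (fl V h + fl V2 k)%MS = (\rank (fl V1 h + fl V2 k)%MS + ~~ (c < k)%N)%N.
    rewrite -cP // -rank_addrow; apply/eqmx_rank/eqmxP.
    apply: eqmx_trans (adds_eqmx Vx (eqmx_refl _)) _.
    by rewrite -addsmxA [(x + _)%MS]addsmxC addsmxA.
  rewrite -!/(rho _ _ _ _) nR; case: (c < k)%N => /=; clear; lia.
have [->|ih] := eqVneq i h.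
  rewrite key // (_ : (h == N n - h)%N = false) /=; last by apply/eqP; rewrite /N; lia.
  by clear; lia.
have [->|ih'] := eqVneq i (N n - h)%N; last first.
  by rewrite /rho nE //=; clear; lia.
rewrite /=.
have := rho_dual Bsym Bunit hV hV2 hN (leq_subr j (N n)).
have := rho_dual Bsym Bunit hV1 hV2 hN (leq_subr j (N n)).
rewrite subKn // key ?leq_subr // nR.
have -> : (N n - c.+1 < j)%N = ~~ (c < N n - j)%N.
  by have := ltn_ord c; move: jN; clear; lia.
by case: (c < _)%N => /=; clear; lia.
Qed.

Definition near_flag V1 x : flag F n d :=
  let W := (fl V1 h + x)%MS in
  [ffun i : 'I_(N n).+1 => if (i == h :> nat) then <<W>>%MS
     else if (i == (N n - h)%N :> nat) then <<orth B W>>%MS else V1 i].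

Lemma fl_near_flag V1 x i : (i <= N n)%N ->
  fl (near_flag V1 x) i =
  if i == h then <<(fl V1 h + x)%MS>>%MS
  else if (i == N n - h)%N then <<orth B (fl V1 h + x)%MS>>%MS else fl V1 i.
Proof. by move=> iN; rewrite {1}/fl ffunE inordK. Qed.

Lemma near_flag_near V1 x : ~~ (x <= fl V1 h)%MS -> near h V1 (near_flag V1 x).
Proof.
move=> xV1; have hN : (h <= N n)%N by case/andP: hh => _ /ltnW.
split.
- by move=> i iN /negPf ih /negPf ih'; rewrite fl_near_flag // ih ih'.
- by rewrite fl_near_flag // eqxx genmxE addsmxSl.
- by rewrite fl_near_flag // eqxx genmxE rank_addrow xV1 addn1.
Qed.

Lemma near_flag_eq V1 V x : is_flag B V -> near h V1 V ->
  (x <= fl V h)%MS -> ~~ (x <= fl V1 h)%MS -> near_flag V1 x = V.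
Proof.
move=> hV hn xV xV1; have Vx := near_add hn xV xV1; have [nE _ _] := hn.
have hN : (h <= N n)%N by case/andP: hh => _ /ltnW.
apply: flag_ext => i iN; rewrite fl_near_flag //.
case: eqP => [->|/eqP ih].
  by rewrite -(eq_genmx Vx) (flag_gen hV).
case: eqP => [->|/eqP ih']; last by rewrite nE.
rewrite -[RHS](flag_gen hV) ?leq_subr //; apply: eq_genmx.
apply: eqmx_sym; apply: eqmx_trans (flag_orth hV (leq_subr _ _)) _; rewrite subKn //.
by apply/eqmxP; rewrite !(orthS Bsym) ?Vx.
Qed.

(** For h = n one has N - h = h + 1, and V_{h+1} becomes the orthogonal of V1_h + x, which has to
    contain x. This is where isotropy enters. *)
Lemma near_flag_is_flag V1 x : is_flag B V1 -> (x <= fl V1 h.+1)%MS ->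
  (h = n -> x *m B *m x^T = 0) -> is_flag B (near_flag V1 x).
Proof.
move=> hV1 xh iso.
have hN : (h <= N n)%N by case/andP: hh => _ /ltnW.
have orthV i : (i <= N n)%N -> (orth B (fl V1 i) :=: fl V1 (N n - i))%MS.
  move=> iN; apply: eqmx_sym; rewrite -{2}(subKn iN); exact: (flag_orth hV1 (leq_subr _ _)).
have Wsub : (fl V1 h + x <= fl V1 h.+1)%MS.
  by rewrite addsmx_sub xh (flag_sub hV1) //; move: hh; clear; lia.
have Wsup : (orth B (fl V1 h + x)%MS <= fl V1 (N n - h))%MS.
  by rewrite -(orthV _ hN) (orthS Bsym) // addsmxSl.
have Wsup' : (fl V1 (N n - h.+1) <= orth B (fl V1 h + x)%MS)%MS.
  by rewrite -(orthV h.+1) ?(orthS Bsym) //; move: hh; clear; lia.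
apply/is_flagP; split.
- move=> i iN; rewrite fl_near_flag //.
  by case: ifP => _; [|case: ifP => _]; rewrite ?genmx_id // (flag_gen hV1).
- move=> i iN; rewrite !fl_near_flag //; last exact: ltnW.
  have [ih|ih] := eqVneq i h.
    rewrite ih (_ : h.+1 == h = false); last by clear; lia.
    rewrite genmxE; case: eqP => [e|_] //.
    have hnE : h = n by move: e hN; rewrite /N; clear; lia.
    have V1o : (orth B (fl V1 h) :=: fl V1 h.+1)%MS by apply: eqmx_trans (orthV _ hN) _; rewrite -e.
    rewrite genmxE addsmx_sub (sub_orthC Bsym) V1o Wsub /=.
    by apply: iso_addrow; rewrite ?V1o // iso.
  have [ih'|ih'] := eqVneq i (N n - h)%N.
    rewrite genmxE (submx_trans Wsup) // ih'.
    have [e|e] := eqVneq (N n - h).+1 h.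
      rewrite genmxE (submx_trans _ (addsmxSl _ _)) //.
      by apply: (flag_sub hV1) => //; move: e; clear; lia.
    rewrite (_ : (_.+1 == _)%N = false); last by clear; lia.
    by apply: (flag_sub hV1); move: iN; rewrite ?ih'; clear; lia.
  case: eqP => [e|_].
    rewrite genmxE (submx_trans _ (addsmxSl _ _)) //.
    by apply: (flag_sub hV1); move: e iN; clear; lia.
  case: eqP => [e|_].
    rewrite genmxE (submx_trans _ Wsup') // (_ : N n - h.+1 = i)%N //.
    by move: e; clear; lia.
  by apply: (flag_sub hV1); move: iN; clear; lia.
- rewrite fl_near_flag // !ifN ?(flag0 hV1) //; move: hh; clear; lia.
- rewrite fl_near_flag // !ifN ?(flagN hV1) //; move: hh; clear; lia.
move=> i iN; rewrite !fl_near_flag ?leq_subr //.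
have NhE : (N n - h == h)%N = false by rewrite /N; move: hh; clear; lia.
have [->|ih] := eqVneq i h.
  rewrite NhE eqxx; apply/eqmx_sym.
  apply: eqmx_trans _ (eqmx_sym (genmxE _)).
  apply: eqmx_trans _ (orthK Bsym Bunit _).
  by apply/eqmxP; rewrite !(orthS Bsym) ?genmxE.
have [->|ih'] := eqVneq i (N n - h)%N.
  rewrite subKn // eqxx; apply: eqmx_trans (genmxE _) _.
  by apply/eqmxP; rewrite !(orthS Bsym) ?genmxE.
rewrite !ifN; first exact: (flag_orth hV1).
  by move: ih iN hN; clear; lia.
by move: ih' iN hN; clear; lia.
Qed.
End NearFlags.

(** * Counting isotropic vectors *)

Section CoordinateSpaces.
Variables (F : finFieldType) (D : nat).
Implicit Types (S T : {set 'I_D}) (x : 'rV[F]_D).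

Definition coord_space S : 'M[F]_D :=
  let a : 'rV[F]_D := \row_i (i \in S)%:R in <<diag_mx a>>%MS.

Lemma coord_space_gen S : <<coord_space S>>%MS = coord_space S.
Proof. exact: genmx_id. Qed.

Lemma sub_coord_space x S :
  (x <= coord_space S)%MS = [forall i, (i \notin S) ==> (x 0 i == 0)].
Proof.
rewrite genmxE; apply/submxP/'forall_implyP => [[y ->] i iS|xS].
  by rewrite mul_mx_diag !mxE (negPf iS) mulr0.
exists x; apply/rowP => i; rewrite mul_mx_diag !mxE.
by case: (boolP (i \in S)) => [|/xS/eqP->]; rewrite ?mulr1 ?mul0r.
Qed.

Lemma sub_coord_spaceP x S :
  reflect (forall i, i \notin S -> x 0 i = 0) (x <= coord_space S)%MS.
Proof.
rewrite sub_coord_space; apply: (iffP 'forall_implyP) => h i /h; last by move=> ->.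
by move/eqP.
Qed.

Lemma card_coord_space S :
  #|[set x : 'rV[F]_D | (x <= coord_space S)%MS]| = (#|F| ^ #|S|)%N.
Proof.
rewrite -(card_pffun_on (0 : F) S F) /=.
pose f (g : {ffun 'I_D -> F}) : 'rV[F]_D := \row_i g i.
have f_inj : injective f.
  by move=> g g' /rowP E; apply/ffunP => i; have := E i; rewrite !mxE.
rewrite -(card_imset _ f_inj); apply: eq_card => x; rewrite inE.
apply/sub_coord_spaceP/imsetP => [xS|[g /pffun_onP[gS _] ->] i iS].
  exists [ffun i => x 0 i]; last by apply/rowP => i; rewrite mxE ffunE.
  apply/pffun_onP; split=> //; apply/subsetP => i; apply: contraTT => /xS xi.
  by rewrite !inE ffunE xi eqxx.
rewrite mxE; apply/eqP; apply: contraNT iS => gi.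
by have /subsetP := gS; apply.
Qed.

Lemma rank_coord_space S : \rank (coord_space S) = #|S|.
Proof.
apply/eqP; rewrite -(eqn_exp2l _ _ (finNzRing_gt1 F)) -card_rowg -card_coord_space.
by apply/eqP/eq_card => x; rewrite mem_rowg.
Qed.

Lemma coord_space_sub S T : S \subset T -> (coord_space S <= coord_space T)%MS.
Proof.
move=> ST; apply/rV_subP => x /sub_coord_spaceP h; apply/sub_coord_spaceP => i iT.
by apply: h; apply: contraNN iT; apply: subsetP.
Qed.

Lemma coord_space_cap S T :
  (coord_space S :&: coord_space T :=: coord_space (S :&: T))%MS.
Proof.
apply/eqmxP/andP; split; last first.
  by rewrite sub_capmx !coord_space_sub ?subsetIl ?subsetIr.
apply/rV_subP => x; rewrite sub_capmx => /andP[/sub_coord_spaceP h /sub_coord_spaceP h'].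
apply/sub_coord_spaceP => i; rewrite inE negb_and => /orP[/h|/h'] //.
Qed.

Lemma coord_space_add S T :
  (coord_space S + coord_space T :=: coord_space (S :|: T))%MS.
Proof.
apply/eqmxP/andP; split.
  by rewrite addsmx_sub !coord_space_sub ?subsetUl ?subsetUr.
apply/rV_subP => x /sub_coord_spaceP h.
pose y : 'rV[F]_D := \row_i ((i \in S)%:R * x 0 i).
rewrite -(subrK y x) addrC; apply: addmx_sub_adds; apply/sub_coord_spaceP => i iS.
  by rewrite mxE (negPf iS) mul0r.
rewrite !mxE; case: (boolP (i \in S)) => iS'; first by rewrite mul1r subrr.
by rewrite mul0r subr0 h // inE negb_or iS'.
Qed.

Lemma coord_space0 : coord_space set0 = 0.
Proof. by apply/eqP; rewrite -mxrank_eq0 rank_coord_space cards0. Qed.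
End CoordinateSpaces.

Section SplitForm.
Variables (F : finFieldType) (d : nat).
Implicit Types (S T : {set 'I_(dimD d)}) (x y : 'rV[F]_(dimD d)).

(** For this form the orthogonal of a coordinate space is again a coordinate space. *)
Definition split_form : 'M[F]_(dimD d) := \matrix_(i, j) (i == rev_ord j)%:R.

Lemma split_form_sym : split_form^T = split_form.
Proof.
by apply/matrixP => i j; rewrite !mxE eq_sym (can2_eq (@rev_ordK _) (@rev_ordK _)).
Qed.

Lemma mul_split_form m (A : 'M[F]_(m, dimD d)) i j : (A *m split_form) i j = A i (rev_ord j).
Proof.
rewrite mxE (bigD1 (rev_ord j)) //= mxE eqxx mulr1 big1 ?addr0 // => k kj.
by rewrite mxE (negPf kj) mulr0.
Qed.

Lemma split_form_unit : split_form \in unitmx.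
Proof.
suff : split_form *m split_form = 1%:M by case/mulmx1_unit.
by apply/matrixP => i j; rewrite mul_split_form !mxE rev_ordK.
Qed.

Definition bil x y : F := (x *m split_form *m y^T) 0 0.

Lemma bilE x y : bil x y = \sum_i x 0 (rev_ord i) * y 0 i.
Proof. by rewrite /bil mxE; apply: eq_bigr => i _; rewrite mul_split_form mxE. Qed.

Lemma bil0P x y : (x *m split_form *m y^T == 0) = (bil x y == 0).
Proof.
apply/eqP/eqP => [|E]; first by rewrite /bil => ->; rewrite mxE.
by apply/matrixP => i j; rewrite !ord1 [RHS]mxE.
Qed.

Lemma orth_coord_space S :
  (orth split_form (coord_space F S) :=: coord_space F [set i | rev_ord i \notin S])%MS.
Proof.
have sub x y : (x <= coord_space F [set i | rev_ord i \notin S])%MS ->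
    (y <= coord_space F S)%MS -> bil x y = 0.
  move=> /sub_coord_spaceP hx /sub_coord_spaceP hy.
  rewrite bilE big1 // => i _; case: (boolP (i \in S)) => [iS|/hy ->]; last by rewrite mulr0.
  by rewrite hx ?mul0r // inE rev_ordK iS.
apply/eqmx_sym/eqmxP; rewrite -mxrank_leqif_eq.
  apply/eqP; have := rank_orth split_form_sym split_form_unit (coord_space F S).
  rewrite rank_coord_space; have := cardsC S; rewrite card_ord rank_coord_space.
  suff -> : #|[set i | rev_ord i \notin S]| = #|~: S| by clear; lia.
  rewrite -(card_imset (mem (~: S)) (@rev_ord_inj _)); apply: eq_card => i; rewrite !inE.
  apply/idP/imsetP => [iS|[j jS ->]]; last by move: jS; rewrite inE rev_ordK.
  by exists (rev_ord i); rewrite ?inE ?rev_ordK.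
apply/rV_subP => x hx; rewrite sub_orth; apply/eqP/rowP => j.
have E := sub x (row j (coord_space F S)) hx (row_sub _ _).
by rewrite [RHS]mxE -E /bil !mxE; apply: eq_bigr => k _; rewrite !mxE.
Qed.

Lemma bil_vanish S x : (forall i, i \in S -> rev_ord i \notin S) ->
  (x <= coord_space F S)%MS -> bil x x = 0.
Proof.
move=> hS /sub_coord_spaceP hx; rewrite bilE big1 // => i _.
case: (boolP (i \in S)) => [/hS/hx->|/hx->]; by rewrite ?mul0r ?mulr0.
Qed.

Definition mid_ord : 'I_(dimD d) := inord d.
Lemma mid_ordE : mid_ord = d :> nat.
Proof. by rewrite inordK // /dimD; lia. Qed.
Lemma rev_mid_ord : rev_ord mid_ord = mid_ord.
Proof. by apply: val_inj; rewrite /= mid_ordE /dimD; lia. Qed.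
Lemma rev_ord_eq (i : 'I_(dimD d)) : (rev_ord i == i) = (i == mid_ord).
Proof. by rewrite -!(inj_eq val_inj) /= mid_ordE /dimD; have := ltn_ord i; rewrite /dimD; lia. Qed.

Lemma bilC x y : bil x y = bil y x.
Proof.
rewrite !bilE (reindex_inj (@rev_ord_inj _)) /=.
by apply: eq_bigr => i _; rewrite rev_ordK mulrC.
Qed.

Lemma bil_delta x (b : 'I_(dimD d)) : bil x (delta_mx 0 b) = x 0 (rev_ord b).
Proof.
rewrite bilE (bigD1 b) //= mxE !eqxx mulr1 big1 ?addr0 // => i /negPf ib.
by rewrite mxE ib andbF mulr0.
Qed.

Lemma bil_addZ x t (b : 'I_(dimD d)) : b != mid_ord ->
  bil (x + t *: delta_mx 0 b) (x + t *: delta_mx 0 b) =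
  bil x x + (t * x 0 (rev_ord b)) *+ 2.
Proof.
move=> bm; set e : 'rV[F]_(dimD d) := delta_mx 0 b.
have D1 y z w : bil (y + z) w = bil y w + bil z w by rewrite /bil !mulmxDl mxE.
have Z1 c y w : bil (c *: y) w = c * bil y w by rewrite /bil -!scalemxAl mxE.
have ee : bil e e = 0 by rewrite bil_delta mxE rev_ord_eq (negPf bm) andbF.
rewrite D1 Z1 ![bil _ (x + _)]bilC !D1 !Z1 ee [bil e x]bilC bil_delta; ring.
Qed.

Hypothesis char_neq2 : (2%:R : F) != 0.

(** Induction on s = |S|. If S contains dual coordinates a and b = [rev_ord a], the vectors with x_a
    = 0 are counted by the induction hypothesis for S minus a, and for x_a <> 0 the equation
    determines x_b: q^(s-2) + (q^(s-1) - q^(s-2)) = q^(s-1). Without such a pair the form is the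
    square of the middle coordinate. *)
Lemma card_isotropic S : mid_ord \in S ->
  #|[set x : 'rV[F]_(dimD d) | (x <= coord_space F S)%MS && (bil x x == 0)]| = (#|F| ^ #|S|.-1)%N.
Proof.
have [k] := ubnP #|S|; elim: k S => // k IH S Sk midS.
have S0 : (0 < #|S|)%N by apply/card_gt0P; exists mid_ord.
case: (pickP [pred a | [&& a \in S, rev_ord a \in S & a != mid_ord]]) => [a|noa]; last first.
  transitivity #|[set x : 'rV[F]_(dimD d) | (x <= coord_space F (S :\ mid_ord))%MS]|; last first.
    by rewrite card_coord_space (cardsD1 mid_ord S) midS.
  apply: eq_card => x; rewrite !inE; apply/andP/idP => [[/sub_coord_spaceP hx /eqP]|].
    rewrite bilE (bigD1 mid_ord) //= big1 ?addr0 => [|i im]; last first.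
      have := noa i; rewrite /= im andbT.
      case: (boolP (i \in S)) => [iS /= /negbT/hx->|/hx->]; by rewrite ?mul0r ?mulr0.
    rewrite rev_mid_ord => /eqP; rewrite mulf_eq0 orbb => /eqP xm.
    apply/sub_coord_spaceP => i; rewrite !inE negb_and negbK => /orP[/eqP->//|/hx//].
  move=> hx; split; first by rewrite (submx_trans hx) // coord_space_sub // subsetDl.
  move/sub_coord_spaceP: hx => hx; apply/eqP; rewrite bilE big1 // => i _.
  have [->|im] := eqVneq i mid_ord; first by rewrite (hx mid_ord) ?mulr0 // !inE eqxx.
  have := noa i; rewrite /= im andbT.
  case: (boolP (i \in S)) => [iS /= iS'|iS _]; last by rewrite (hx i) ?mulr0 // !inE negb_and iS orbT.
  by rewrite (hx (rev_ord i)) ?mul0r // !inE negb_and iS' orbT.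
rewrite /= => /and3P[aS a'S am]; set b := rev_ord a.
have bm : b != mid_ord by rewrite -rev_mid_ord (inj_eq (@rev_ord_inj _)).
have ab : a != b by rewrite eq_sym rev_ord_eq.
have b'E : rev_ord b = a by rewrite rev_ordK.
set A := [set x : 'rV[F]_(dimD d) | _].
have -> : #|A| = (#|A :&: [set x : 'rV[F]_(dimD d) | x 0%R a == 0%R]| + #|A :\: [set x : 'rV[F]_(dimD d) | x 0%R a == 0%R]|)%N.
  by rewrite cardsID.
have -> : A :&: [set x : 'rV[F]_(dimD d) | x 0 a == 0] =
    [set x : 'rV[F]_(dimD d) | (x <= coord_space F (S :\ a))%MS && (bil x x == 0)].
  apply/setP => x; rewrite !inE andbAC; congr (_ && _).
  apply/andP/sub_coord_spaceP => [[/sub_coord_spaceP hx /eqP xa] i|hx].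
    by rewrite !inE negb_and negbK => /orP[/eqP->|/hx].
  split; last by rewrite hx ?inE ?eqxx.
  by apply/sub_coord_spaceP => i iS; apply: hx; rewrite !inE negb_and iS orbT.
have SaE : #|S| = #|S :\ a|.+1 by rewrite (cardsD1 a S) aS.
have SbE : #|S| = #|S :\ b|.+1 by rewrite (cardsD1 b S) a'S.
have SabE : #|S :\ b| = #|S :\ b :\ a|.+1 by rewrite (cardsD1 a (S :\ b)) !inE aS ab.
rewrite IH; last 2 first.
- by move: SaE Sk; clear; lia.
- by rewrite !inE eq_sym am.
pose Z := [set x : 'rV[F]_(dimD d) | (x <= coord_space F (S :\ b))%MS] :\: [set x : 'rV[F]_(dimD d) | x 0 a == 0].
(* [f] erases the coordinate b, and [g] restores its only value that makes the vector isotropic, the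
   form being affine in x_b with slope 2 x_a. *)
pose f x := x - x 0 b *: delta_mx 0 b.
pose g x := x + (- (bil x x) / (2%:R * x 0 a)) *: delta_mx 0 b.
have fa x : f x 0 a = x 0 a by rewrite !mxE (negPf ab) andbF mulr0 subr0.
have ga x : g x 0 a = x 0 a by rewrite !mxE (negPf ab) andbF mulr0 addr0.
have delta_out i : i != b -> (delta_mx 0 b : 'rV[F]_(dimD d)) 0 i = 0.
  by move=> ib; rewrite mxE (negPf ib) andbF.
have -> : #|A :\: [set x : 'rV[F]_(dimD d) | x 0%R a == 0%R]| = #|Z|.
  have gK : {in Z, cancel g f}.
    move=> x; rewrite !inE => /andP[xa /sub_coord_spaceP hx].
    have xb : x 0 b = 0 by rewrite hx // !inE eqxx.
    apply/rowP => i; rewrite !mxE !eqxx /= xb; ring.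
  rewrite -(card_in_imset (can_in_inj gK)); apply: eq_card => x.
  rewrite !inE; apply/idP/imsetP => [/and3P[xa /sub_coord_spaceP hx /eqP xx]|[y + ->]].
    exists (f x).
      rewrite !inE fa xa; apply/sub_coord_spaceP => i; rewrite !inE negb_and negbK.
      have [->|ib] := eqVneq i b; first by rewrite !mxE !eqxx mulr1 subrr.
      by move=> /= /hx xi; rewrite !mxE xi (negPf ib) andbF mulr0 subr0.
    have -> : g (f x) = f x + (- (- x 0 b * x 0 a *+ 2) / (2%:R * x 0 a)) *: delta_mx 0 b.
      by rewrite /g fa {2 3}/f -scaleNr bil_addZ // b'E xx add0r.
    rewrite /f.
    rewrite -[LHS](subrK (x 0 b *: delta_mx 0 b)); congr (_ + _ *: _).
    by field; rewrite xa char_neq2.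
  rewrite !inE ga => /andP[ya /sub_coord_spaceP hy]; rewrite ya /=; apply/andP; split.
    apply/sub_coord_spaceP => i iS; have ib : i != b by apply: contraNneq iS => ->.
    rewrite mxE [X in _ + X]mxE delta_out // mulr0 addr0 hy //.
    by rewrite in_setD1 negb_and iS orbT.
  by rewrite bil_addZ // b'E; apply/eqP; field; rewrite ya char_neq2.
have : #|Z| = (#|F| ^ #|S :\ b| - #|F| ^ #|S :\ b :\ a|)%N.
  rewrite -card_coord_space -(card_coord_space F (S :\ b :\ a)) /Z cardsD; congr (_ - _)%N.
  apply: eq_card => x; rewrite !inE.
  apply/andP/sub_coord_spaceP => [[/sub_coord_spaceP hx /eqP xa] i|hx].
    by rewrite in_setD1 negb_and negbK => /orP[/eqP->|/hx].
  split; last by rewrite hx ?inE ?eqxx.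
  by apply/sub_coord_spaceP => i iS; apply: hx; rewrite in_setD1 negb_and iS orbT.
move=> ->; have -> : #|S|.-1 = #|S :\ b| by rewrite SbE.
have -> : #|S :\ a|.-1 = #|S :\ b :\ a| by move: SaE SbE SabE; clear; lia.
by rewrite subnKC // leq_exp2l ?finNzRing_gt1 // SabE.
Qed.
End SplitForm.

(** * Counting flags *)

Section PairList.
Variables (n d : nat) (C : Xi n d).

Definition rev_pair (p : 'I_(N n) * 'I_(N n)) := (rev_ord p.1, rev_ord p.2).

Lemma rev_enum_ord k : rev (enum 'I_k) = map (@rev_ord k) (enum 'I_k).
Proof.
apply: (inj_map val_inj); rewrite map_rev val_enum_ord -map_comp.
rewrite (eq_map (g := fun i : 'I_k => (k - i.+1)%N)) //.
rewrite (map_comp (fun i => k - i.+1)%N val) val_enum_ord.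
apply: (@eq_from_nth _ 0%N); rewrite ?size_rev ?size_map // size_iota => i ik.
by rewrite nth_rev size_iota // (nth_map 0%N) ?size_iota // !nth_iota //; lia.
Qed.

(** One block (i, j) per basis vector, in lexicographic order. Rotation reverses this order and
    preserves multiplicities, so vectors dual for the split form lie in rotated blocks; this makes
    the resulting coordinate flags self-dual. *)
Definition pair_list : seq ('I_(N n) * 'I_(N n)) :=
  flatten [seq nseq (Xi_entry C p.1 p.2) p
          | p <- [seq (i, j) | i <- enum 'I_(N n), j <- enum 'I_(N n)]].

Lemma rev_flatten_map (S T : Type) (e : seq S) (f : S -> S) (k : S -> seq T) (g : T -> T) :
  rev e = map f e -> (forall i, rev (k (f i)) = map g (k i)) ->
  rev (flatten [seq k i | i <- e]) = map g (flatten [seq k i | i <- e]).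
Proof.
move=> re kf; rewrite rev_flatten -map_rev -map_rev re map_flatten -!map_comp.
by congr flatten; apply: eq_map => i /=; rewrite kf.
Qed.

Lemma rev_pair_list : rev pair_list = map rev_pair pair_list.
Proof.
apply: (rev_flatten_map (f := rev_pair)) => [|[i j]].
  apply: (rev_flatten_map (f := @rev_ord _)); first exact: rev_enum_ord.
  by move=> i; rewrite -map_rev rev_enum_ord -!map_comp.
have rev_nseq (T : Type) k (x : T) : rev (nseq k x) = nseq k x.
  elim: k => //= k IH; rewrite rev_cons IH.
  by elim: (k) => //= k' {1}<-.
rewrite rev_nseq map_nseq /rev_pair /=; congr nseq.
have /theta_symP/(_ i j) := Xi_mx_sym C; rewrite !Xi_mxE => -[->] //.
Qed.

Lemma count_pair_list i j : count_mem (i, j) pair_list = Xi_entry C i j.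
Proof.
rewrite count_flatten sumnE !big_map big_allpairs_dep /= big_enum /=.
under eq_bigr => a _ do rewrite big_enum /=.
rewrite (bigD1 i) //= (bigD1 j) //= count_nseq /= eqxx mul1n.
rewrite !big1 ?addn0 // => [a ai|b bj]; last first.
  by rewrite count_nseq /= -pair_eqE /= (negPf bj) andbF.
by rewrite big1 // => b _; rewrite count_nseq /= -pair_eqE /= (negPf ai).
Qed.

Lemma size_pair_list : size pair_list = dimD d.
Proof.
rewrite size_flatten /shape sumnE !big_map big_allpairs_dep /= big_enum /=.
case/andP: (valP C) => /eqP E _; rewrite -[RHS]E; apply: eq_bigr => i _.
by rewrite big_enum; apply: eq_bigr => j _; rewrite size_nseq.
Qed.

(* r and c give the row and the column of the block of each basis vector *)
Lemma orbit_coordinates : exists r c : 'I_(dimD d) -> 'I_(N n),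
  [/\ forall y, r (rev_ord y) = rev_ord (r y), forall y, c (rev_ord y) = rev_ord (c y)
    & forall i j, Xi_entry C i j = #|[set y | (r y == i) && (c y == j)]|].
Proof.
(* The default is never reached, the list having [dimD d] terms. *)
pose p (y : 'I_(dimD d)) := nth (mid n, mid n) pair_list y.
have pr y : p (rev_ord y) = rev_pair (p y).
  have sy : (y < size pair_list)%N by rewrite size_pair_list.
  have yE : rev_ord y = (size pair_list - y.+1)%N :> nat by rewrite size_pair_list.
  rewrite /p yE -nth_rev // rev_pair_list.
  by rewrite (nth_map (mid n, mid n)).
exists (fun y => (p y).1), (fun y => (p y).2); split=> [y|y|i j]; rewrite ?pr //.
rewrite -count_pair_list -sum1_count (big_nth (mid n, mid n)) size_pair_list big_mkord.
rewrite -sum1_card; apply: eq_bigl => y; rewrite inE -/(p y).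
by case: (p y).
Qed.
End PairList.

Section CoordinateFlags.
Variables (F : finFieldType) (n d : nat).
Implicit Types r c : 'I_(dimD d) -> 'I_(N n).

Definition coord_flag r : flag F n d :=
  [ffun i : 'I_(N n).+1 => coord_space F [set y | (r y < i)%N]].

Lemma fl_coord_flag r i : (i <= N n)%N ->
  fl (coord_flag r) i = coord_space F [set y | (r y < i)%N].
Proof. by move=> iN; rewrite /fl ffunE inordK. Qed.

Lemma coord_flag_is_flag r : (forall y, r (rev_ord y) = rev_ord (r y)) ->
  is_flag (split_form F d) (coord_flag r).
Proof.
move=> rr; apply/is_flagP; split.
- by move=> i iN; rewrite fl_coord_flag // coord_space_gen.
- move=> i iN; rewrite !fl_coord_flag //; last exact: ltnW.
  by apply: coord_space_sub; apply/subsetP => y; rewrite !inE => /ltnW.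
- by rewrite fl_coord_flag // (_ : [set y | _] = set0) ?coord_space0 //; apply/setP => y; rewrite !inE.
- rewrite fl_coord_flag // rank_coord_space -[RHS]card_ord; apply: eq_card => y.
  by rewrite !inE ltn_ord.
move=> i iN; rewrite !fl_coord_flag ?leq_subr //; apply: eqmx_sym.
apply: eqmx_trans (orth_coord_space _ _) _.
suff -> : [set y | rev_ord y \notin [set z | (r z < N n - i)%N]] =
  [set y | (r y < i)%N] by [].
apply/setP => y; rewrite !inE rr /=.
by have := ltn_ord (r y); move: iN; clear; lia.
Qed.

Lemma card_block (C : Xi n d) r c i j :
  (forall i j, Xi_entry C i j = #|[set y | (r y == i) && (c y == j)]|) ->
  psum (Xi_mx C) i j = #|[set y | (r y < i)%N && (c y < j)%N]|.
Proof.
move=> CE; rewrite -sum1_card.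
rewrite (eq_bigl (fun y => (r y < i)%N && (c y < j)%N)); last by move=> y; rewrite inE.
rewrite (partition_big r (fun a : 'I_(N n) => (a < i)%N)) /=; last by move=> y /andP[].
rewrite Posz_sum; apply: eq_bigr => a ai.
rewrite (partition_big c (fun b : 'I_(N n) => (b < j)%N)) /=; last by move=> y /andP[/andP[]].
rewrite Posz_sum; apply: eq_bigr => b bj; rewrite Xi_mxE CE -sum1_card; congr Posz.
apply: eq_bigl => y; rewrite inE.
case: eqP => [->|]; case: eqP => [->|]; rewrite ?andbF //= ?ai ?bj //.
Qed.

Lemma coord_flag_orbit (C : Xi n d) r c :
  (forall y, r (rev_ord y) = rev_ord (r y)) -> (forall y, c (rev_ord y) = rev_ord (c y)) ->
  (forall i j, Xi_entry C i j = #|[set y | (r y == i) && (c y == j)]|) ->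
  in_orbit C (coord_flag r) (coord_flag c).
Proof.
move=> rr cr CE; apply/in_orbitP; try exact: coord_flag_is_flag.
move=> i j iN jN; rewrite (card_block _ _ CE) /rho !fl_coord_flag //.
rewrite coord_space_cap rank_coord_space; congr (Posz _).
by apply: eq_card => y; rewrite !inE.
Qed.
End CoordinateFlags.

Section StepCount.
Variables (F : finFieldType) (n d h : nat).
Hypothesis hh : (0 < h < N n)%N.

Lemma orbit_near_step (B : 'M[F]_(dimD d)) (A C : Xi n d)
    (V1 V2 V : flag F n d) (x : 'rV[F]_(dimD d)) : B^T = B -> B \in unitmx ->
  is_flag B V1 -> is_flag B V2 -> is_flag B V -> in_orbit C V1 V2 ->
  near h V1 V -> (x <= fl V h)%MS -> ~~ (x <= fl V1 h)%MS ->
  exists2 c : 'I_(N n),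
    forall j, (j <= N n)%N -> (x <= fl V1 h + fl V2 j)%MS = (c < j)%N
  & in_orbit A V V2 <-> Xi_mx A = Xi_mx C + step h c.
Proof.
move=> Bs Bu hV1 hV2 hV oC hn xV xV1.
have [c [cj cr]] := near_rho Bs Bu hh hV1 hV2 hV hn xV xV1.
exists c => //; have /(in_orbitP hV1 hV2) rC := oC.
split=> [/(in_orbitP hV hV2) rA|E].
  by apply: psum_inj => i j iN jN; rewrite psumD rA // cr // rC.
by apply/(in_orbitP hV hV2) => i j iN jN; rewrite E psumD cr // rC.
Qed.

Lemma near_witness (V1 V : flag F n d) : near h V1 V ->
  exists2 x : 'rV[F]_(dimD d), (x <= fl V h)%MS & ~~ (x <= fl V1 h)%MS.
Proof.
case=> _ nS nR; have : ~~ (fl V h <= fl V1 h)%MS.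
  by apply/negP => /mxrankS; rewrite nR ltnn.
case/row_subPn => i iV; exists (row i (fl V h)) => //; exact: row_sub.
Qed.

(** For h = n the space V_{h+1} differs from V1_{h+1}, but it is the orthogonal of a space
    containing V1_h and so lies in V1_{h+1}. *)
Lemma near_sub (B : 'M[F]_(dimD d)) (V1 V : flag F n d) : B^T = B ->
  is_flag B V1 -> is_flag B V -> near h V1 V -> (fl V h <= fl V1 h.+1)%MS.
Proof.
move=> Bs hV1 hV [nE nS nR]; have hN : (h <= N n)%N by case/andP: hh => _ /ltnW.
have [e|e] := eqVneq h.+1 (N n - h)%N.
  rewrite (submx_trans (flag_sub hV (leqnSn h) _)) //; first by case/andP: hh.
  rewrite e (flag_orth hV) ?leq_subr // (flag_orth hV1) ?leq_subr // subKn //.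
  exact: orthS.
rewrite -nE //; [apply: (flag_sub hV) => //| |]; try (by case/andP: hh).
by clear; lia.
Qed.

Variables (C : Xi n d) (r c : 'I_(dimD d) -> 'I_(N n)).
Hypotheses (rr : forall y, r (rev_ord y) = rev_ord (r y))
           (cr : forall y, c (rev_ord y) = rev_ord (c y))
           (CE : forall i j, Xi_entry C i j = #|[set y | (r y == i) && (c y == j)]|).
Hypothesis char_neq2 : (2%:R : F) != 0.

Let B := split_form F d.
Let V1 := coord_flag F r.
Let V2 := coord_flag F c.
Let q := #|F|.

(* the number of boxes of row h in columns < j; the form restricted to V_{n+1} / V_n
   is nondegenerate, so that for h = n isotropy costs one dimension as soon as
   the middle box is included *)
Definition row_weight (M : 'M[int]_(N n)) (j : nat) : int :=
  psum M h.+1 j - psum M h j - ((h == n) && (n < j)%N)%:R.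

(** The coordinates of V1_{h+1} cap (V1_h + V2_j), as [sub_coord_U] shows. *)
Let U (j : nat) : {set 'I_(dimD d)} :=
  [set y | (r y < h)%N || ((r y == h :> nat) && (c y < j)%N)].

Let Z (j : nat) : {set 'rV[F]_(dimD d)} :=
  [set x : 'rV[F]_(dimD d) | (x <= coord_space F (U j))%MS && ((h == n) ==> (bil x x == 0))].

Lemma card_U j : #|U j|%:Z = (\rank (fl V1 h))%:Z + (psum (Xi_mx C) h.+1 j - psum (Xi_mx C) h j).
Proof.
have hN : (h <= N n)%N by case/andP: hh => _ /ltnW.
rewrite /V1 fl_coord_flag // rank_coord_space !(card_block _ _ CE).
rewrite -(cardsID [set y | (r y < h)%N] (U j)) -(cardsID [set y | (r y < h)%N] [set y | (r y < h.+1)%N && (c y < j)%N]).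
have -> : U j :&: [set y | (r y < h)%N] = [set y | (r y < h)%N].
  by apply/setP => y; rewrite !inE; case: (_ < h)%N; rewrite ?andbF.
have -> : [set y | (r y < h.+1)%N && (c y < j)%N] :&: [set y | (r y < h)%N] =
          [set y | (r y < h)%N && (c y < j)%N].
  by apply/setP => y; rewrite !inE; rewrite ltnS; case: (ltngtP (r y) h); case: (c y < j)%N.
have -> : [set y | (r y < h.+1)%N && (c y < j)%N] :\: [set y | (r y < h)%N] =
          U j :\: [set y | (r y < h)%N].
  by apply/setP => y; rewrite !inE; rewrite ltnS; case: (ltngtP (r y) h); case: (c y < j)%N.
by rewrite !PoszD; ring.
Qed.

(** For h = n and j <= n, [U j] contains no coordinate together with its dual, so the form vanishes
    there. For h = n < j it contains the middle coordinate, and [card_isotropic] applies. *)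
Lemma card_Z j : (j <= N n)%N ->
  exists2 w : nat, row_weight (Xi_mx C) j = w%:Z & #|Z j| = (q ^ (\rank (fl V1 h) + w))%N.
Proof.
move=> jN; have cU := card_U j; rewrite /row_weight.
have rkU : (\rank (fl V1 h) <= #|U j|)%N.
  have hN : (h <= N n)%N by case/andP: hh => _ /ltnW.
  rewrite /V1 fl_coord_flag // rank_coord_space subset_leq_card //.
  by apply/subsetP => y; rewrite !inE => ->.
case: (boolP ((h == n) && (n < j)%N)) => [/andP[/eqP hE nj]|hj].
  have midU : mid_ord d \in U j.
    have rm : r (mid_ord d) = mid n.
      apply: val_inj; have := congr1 val (rr (mid_ord d)).
      by rewrite rev_mid_ord /= /mid inordK /N; have := ltn_ord (r (mid_ord d)); rewrite /N; lia.
    have cm : c (mid_ord d) = mid n.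
      apply: val_inj; have := congr1 val (cr (mid_ord d)).
      by rewrite rev_mid_ord /= /mid inordK /N; have := ltn_ord (c (mid_ord d)); rewrite /N; lia.
    by rewrite inE rm cm /mid inordK /N ?hE ?eqxx ?nj ?orbT //; lia.
  have lt : (\rank (fl V1 h) < #|U j|)%N.
    have hN : (h <= N n)%N by case/andP: hh => _ /ltnW.
    rewrite /V1 fl_coord_flag // rank_coord_space proper_card //.
    apply/properP; split; first by apply/subsetP => y; rewrite !inE => ->.
    exists (mid_ord d) => //; move: midU; rewrite !inE.
    have rm : r (mid_ord d) = n :> nat.
      have := congr1 val (rr (mid_ord d)).
      by rewrite rev_mid_ord /=; have := ltn_ord (r (mid_ord d)); rewrite /N; lia.
    by rewrite rm hE ltnn.
  exists (#|U j| - \rank (fl V1 h)).-1.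
    by move: cU lt; clear; lia.
  have -> : (\rank (fl V1 h) + (#|U j| - \rank (fl V1 h)).-1)%N = #|U j|.-1.
    by move: lt; clear; lia.
  by rewrite -(card_isotropic char_neq2 midU); apply: eq_card => x; rewrite !inE hE eqxx.
exists (#|U j| - \rank (fl V1 h))%N; first by move: cU rkU; clear; lia.
rewrite subnKC // -(card_coord_space F (U j)); apply: eq_card => x; rewrite !inE.
case: eqP => [hE|]; rewrite ?andbT //; case: (boolP (x <= _)%MS) => //= xU.
apply/eqP/(bil_vanish _ xU) => y; rewrite !inE rr cr /=.
move: hj; rewrite hE eqxx /=.
by have := ltn_ord (r y); have := ltn_ord (c y); rewrite /N; clear; lia.
Qed.

Let Bs : B^T = B := split_form_sym F d.
Let Bu : B \in unitmx := split_form_unit F d.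
Let hV1 : is_flag B V1 := coord_flag_is_flag F rr.
Let hV2 : is_flag B V2 := coord_flag_is_flag F cr.
Let oC : in_orbit C V1 V2 := coord_flag_orbit F rr cr CE.

Lemma sub_coord_U (x : 'rV[F]_(dimD d)) j : (j <= N n)%N ->
  (x <= coord_space F (U j))%MS = (x <= fl V1 h.+1)%MS && (x <= fl V1 h + fl V2 j)%MS.
Proof.
move=> jN; have hN : (h <= N n)%N by case/andP: hh => _ /ltnW.
rewrite /V1 /V2 !fl_coord_flag //; last by case/andP: hh.
rewrite (coord_space_add _ _ _) -sub_capmx (coord_space_cap _ _ _).
suff -> : U j = [set y | (r y < h.+1)%N] :&: ([set y | (r y < h)%N] :|: [set y | (c y < j)%N]) by [].
by apply/setP => y; rewrite !inE ltnS; case: (ltngtP (r y) h); case: (c y < j)%N.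
Qed.

(** Double counting over the admissible x that enter exactly at column [c0]. With r = dim V1_h there
    are q^(r+w') - q^(r+w) of them, and each V arises from the q^r (q - 1) vectors of V_h outside
    V1_h. *)
Lemma card_step_flags (l : 'M[int]_(N n)) (B0 A : Xi n d) (c0 : 'I_(N n)) :
  is_diag_mx l -> Xi_mx B0 = l + Etheta n h h.-1 ->
  (forall i, (i <= N n)%N -> psum (Xi_mx B0) i (N n) = psum (Xi_mx C) i (N n)) ->
  Xi_mx A = Xi_mx C + step h c0 ->
  exists w w' : nat, [/\ row_weight (Xi_mx C) c0 = w%:Z,
    row_weight (Xi_mx C) c0.+1 = w'%:Z &
    (#|[set V : flag F n d | [&& is_flag B V, in_orbit B0 V1 V & in_orbit A V V2]]| * q.-1
      + q ^ w = q ^ w')%N].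
Proof.
move=> ld B0E rows AE; set S := [set V : flag F n d | _].
have hN : (h <= N n)%N by case/andP: hh => _ /ltnW.
have hN1 : (h.+1 <= N n)%N by case/andP: hh.
have c0N : (c0 <= N n)%N by apply: ltnW.
have rows' i : (i <= N n)%N -> psum (Xi_mx B0) i (N n) = (\rank (fl V1 i))%:Z.
  by move=> iN; rewrite rows // (in_orbitP hV1 hV2 _ oC) // (rhoNr V1 hV2).
have [w wE Zw] := card_Z c0N; have [w' wE' Zw'] := card_Z (ltn_ord c0).
exists w, w'; split=> //.
pose X := Z c0.+1 :\: Z c0.
have XP x : x \in X -> [/\ (x <= fl V1 h.+1)%MS, ~~ (x <= fl V1 h)%MS,
    (h = n -> x *m B *m x^T = 0), (x <= fl V1 h + fl V2 c0.+1)%MS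
    & ~~ (x <= fl V1 h + fl V2 c0)%MS].
  rewrite in_setD !inE !sub_coord_U // => /andP[+ /andP[/andP[x1 x2] iso]].
  rewrite x1 iso andbT /= => x3; split=> //.
    by apply: contraNN x3 => /submx_trans; apply; exact: addsmxSl.
  by move=> e; apply/eqP; rewrite bil0P; move: iso; rewrite e eqxx.
have XS x : x \in X -> near_flag B h V1 x \in S.
  case/XP => x1 x2 iso x3 x4.
  have hV := near_flag_is_flag Bs Bu hh hV1 x1 iso.
  have hn := near_flag_near B hh x2.
  rewrite inE hV /=; apply/andP; split; first by apply/(near_orbit Bs Bu hh ld B0E hV1 hV).
  have xV : (x <= fl (near_flag B h V1 x) h)%MS.
    by rewrite fl_near_flag // eqxx genmxE addsmxSr.
  have [c1 c1P oA] := orbit_near_step A Bs Bu hV1 hV2 hV oC hn xV x2.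
  apply/oA; rewrite AE; congr (_ + step h _); apply/val_inj.
  by move: x3 x4; rewrite !c1P //=; clear; lia.
have SX V : V \in S -> #|[set x in X | near_flag B h V1 x == V]| =
    (q ^ \rank (fl V1 h) * q.-1)%N.
  rewrite inE => /and3P[hV oB oA].
  have [_ hn] := (near_orbit Bs Bu hh ld B0E hV1 hV).1 oB.
  have [_ nS nR] := hn.
  transitivity #|rowg (fl V h) :\: rowg (fl V1 h)|; last first.
    rewrite cardsD (setIidPr _); last by apply/subsetP => x; rewrite !inE => /submx_trans; apply.
    rewrite !card_rowg nR expnS -subn1 mulnBr muln1 mulnC //.
  apply: eq_card => x; rewrite !inE; apply/andP/andP => [[xX /eqP <-]|[xV1 xV]].
    have := XP x; rewrite !inE => /(_ xX)[x1 x2 _ _ _]; split=> //.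
    by rewrite fl_near_flag // eqxx genmxE addsmxSr.
  have [c1 c1P oA'] := orbit_near_step A Bs Bu hV1 hV2 hV oC hn xV xV1.
  have cc : c1 = c0.
    by move/oA': oA; rewrite AE => /addrI/(step_inj hh).
  split; last by rewrite (near_flag_eq Bs hh hV hn xV xV1).
  have x1 : (x <= fl V1 h.+1)%MS by rewrite (submx_trans xV) // (near_sub Bs hV1 hV).
  rewrite !sub_coord_U // x1 !c1P // cc ltnn ltnSn /=.
  apply/implyP => /eqP hE; rewrite -bil0P -/B.
  (* For h = n, V_h lies in V_{h+1} = V_h^perp, so all vectors of V_h are isotropic. *)
  have VV : (fl V h <= orth B (fl V h))%MS.
    rewrite (submx_trans (flag_sub hV (leqnSn h) hN1)) // (flag_orth hV hN1).
    by rewrite (_ : N n - h.+1 = h)%N // hE /N; clear; lia.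
  case/submxP: xV => u ->; rewrite trmx_mul mulmxA -(mulmxA u) -(mulmxA u).
  by move: VV; rewrite sub_orth => /eqP ->; rewrite mulmx0 mul0mx.
have ZZ : Z c0 \subset Z c0.+1.
  apply/subsetP => x; rewrite !inE => /andP[x1 ->]; rewrite andbT.
  apply: submx_trans x1 _; apply: coord_space_sub; apply/subsetP => y; rewrite !inE.
  by case/orP => [->//|/andP[-> /ltnW y1]]; rewrite ltnS y1 orbT.
have cX : #|X| = (#|S| * (q ^ \rank (fl V1 h) * q.-1))%N.
  rewrite -sum_nat_const -sum1_card.
  rewrite (partition_big (near_flag B h V1) (mem S)) /=; last by move=> x; exact: XS.
  apply: eq_bigr => V VS; rewrite -(SX V VS) -sum1_card; apply: eq_bigl => x.
  by rewrite inE.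
have := cardsD (Z c0.+1) (Z c0); rewrite -/X cX (setIidPr ZZ) Zw Zw' !expnD.
have q0 : (0 < q ^ \rank (fl V1 h))%N by rewrite expn_gt0 (ltnW (finNzRing_gt1 F)).
have := subset_leq_card ZZ; rewrite Zw Zw' !expnD.
rewrite leq_pmul2l // => ww; rewrite mulnCA -mulnBr => /eqP.
by rewrite eqn_pmul2l // => /eqP->; rewrite subnK.
Qed.
End StepCount.

(** * Structure constants of the Schur algebra *)

Section PolyInt.

Lemma odd_primes k : exists s : seq nat,
  [/\ size s = k, uniq s & all (fun p => prime p && odd p) s].
Proof.
elim: k => [|k [s [<- us ps]]]; first by exists [::].
have [p pm pp] := prime_above (\max_(x <- s) x + 2).
exists (p :: s); split=> //=; rewrite ?us ?ps ?pp ?andbT /=.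
  apply/negP => /(@leq_bigmax_seq _ _ xpredT id) /(_ isT) /=; move: pm; lia.
by case: (even_prime pp) => // e; move: pm; rewrite e; lia.
Qed.

Lemma poly_int_eq (P Q : {poly int}) :
  (forall p, prime p -> odd p -> P.[p%:Z] = Q.[p%:Z]) -> P = Q.
Proof.
move=> E; apply/eqP; rewrite -subr_eq0; apply/negPn/negP => R0.
have [s [sz us /allP ps]] := odd_primes (size (P - Q)).
have := @max_poly_roots _ (P - Q) (map Posz s) R0.
rewrite size_map sz map_inj_uniq ?us; last by move=> x y [].
rewrite ltnn => h; suff : false by []; apply: h => //.
apply/allP => _ /mapP[p /ps /andP[pp po] ->].
by rewrite /root hornerD hornerN E // subrr.
Qed.
End PolyInt.

Section SchurConstants.
Variables (n d : nat) (g : Xi n d -> Xi n d -> Xi n d -> {poly int}).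
Hypothesis hg : counts_flags g.

Definition count_flags (F : finFieldType) (B : 'M[F]_(dimD d)) A A' (V1 V2 : flag F n d) :=
  #|[set V : flag F n d | [&& is_flag B V, in_orbit A V1 V & in_orbit A' V V2]]|.

Lemma Fp_odd p : prime p -> odd p -> odd #|'F_p| /\ (2%:R : 'F_p) != 0.
Proof.
move=> pp po; rewrite card_Fp //; split=> //.
have := dvdn_pcharf (pchar_Fp pp) 2; rewrite dvdn_prime2 // => <-.
by apply: contraTN po => /eqP->.
Qed.

(** [counts_flags] evaluates g at any pair of flags in the orbit C, and for every odd prime the
    coordinate flags provide such a pair. *)
Lemma flags_eq (P : {poly int}) (A A' C : Xi n d) :
  (forall p (r c : 'I_(dimD d) -> 'I_(N n)), prime p -> odd p ->
     (forall y, r (rev_ord y) = rev_ord (r y)) -> (forall y, c (rev_ord y) = rev_ord (c y)) ->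
     (forall i j, Xi_entry C i j = #|[set y | (r y == i) && (c y == j)]|) ->
     P.[p%:Z] = (count_flags (split_form 'F_p d) A A' (coord_flag _ r) (coord_flag _ c))%:Z) ->
  g A A' C = P.
Proof.
move=> h; apply: poly_int_eq => p pp po; have [Fo _] := Fp_odd pp po.
have [r [c [rr cr CE]]] := orbit_coordinates C.
have := hg Fo (split_form_sym 'F_p d) (split_form_unit 'F_p d) A A'
  (coord_flag_is_flag 'F_p rr) (coord_flag_is_flag 'F_p cr) (coord_flag_orbit 'F_p rr cr CE).
by rewrite card_Fp // => ->; rewrite (h p r c).
Qed.

(** Both sides count the pairs (V, W) with (V1, V), (V, W), (W, V2) in the orbits of A, B, C: the
    sum over E removes the condition on (V1, W), respectively (V, V2), because such a pair lies in
    exactly one orbit. *)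
Lemma structure_constants_assoc (A B C D : Xi n d) :
  \sum_E g A B E * g E C D = \sum_E g B C E * g A E D.
Proof.
apply: poly_int_eq => p pp po; have [Fo _] := Fp_odd pp po.
have [r [c [rr cr CE]]] := orbit_coordinates D.
pose Q := split_form 'F_p d; pose V1 := coord_flag 'F_p r; pose V2 := coord_flag 'F_p c.
have Qs : Q^T = Q := split_form_sym 'F_p d; have Qu : Q \in unitmx := split_form_unit 'F_p d.
have hV1 : is_flag Q V1 := coord_flag_is_flag 'F_p rr.
have hV2 : is_flag Q V2 := coord_flag_is_flag 'F_p cr.
have oD : in_orbit D V1 V2 := coord_flag_orbit 'F_p rr cr CE.
have gE A1 A2 A3 W1 W2 : is_flag Q W1 -> is_flag Q W2 -> in_orbit A3 W1 W2 ->
    (g A1 A2 A3).[p%:Z] = (\sum_V [&& is_flag Q V, in_orbit A1 W1 V & in_orbit A2 V W2])%N%:Z.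
  move=> h1 h2 o; have := hg Fo Qs Qu A1 A2 h1 h2 o; rewrite card_Fp // => ->.
  by congr Posz; rewrite -sum1dep_card big_mkcond.
pose f V W := (([&& is_flag Q V, is_flag Q W, in_orbit A V1 V, in_orbit B V W & in_orbit C W V2] : nat)).
rewrite !horner_sum.
have hM (P P' : {poly int}) : (P * P').[p%:Z] = P.[p%:Z] * P'.[p%:Z] by exact: hornerM.
have -> : \sum_E (g A B E * g E C D).[p%:Z] = (\sum_W \sum_V f V W)%N%:Z.
  under [LHS]eq_bigr => E _ do rewrite (hM _ _) (gE E C D V1 V2) // Posz_sum mulr_sumr.
  rewrite exchange_big Posz_sum; apply: eq_bigr => W _ /=.
  case: (boolP (is_flag Q W && in_orbit C W V2)) => [/andP[hW oC]|no]; last first.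
    rewrite big1 => [|E _]; last first.
      suff -> : [&& is_flag Q W, in_orbit E V1 W & in_orbit C W V2] = false by rewrite mulr0.
      by apply: contraNF no => /and3P[-> _ ->].
    rewrite big1 // => V _; rewrite /f.
    suff -> : [&& is_flag Q V, is_flag Q W, in_orbit A V1 V, in_orbit B V W & in_orbit C W V2] = false by [].
    by apply: contraNF no => /and5P[_ -> _ _ ->].
  have [E0 oE] := in_orbit_ex Qs Qu hV1 hW.
  rewrite (bigD1 E0) //= big1 => [|E ne]; last first.
    case: (boolP (in_orbit E V1 W)) => [o|]; last by rewrite andbF mulr0.
    by rewrite (in_orbit_inj hV1 hW o oE) eqxx in ne.
  rewrite addr0 (gE A B E0 V1 W) // hW oE oC mulr1; congr Posz; apply: eq_bigr => V _.
  by rewrite /f hW oC !andbT.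
have -> : \sum_E (g B C E * g A E D).[p%:Z] = (\sum_V \sum_W f V W)%N%:Z.
  under [LHS]eq_bigr => E _ do rewrite (hM _ _) (gE A E D V1 V2) // Posz_sum mulr_sumr.
  rewrite exchange_big Posz_sum; apply: eq_bigr => V _ /=.
  case: (boolP (is_flag Q V && in_orbit A V1 V)) => [/andP[hV oA]|no]; last first.
    rewrite big1 => [|E _]; last first.
      suff -> : [&& is_flag Q V, in_orbit A V1 V & in_orbit E V V2] = false by rewrite mulr0.
      by apply: contraNF no => /and3P[-> -> _].
    rewrite big1 // => W _; rewrite /f.
    suff -> : [&& is_flag Q V, is_flag Q W, in_orbit A V1 V, in_orbit B V W & in_orbit C W V2] = false by [].
    by apply: contraNF no => /and5P[-> _ -> _ _].
  have [E0 oE] := in_orbit_ex Qs Qu hV hV2.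
  rewrite (bigD1 E0) //= big1 => [|E ne]; last first.
    case: (boolP (in_orbit E V V2)) => [o|]; last by rewrite !andbF mulr0.
    by rewrite (in_orbit_inj hV hV2 o oE) eqxx in ne.
  rewrite addr0 (gE B C E0 V V2) // hV oE oA mulr1; congr Posz; apply: eq_bigr => W _.
  by rewrite /f hV oA /=.
by rewrite exchange_big.
Qed.
End SchurConstants.

Section StepConstants.
Variables (n d : nat) (g : Xi n d -> Xi n d -> Xi n d -> {poly int}).
Hypothesis hg : counts_flags g.

Definition composable_mx (A B : 'M[int]_(N n)) : bool :=
  [forall i, col_sum A i == row_sum B i].

Lemma composable_psum (A B : 'M[int]_(N n)) :
  reflect (forall i, (i <= N n)%N -> psum A (N n) i = psum B i (N n)) (composable_mx A B).
Proof.
apply: (iffP forallP) => h i; last first.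
  by rewrite col_sum_psum row_sum_psum !h // ltnW.
by move=> iN; rewrite psum_col psum_row; apply: eq_bigr => a _; apply/eqP.
Qed.

(* the structure constant at v of the step matrix with nonzero entry (h, h - 1) *)
Definition step_coef (h : nat) (A C : 'M[int]_(N n)) : Qv :=
  \sum_(c < N n) if A == C + step h c
    then (v ^ (2 * row_weight h C c.+1) - v ^ (2 * row_weight h C c)) / (v ^+ 2 - 1) else 0.

Definition eval_v2 (P : {poly int}) : Qv := (map_poly intr P).[v ^+ 2].

Lemma eval_v2E (P : {poly int}) : laurent_val (map_poly intr P).[vexp 2] = eval_v2 P.
Proof.
pose lv : {rmorphism laurent -> Qv} := val.
rewrite -[laurent_val _]/(lv _) -horner_map -map_poly_comp.
by congr (_.[_]); apply: eq_map_poly => z; exact: (rmorph_int lv).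
Qed.

Lemma eval_v2M P Q : eval_v2 (P * Q) = eval_v2 P * eval_v2 Q.
Proof. by rewrite /eval_v2 rmorphM hornerM. Qed.
Lemma eval_v2D P Q : eval_v2 (P + Q) = eval_v2 P + eval_v2 Q.
Proof. by rewrite /eval_v2 rmorphD hornerD. Qed.
Lemma eval_v2Xn k : eval_v2 'X^k = v ^ (2 * k%:Z).
Proof. by rewrite /eval_v2 map_polyXn hornerXn -exprM -PoszM. Qed.
Lemma eval_v2C (z : int) : eval_v2 z%:P = z%:~R.
Proof. by rewrite /eval_v2 map_polyC hornerC. Qed.

Lemma vX_inj : injective (fun k : nat => v ^+ k).
Proof.
suff key k : (0 < k)%N -> v ^+ k != 1.
  move=> j k; wlog jk : j k / (j <= k)%N.
    by move=> H E; case: (leqP j k) => [|/ltnW] l; [|apply/esym]; apply: H.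
  move=> /eqP; rewrite -(subnK jk) exprD -{1}[v ^+ j]mul1r.
  rewrite (inj_eq (mulIf (expf_neq0 _ v_neq0))) => /eqP E.
  have := key (k - j)%N; rewrite -E eqxx subn_gt0; lia.
move=> k0; rewrite /v -tofracXn -tofrac1 tofrac_eq.
apply/eqP => /(congr1 (fun p : {poly rat} => size p)); rewrite size_polyXn size_poly1.
by case: k k0.
Qed.

Lemma v2_neq1 : v ^+ 2 - 1 != 0.
Proof. by rewrite subr_eq0 -(expr0 v) (inj_eq vX_inj). Qed.

(** Column sums of B and row sums of A differ from the row sums of B and of C by the same amounts.
    So composability means that B and C prescribe the same dimensions for the first flag. *)
Lemma composable_step h (l : 'M[int]_(N n)) (c : 'I_(N n)) (B A C : 'M[int]_(N n)) :
  (0 < h < N n)%N -> is_diag_mx l -> B = l + Etheta n h h.-1 -> A = C + step h c ->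
  composable_mx B A <-> (forall i, (i <= N n)%N -> psum B i (N n) = psum C i (N n)).
Proof.
move=> hh ld -> ->.
have E i : (i <= N n)%N -> psum (l + Etheta n h h.-1) (N n) i =
    psum (l + Etheta n h h.-1) i (N n) + psum (step h c) i (N n).
  move=> iN; have [h0 hN] := andP hh; have hN' := leq_ltn_trans (leq_pred h) hN.
  rewrite psum_step // (psumD l _ (N n) i) (psumD l _ i (N n)) !psum_Etheta //.
  rewrite !psum_diag // (minn_idPr iN) (minn_idPl iN) hN hN' ltn_ord !ltn_subrL !andbT /=.
  have -> : (N n - h.+1 < i)%N = (N n - h <= i)%N by rewrite subnS predn_ltn ?subn_gt0.
  by rewrite (prednK h0) (leq_natr h) (leq_natr (N n - h)); ring.
split=> [/composable_psum h1 i iN|h1].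
  by apply: (addIr (psum (step h c) i (N n))); rewrite -E // h1 // (psumD C).
by apply/composable_psum => i iN; rewrite E // (psumD C) h1.
Qed.

Lemma schur_step h (l : 'M[int]_(N n)) (B A C : Xi n d) :
  (0 < h < N n)%N -> is_diag_mx l -> Xi_mx B = l + Etheta n h h.-1 ->
  eval_v2 (g B A C) =
  if composable_mx (Xi_mx B) (Xi_mx A) then step_coef h (Xi_mx A) (Xi_mx C) else 0.
Proof.
move=> hh ld BE.
case: (pickP (fun c => Xi_mx A == Xi_mx C + step h c)) => [c0 /eqP AE|noc]; last first.
  have -> : step_coef h (Xi_mx A) (Xi_mx C) = 0 by apply: big1 => c _; rewrite noc.
  rewrite if_same (flags_eq hg (P := 0)) ?rmorph0 /eval_v2 ?rmorph0 ?horner0 //.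
  move=> p r c pp po rr cr CE; rewrite horner0; apply/esym; congr Posz; apply/eqP.
  rewrite cards_eq0; apply/eqP/setP => V; rewrite !inE; apply/and3P => -[hV oB oA].
  have hV1 := coord_flag_is_flag 'F_p rr; have hV2 := coord_flag_is_flag 'F_p cr.
  have oC := coord_flag_orbit 'F_p rr cr CE.
  have Qs := split_form_sym 'F_p d; have Qu := split_form_unit 'F_p d.
  have [_ hn] := (near_orbit Qs Qu hh ld BE hV1 hV).1 oB.
  have [x xV xV1] := near_witness hn.
  have [c1 _ oA'] := orbit_near_step hh A Qs Qu hV1 hV2 hV oC hn xV xV1.
  by have := noc c1; rewrite (oA'.1 oA) eqxx.
have -> : step_coef h (Xi_mx A) (Xi_mx C) = (v ^ (2 * row_weight h (Xi_mx C) c0.+1)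
     - v ^ (2 * row_weight h (Xi_mx C) c0)) / (v ^+ 2 - 1).
  rewrite /step_coef (bigD1 c0) //= AE eqxx big1 ?addr0 // => c cc.
  by case: eqP => // /addrI/(step_inj hh) e; rewrite e eqxx in cc.
have cS := composable_step hh ld BE AE.
case: ifP => [/cS rows|/negP nocomp].
  have [r [c [rr cr CE]]] := orbit_coordinates C.
  (* The exponents w and w' depend on C alone, so any odd prime produces them as natural numbers. *)
  have [_ p3] := Fp_odd (isT : prime 3) isT.
  have [w [w' [wE wE' _]]] := card_step_flags hh rr cr CE p3 ld BE rows AE.
  rewrite wE wE' -!eval_v2Xn; apply: (canRL (mulfK v2_neq1)).
  have -> : v ^+ 2 - 1 = eval_v2 ('X^1 + (-1)%:P).
    by rewrite eval_v2D eval_v2Xn eval_v2C mulr1 mulrN1z.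
  rewrite -eval_v2M; apply: (canRL (addrK _)); rewrite -eval_v2D; congr eval_v2.
  apply: poly_int_eq => p pp po.
  have [Fo pF] := Fp_odd pp po.
  have := hg Fo (split_form_sym 'F_p d) (split_form_unit 'F_p d) B A
    (coord_flag_is_flag 'F_p rr) (coord_flag_is_flag 'F_p cr) (coord_flag_orbit 'F_p rr cr CE).
  rewrite card_Fp // hornerD hornerM hornerD !hornerXn hornerC => ->.
  have [w1 [w1' []]] := card_step_flags hh rr cr CE pF ld BE rows AE.
  rewrite wE wE' => -[<-] [<-]; rewrite card_Fp // => /(congr1 Posz).
  have PX k : (p ^ k)%N%:Z = p%:Z ^+ k by rewrite -[LHS]natz natrX natz.
  rewrite PoszD PoszM !PX => <-; congr (_ * _ + _).
  by have := prime_gt0 pp; clear; lia.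
rewrite (flags_eq hg (P := 0)) ?rmorph0 /eval_v2 ?rmorph0 ?horner0 //.
move=> p r c pp po rr cr CE; rewrite horner0; apply/esym; congr Posz; apply/eqP.
rewrite cards_eq0; apply/eqP/setP => V; rewrite !inE; apply/and3P => -[hV oB oA].
have hV1 := coord_flag_is_flag 'F_p rr; have hV2 := coord_flag_is_flag 'F_p cr.
have oC := coord_flag_orbit 'F_p rr cr CE.
have Qs := split_form_sym 'F_p d; have Qu := split_form_unit 'F_p d.
have [rows _] := (near_orbit Qs Qu hh ld BE hV1 hV).1 oB.
apply: nocomp; apply/cS => i iN; rewrite rows // (in_orbitP hV1 hV2 _ oC) //.
by rewrite (rhoNr _ hV2).
Qed.

(** A diagonal B forces V = V1, and then A must be the position of (V1, V2). *)
Lemma schur_diag (B A C : Xi n d) : is_diag_mx (Xi_mx B) ->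
  eval_v2 (g B A C) = (composable_mx (Xi_mx B) (Xi_mx A) && (A == C))%:R.
Proof.
move=> Bd.
rewrite (flags_eq hg (P := (composable_mx (Xi_mx B) (Xi_mx A) && (A == C))%:R%:P)).
  by rewrite eval_v2C; case: (_ && _).
move=> p r c pp po rr cr CE; rewrite hornerC.
have hV1 := coord_flag_is_flag 'F_p rr; have hV2 := coord_flag_is_flag 'F_p cr.
have /(in_orbitP hV1 hV2) oC := coord_flag_orbit 'F_p rr cr CE.
set V1 := coord_flag _ _ in hV1 oC *; set V2 := coord_flag _ _ in hV2 oC *.
pose s i := \sum_(a < N n | (a < i)%N) Xi_mx B a a.
have BE i j : psum (Xi_mx B) i j = s (minn i j) by rewrite psum_diag.
have key V : [&& is_flag (split_form 'F_p d) V, in_orbit B V1 V & in_orbit A V V2] =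
    (V == V1) && (composable_mx (Xi_mx B) (Xi_mx A) && (A == C)).
  apply/and3P/and3P => [[hV /(in_orbitP hV1 hV) oB /(in_orbitP hV hV2) oA]|[/eqP -> cBA /eqP AC]].
    have VE : V = V1.
      apply: flag_ext => i iN; apply: (flag_eqP hV iN (flag_gen hV1 iN)).
      have e1 := oB i i iN iN; have e2 := oB i _ iN (leqnn _); have e3 := oB _ i (leqnn _) iN.
      rewrite BE minnn in e1; rewrite BE (minn_idPl iN) (rhoNr _ hV) e1 in e2.
      rewrite BE (minn_idPr iN) (rhoNl _ hV1) e1 in e3.
      apply/eqmxP/andP; move: e2 e3 => [e2] [e3].
      by split; apply: rank_capl; rewrite -?e2 -?e3 /rho // capmxC.
    rewrite VE in oA oB; split; first by rewrite VE.
      apply/composable_psum => i iN; rewrite oA // (rhoNr _ hV2) oB //.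
      by rewrite (rhoNl _ hV1).
    by apply/eqP/Xi_mx_inj/psum_inj => i j iN jN; rewrite oA // oC.
  split=> //; last by rewrite AC; apply/(in_orbitP hV1 hV2).
  apply/(in_orbitP hV1 hV1) => i j iN jN; rewrite BE.
  move/composable_psum: cBA; rewrite AC => cBC.
  have mN : (minn i j <= N n)%N by rewrite geq_min iN.
  have := cBC _ mN; rewrite BE (minn_idPr mN) => ->.
  rewrite oC // (rhoNr _ hV2) /rho; congr Posz.
  apply/eqmx_rank/andP; split.
    by rewrite sub_capmx !(flag_sub hV1) ?geq_minl ?geq_minr.
  by case: (leqP i j) => _; rewrite ?capmxSl ?capmxSr.
rewrite /count_flags; case: (boolP (_ && _)) key => _ key.
  rewrite (_ : [set V | _] = [set V1]) ?cards1 //.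
  by apply/setP => V; rewrite !inE key andbT.
rewrite (_ : [set V | _] = set0) ?cards0 //.
by apply/setP => V; rewrite !inE key andbF.
Qed.
End StepConstants.

(** * Structure constants of the stabilized algebra *)

Section ExponentialPolynomials.

(* sequences p |-> sum_i c_i v^(z_i p) *)
Definition vexp_poly (f : nat -> Qv) : Prop :=
  exists (P : {poly Qv}) (k : nat), forall p, f p = v ^- (k * p) * P.[v ^+ p].

Lemma vexp_poly_ext f f' : f =1 f' -> vexp_poly f -> vexp_poly f'.
Proof. by move=> E [P [k h]]; exists P, k => p; rewrite -E. Qed.

Lemma vexp_poly_cst c : vexp_poly (fun=> c).
Proof. by exists c%:P, 0%N => p; rewrite hornerC mul0n expr0 invr1 mul1r. Qed.

Lemma vexp_polyD f f' : vexp_poly f -> vexp_poly f' -> vexp_poly (fun p => f p + f' p).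
Proof.
case=> P [k h] [P' [k' h']]; exists (P * 'X^k' + P' * 'X^k), (k + k')%N => p.
rewrite h h' !hornerE -!exprM mulnDl exprD invfM [(p * k')%N]mulnC [(p * k)%N]mulnC.
have v0 j : v ^+ j != 0 by rewrite expf_neq0 ?v_neq0.
rewrite mulrDr; congr (_ + _).
  by rewrite -!mulrA [X in _ = _ * X]mulrCA mulVf // mulr1.
by rewrite [X in _ = X * _]mulrC -!mulrA [X in _ = _ * X]mulrCA mulVf // mulr1.
Qed.

Lemma vexp_polyM f f' : vexp_poly f -> vexp_poly f' -> vexp_poly (fun p => f p * f' p).
Proof.
case=> P [k h] [P' [k' h']]; exists (P * P'), (k + k')%N => p.
by rewrite h h' hornerM mulnDl exprD invfM mulrACA.
Qed.

Lemma vexp_poly_sum (I : Type) (s : seq I) (Q : pred I) (F : I -> nat -> Qv) :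
  (forall i, Q i -> vexp_poly (F i)) -> vexp_poly (fun p => \sum_(i <- s | Q i) F i p).
Proof.
move=> h; elim: s => [|i s IH].
  by apply: vexp_poly_ext (vexp_poly_cst 0) => p; rewrite big_nil.
case Qi: (Q i).
  by apply: vexp_poly_ext (vexp_polyD (h _ Qi) IH) => p; rewrite big_cons Qi.
by apply: vexp_poly_ext IH => p; rewrite big_cons Qi.
Qed.

Lemma vexp_poly_exp (a b : int) : vexp_poly (fun p => v ^ (a + p%:Z * b)).
Proof.
have v0 : v != 0 := v_neq0.
apply: (@vexp_poly_ext (fun p => v ^ a * v ^ (p%:Z * b))).
  by move=> p; rewrite expfzDr.
apply: vexp_polyM (vexp_poly_cst _) _; case: b => b.
  by exists 'X^b, 0%N => p; rewrite hornerXn mul0n expr0 invr1 mul1r -exprM -PoszM.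
exists 1, b.+1 => p; rewrite hornerC mulr1 NegzE mulrN -PoszM exprnN.
by rewrite mulnC.
Qed.

Lemma vexp_poly_horner (G : {poly Qv}) : vexp_poly (fun p => G.[v ^- (2 * p)]).
Proof.
elim/poly_ind: G => [|G c IH].
  by apply: vexp_poly_ext (vexp_poly_cst 0) => p; rewrite horner0.
have vX := vexp_poly_exp 0 (- 2).
apply: vexp_poly_ext (vexp_polyD (vexp_polyM IH vX) (vexp_poly_cst c)) => p.
by rewrite hornerMXaddC add0r mulrN -PoszM exprnN mulnC.
Qed.

(** Cleared of negative powers, both sides are polynomials in v^p that agree at infinitely many
    distinct points, hence everywhere. The point 1 is the case p = 0. *)
Lemma vexp_poly_eq0 f f' p0 : vexp_poly f -> vexp_poly f' ->
  (forall p, (p0 <= p)%N -> f p = f' p) -> f 0%N = f' 0%N.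
Proof.
case=> P [k h] [P' [k' h']] E.
have v0 j : v ^+ j != 0 by rewrite expf_neq0 ?v_neq0.
suff R : P * 'X^k' = P' * 'X^k.
  have := congr1 (fun Q : {poly Qv} => Q.[1]) R.
  by rewrite h h' !muln0 !expr0 invr1 !mul1r !hornerM !hornerXn !expr1n !mulr1.
apply/eqP; rewrite -subr_eq0; apply/negPn/negP.
set R := P * 'X^k' - P' * 'X^k => R0.
pose s := [seq v ^+ p | p <- iota p0 (size R)].
have := @max_poly_roots _ R s R0; rewrite size_map size_iota ltnn => hs.
suff : false by []; apply: hs; last first.
  by rewrite map_inj_uniq ?iota_uniq //; exact: vX_inj.
apply/allP => x /mapP[p]; rewrite mem_iota => /andP[pp _] -> {x}.
rewrite /root /R !hornerE subr_eq0 -!exprM [(p * k)%N]mulnC [(p * k')%N]mulnC.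
have := E p pp; rewrite h h' => e.
rewrite -(inj_eq (mulfI (invr_neq0 (v0 (k * p)%N)))) mulrA e.
by rewrite [X in X == _]mulrAC mulVf // mul1r mulrCA mulVf // mulr1.
Qed.
End ExponentialPolynomials.

(** * Exponents and coefficients as functions of the shift *)

Section ExtendedDimension.
Variable n : nat.
Implicit Type M : 'M[int]_(N n).

Definition affine (f : int -> int) := forall z, f z = f 0 + z * (f 1 - f 0).

Lemma affine_sum (I : finType) (P : pred I) (F : I -> int -> int) :
  (forall i, P i -> affine (F i)) -> affine (fun z => \sum_(i | P i) F i z).
Proof.
move=> h z; rewrite -sumrB mulr_sumr -big_split; apply: eq_bigr => i Pi; exact: h.
Qed.

Lemma affineD f f' : affine f -> affine f' -> affine (fun z => f z + f' z).
Proof. by move=> h h' z; rewrite h h'; ring. Qed.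

(** The exponent d_A for integer matrices, whose diagonal may be negative. The absolute values
    concern off-diagonal entries only, since j < n <= i. *)
Definition dZ M : int :=
  (\sum_(i < N n) \sum_(j < N n) \sum_(k < N n | (k < i)%N)
      \sum_(l < N n | (j < l)%N && (i + k + 1 < N n)%N) M i j * M k l)
   + (\sum_(i < N n) \sum_(j < N n)
      \sum_(l < N n | (j < l)%N && ((i < n)%N || (j + l + 1 < N n)%N)) M i j * M i l)
   + (\sum_(i < N n | (n <= i)%N) \sum_(j < N n | (j < n)%N)
        ((`|M i j| * `|M i j|.-1) %/ 2)%N%:Z).

Lemma dZ_Xi d (A : Xi n d) : dZ (Xi_mx A) = (dA A)%:Z.
Proof.
rewrite /dZ /dA !PoszD !Posz_sum; congr (_ + _ + _); apply: eq_bigr => i _.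
- rewrite Posz_sum; apply: eq_bigr => j _; rewrite Posz_sum; apply: eq_bigr => k _.
  by rewrite Posz_sum; apply: eq_bigr => l _; rewrite !Xi_mxE PoszM.
- rewrite Posz_sum; apply: eq_bigr => j _; rewrite Posz_sum; apply: eq_bigr => l _.
  by rewrite !Xi_mxE PoszM.
by rewrite Posz_sum; apply: eq_bigr => j _; rewrite Xi_mxE.
Qed.

(* No term of d_A is quadratic in the diagonal. *)
Lemma dZ_affine M : affine (fun z => dZ (M + z%:M)).
Proof.
have mul i j k l : (i == j) && (k == l) = false ->
    affine (fun z => (M + z%:M) i j * (M + z%:M) k l).
  move=> ne z; rewrite !mxE; move: ne.
  by case: (i == j); case: (k == l) => //= _; rewrite ?mulr1n ?mulr0n; ring.
rewrite /dZ; apply: affineD; first apply: affineD.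
- apply: affine_sum => i _; apply: affine_sum => j _; apply: affine_sum => k ki.
  apply: affine_sum => l /andP[jl _]; apply: mul; apply/negP => /andP[/eqP e /eqP e'].
  by move: ki jl; rewrite e e'; clear; lia.
- apply: affine_sum => i _; apply: affine_sum => j _; apply: affine_sum => l /andP[jl _].
  apply: mul; apply/negP => /andP[/eqP e /eqP e'].
  by move: jl; rewrite -e e'; clear; lia.
apply: affine_sum => i ni; apply: affine_sum => j jn z; rewrite !mxE.
suff -> : (i == j) = false by rewrite /= !mulr0n subrr mulr0 !addr0.
by apply/negP => /eqP e; move: ni jn; rewrite e; clear; lia.
Qed.

Lemma row_weight_shift h M z j : row_weight h (M + z%:M) j =
  row_weight h M j + z * (psum (1%:M : 'M[int]_(N n)) h.+1 j - psum (1%:M : 'M[int]_(N n)) h j).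
Proof.
have sc i : psum (M + z%:M) i j = psum M i j + z * psum (1%:M : 'M[int]_(N n)) i j.
  rewrite psumD /psum; congr (_ + _); rewrite mulr_sumr; apply: eq_bigr => a _.
  by rewrite mulr_sumr; apply: eq_bigr => b _; rewrite !mxE; case: (a == b); rewrite ?mulr1 ?mulr0.
by rewrite /row_weight !sc; ring.
Qed.

(** The shift cancels in A = C + [step h c], so the contributing c do not depend on p; only the
    exponents do, and they are affine in p. *)
Lemma step_coef_shift h (A C : 'M[int]_(N n)) :
  vexp_poly (fun p => step_coef h (A + (2 * p)%:Z%:M) (C + (2 * p)%:Z%:M)).
Proof.
rewrite /step_coef; apply: vexp_poly_sum => c _.
have E p : (A + (2 * p)%:Z%:M == C + (2 * p)%:Z%:M + step h c) = (A == C + step h c).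
  by rewrite addrAC (inj_eq (addIr _)).
case: (boolP (A == C + step h c)) => ne; last first.
  by apply: vexp_poly_ext (vexp_poly_cst 0) => p; rewrite E (negPf ne).
apply: (@vexp_poly_ext (fun p => (v ^ (2 * row_weight h (C + (2 * p)%:Z%:M) c.+1)
    + (-1) * v ^ (2 * row_weight h (C + (2 * p)%:Z%:M) c)) * (v ^+ 2 - 1)^-1)).
  by move=> p; rewrite E ne mulN1r.
have W j : vexp_poly (fun p => v ^ (2 * row_weight h (C + (2 * p)%:Z%:M) j)).
  apply: (vexp_poly_ext _ (vexp_poly_exp (2 * row_weight h C j)
    (4 * (psum (1%:M : 'M[int]_(N n)) h.+1 j - psum (1%:M : 'M[int]_(N n)) h j)))) => p.
  by congr (v ^ _); rewrite row_weight_shift PoszM; ring.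
apply: vexp_polyM (vexp_poly_cst _); apply: vexp_polyD (W _) _.
exact: vexp_polyM (vexp_poly_cst _) (W _).
Qed.
End ExtendedDimension.

Section LinearExtension.
Variables (R : nzRingType) (I : choiceType) (V : lmodType R).
Implicit Types (F : I -> V) (x y : {malg R[I]}).

Definition lin_ext F x : V := \sum_(k <- msupp x) x@_k *: F k.

Lemma lin_extEw F x (e : {fset I}) : (msupp x `<=` e)%fset ->
  lin_ext F x = \sum_(k <- e) x@_k *: F k.
Proof.
move=> xe; apply: big_fset_incl => // k _ kx.
by rewrite mcoeff_outdom ?scale0r.
Qed.

Lemma lin_extP F a x y : lin_ext F (a *: x + y) = a *: lin_ext F x + lin_ext F y.
Proof.
pose e := (msupp x `|` msupp y `|` msupp (a *: x + y))%fset.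
have xe : (msupp x `<=` e)%fset by rewrite /e -fsetUA fsubsetUl.
have ye : (msupp y `<=` e)%fset by rewrite /e fsetUAC fsubsetUr.
have ze : (msupp (a *: x + y) `<=` e)%fset by rewrite /e fsubsetUr.
rewrite (lin_extEw F xe) (lin_extEw F ye) (lin_extEw F ze).
rewrite scaler_sumr -big_split; apply: eq_bigr => k _ /=.
by rewrite scalerA -scalerDl mcoeffD mcoeffZ.
Qed.

Lemma lin_extU F k : lin_ext F << k >> = F k.
Proof. by rewrite /lin_ext msuppU oner_eq0 big_seq_fset1 mcoeffUU scale1r. Qed.

Lemma lin_ext_linear F : linear (lin_ext F).
Proof. by move=> a x y; exact: lin_extP. Qed.

Lemma lin_ext_eq F F' : F =1 F' -> lin_ext F =1 lin_ext F'.
Proof. by move=> E x; apply: eq_bigr => k _; rewrite E. Qed.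

Lemma malg_lin_ext (f : {linear {malg R[I]} -> V}) x : f x = lin_ext (fun k => f << k >>) x.
Proof.
rewrite {1}[x]monalgE linear_sum; apply: eq_bigr => k _.
rewrite -linearZ; congr (f _); apply/malgP => k'.
by rewrite mcoeffZ !mcoeffU mulr_natr.
Qed.
End LinearExtension.

Lemma laurent_valM : {morph laurent_val : x y / x * y}.
Proof. exact: (rmorphM (val : laurent -> Qv)). Qed.

Lemma laurent_vexp z : laurent_val (vexp z) = v ^ z. Proof. by []. Qed.

Section Coefficients.
Variable n : nat.

Lemma toQE (I : choiceType) (x : {malg laurent[I]}) k : (toQ x)@_k = laurent_val x@_k.
Proof. by rewrite /toQ mcoeffE; case: msuppP. Qed.

Lemma mcoeff_sum (I : choiceType) (R : zmodType) (J : Type) (s : seq J) (P : pred J)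
    (F : J -> {malg R[I]}) k : (\sum_(j <- s | P j) F j)@_k = \sum_(j <- s | P j) (F j)@_k.
Proof.
elim: s => [|j s IH]; first by rewrite !big_nil mcoeff0.
by rewrite !big_cons; case: (P j); rewrite // mcoeffD IH.
Qed.

Lemma schur_e_coef d (A C : Xi n d) : (schur_e A)@_C = (A == C)%:R.
Proof. exact: (mcoeffU A (1 : laurent) C). Qed.

Lemma schur_std_coef d (M : 'M[int]_(N n)) (C : Xi n d) :
  (schur_std d M)@_C = if M == Xi_mx C then vexp (- (dA C)%:Z) else 0.
Proof.
rewrite /schur_std; case: pickP => [A /eqP <-|noA]; last first.
  by case: eqP => [E|_]; rewrite ?mcoeff0 //; have := noA C; rewrite E eqxx.
rewrite mcoeffZ schur_e_coef (inj_eq (@Xi_mx_inj n d)).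
by case: eqP => [->|_]; rewrite ?mulr1 ?mulr0.
Qed.

Lemma schurZ_coef d (c : laurent) (x : schur n d) C : (c *: x)@_C = c * x@_C.
Proof. exact: mcoeffZ. Qed.

Lemma schur_sum_coef d (J : finType) (F : J -> schur n d) C :
  (\sum_j F j)@_C = \sum_j (F j)@_C.
Proof. exact: mcoeff_sum. Qed.

Lemma sum_schur_e_coef d (c : Xi n d -> laurent) (C : Xi n d) :
  (\sum_A c A *: schur_e A)@_C = c C.
Proof.
rewrite schur_sum_coef (eq_bigr (fun A => c A * (A == C)%:R)) => [|A _].
  rewrite (bigD1 C) //= eqxx mulr1 big1 ?addr0 // => A /negPf ->.
  exact: mulr0.
by rewrite schurZ_coef schur_e_coef.
Qed.

Lemma schur_mul_coef (g : structure_constants n) d (x y : schur n d) C :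
  (schur_mul g x y)@_C =
  \sum_A \sum_A' x@_A * y@_A' * (map_poly intr (g d A A' C)).[vexp 2].
Proof.
rewrite schur_sum_coef; apply: eq_bigr => A _; rewrite schur_sum_coef; apply: eq_bigr => A' _.
exact: sum_schur_e_coef.
Qed.

Lemma schur_mul_std (g : structure_constants n) d (A B C : Xi n d) :
  (schur_mul g (schur_std d (Xi_mx B)) (schur_std d (Xi_mx A)))@_C =
  vexp (- (dA B)%:Z) * vexp (- (dA A)%:Z) * (map_poly intr (g d B A C)).[vexp 2].
Proof.
rewrite schur_mul_coef (bigD1 B) //= (bigD1 A) //= !schur_std_coef !eqxx.
rewrite big1 ?addr0 => [|A' ne]; last first.
  by rewrite !schur_std_coef (inj_eq (@Xi_mx_inj n d)) eq_sym (negPf ne) mulr0 mul0r.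
rewrite big1 ?addr0 // => B' ne; apply: big1 => A' _.
by rewrite !schur_std_coef (inj_eq (@Xi_mx_inj n d)) eq_sym (negPf ne) !mul0r.
Qed.

Lemma K_mulE (m : Xit n -> Xit n -> K n) (x y : K n) :
  K_mul m x y = lin_ext (fun A => lin_ext (m A) y : K n) x.
Proof.
apply: eq_bigr => A _; rewrite /lin_ext scaler_sumr; apply: eq_bigr => B _.
by rewrite scalerA.
Qed.

Lemma K_mulU (m : Xit n -> Xit n -> K n) (A B : Xit n) : K_mul m << A >> << B >> = m A B.
Proof. by rewrite K_mulE !lin_extU. Qed.

Lemma Xit_ge0 (A : Xit n) i j : i != j -> 0 <= val A i j.
Proof. by have /and3P[/'forall_forallP/(_ i j)/implyP] := valP A. Qed.
Lemma Xit_sym (A : Xit n) : theta_sym (val A).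
Proof. by have /and3P[] := valP A. Qed.
Lemma Xit_odd (A : Xit n) : odd `|val A (mid n) (mid n)|%N.
Proof. by have /and3P[] := valP A. Qed.

Lemma theta_sym_shift (A : 'M[int]_(N n)) z : theta_sym A -> theta_sym (A + z%:M).
Proof.
move/theta_symP => h; apply/theta_symP => i j; rewrite !mxE -h.
by rewrite (inj_eq (@rev_ord_inj _)).
Qed.

Lemma shift0 (A : Xit n) : shift 0 A = val A.
Proof. by rewrite /shift muln0; apply/matrixP => i j; rewrite !mxE mul0rn addr0. Qed.
End Coefficients.

(** * Reading off the products of the stabilized algebra *)

Section Stabilization.
Variables (n : nat) (g : structure_constants n) (m : Xit n -> Xit n -> K n).
Hypothesis hm : is_stabilization g m.

Let total (M : 'M[int]_(N n)) := \sum_i \sum_j M i j.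

Lemma total_shift (M : 'M[int]_(N n)) z : total (M + z%:M) = total M + z * (N n)%:Z.
Proof.
rewrite /total -[X in z * X%:Z]card_ord -natz mulr_natr -sumr_const -big_split.
apply: eq_bigr => i _ /=.
transitivity (\sum_j M i j + \sum_j (z *+ (i == j))).
  by rewrite -big_split; apply: eq_bigr => j _; rewrite !mxE.
congr (_ + _); rewrite (bigD1 i) //= eqxx big1 ?addr0 ?mulr1 // => j ji.
by rewrite eq_sym (negPf ji).
Qed.

(* The coefficients of [B][A] are read off the large p: f is an exponential
   polynomial, so its value at p = 0 is the value of G(v, v') at v' = 1. *)
Lemma stabilization_coef (B A C : Xit n) (f : nat -> Qv) :
  composable B A -> vexp_poly f ->
  (forall d p (B' A' C' : Xi n d), (0 < d)%N -> Xi_mx B' = shift p B ->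
     Xi_mx A' = shift p A -> Xi_mx C' = shift p C -> eval_v2 (@g d B' A' C') = f p) ->
  (total (val A) != total (val C) -> f 0%N = 0) ->
  laurent_val (m B A)@_C = v ^ (dZ (val C) - dZ (val B) - dZ (val A)) * f 0%N.
Proof.
move=> cBA fE fS f0; case: hm => _ _ /(_ B [:: A]); rewrite /= cBA => /(_ isT).
case=> ZG [[p0 big] /(congr1 (mcoeff C))]; rewrite toQE K_mulU => ->.
pose G := \sum_(z <- ZG | z.1 == C) z.2.
have -> : (\sum_(z <- ZG) z.2.[1] *: << z.1 >>)@_C = G.[1].
  rewrite mcoeff_sum horner_sum [RHS]big_mkcond; apply: eq_bigr => z _.
  by rewrite mcoeffZ mcoeffU; case: eqP; rewrite ?mulr1 ?mulr0.
(* If the totals differ, shifts of A and C never lie in the same [Xi n d], so [fS] gives no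
   information. But the shifted Z_i lie in the same [Xi n d] as the shift of A, so none of them is C
   and G is an empty sum. *)
have [tE|tne] := eqVneq (total (val A)) (total (val C)); last first.
  rewrite f0 // mulr0 /G big_seq_cond big_pred0 ?horner0 // => z.
  apply/negP => /andP[zZ /eqP zC]; have [d [_ aA aZ _]] := big p0 (leqnn _).
  case/and3P: aA => _ aA _; have := in_Xi_sum aA; have := in_Xi_sum (allP aZ _ zZ).
  rewrite zC -!/(total _) !total_shift => <- /addIr e.
  by rewrite e eqxx in tne.
(* From [p1] on, the shift makes all diagonal entries of C nonnegative. *)
pose p1 := maxn p0 (\sum_i `|val C i i|)%N.
(* [f] corrected by the powers of v that relate standard basis elements to characteristic
   functions. *)
pose f' p := v ^ (dZ (shift p C) - dZ (shift p B) - dZ (shift p A)) * f p.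
have f'E : vexp_poly f'.
  apply: vexp_polyM fE; rewrite /shift.
  pose a (M : 'M[int]_(N n)) := dZ (M + 1%:M) - dZ (M + 0%:M).
  pose b (M : 'M[int]_(N n)) := dZ (M + 0%:M).
  apply: (vexp_poly_ext _ (vexp_poly_exp (b (val C) - b (val B) - b (val A))
     (2 * (a (val C) - a (val B) - a (val A))))) => p; congr (v ^ _).
  by rewrite (dZ_affine (val C)) (dZ_affine (val B)) (dZ_affine (val A)) /a /b PoszM; ring.
transitivity (f' 0%N); last by rewrite /f' !shift0.
transitivity (G.[v ^- (2 * 0)]); first by rewrite muln0 expr0 invr1.
apply: (vexp_poly_eq0 (p0 := p1) (vexp_poly_horner G) f'E).
move=> p pp; have [d [d0 aA aZ E]] := big p (leq_trans (leq_maxl _ _) pp).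
case/and3P: aA => /in_XiP[B' BE] /in_XiP[A' AE] _.
have /in_XiP[C' CE'] : in_Xi d (shift p C).
  apply: in_Xi_intro.
  - move=> i j; rewrite !mxE; have [->|ij] := eqVneq i j; last by rewrite addr0 Xit_ge0.
    have : (`|val C j j| <= p)%N.
      apply: leq_trans (leq_trans (leq_maxr _ _) pp).
      by rewrite (bigD1 j) //= leq_addr.
    by rewrite mulr1n; move: (val C j j) => z; clear; lia.
  - exact/theta_sym_shift/Xit_sym.
  - by rewrite -(Xi_mx_sum A') AE -!/(total _) !total_shift tE.
have := congr1 (mcoeff C') E; rewrite toQE -BE -AE schur_mul_std mcoeff_sum.
have -> : \sum_(z <- ZG) (z.2.[v ^- (2 * p)] *: toQ (schur_std d (shift p z.1)))@_C' =
   G.[v ^- (2 * p)] * v ^ (- (dA C')%:Z).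
  rewrite horner_sum mulr_suml [RHS]big_mkcond; apply: eq_bigr => z _.
  rewrite mcoeffZ toQE schur_std_coef CE' (inj_eq (addIr _)) (inj_eq val_inj).
  by case: eqP => // _; rewrite mulr0.
rewrite !laurent_valM !laurent_vexp eval_v2E (fS _ _ _ _ _ d0 BE AE CE') -!dZ_Xi BE AE CE' => e.
have vE z : v ^ z != 0 by rewrite expfz_neq0 ?v_neq0.
apply: (mulIf (vE (- dZ (shift p C)))); rewrite -e /f'.
rewrite [RHS]mulrAC -expfzDr ?v_neq0 // -expfzDr ?v_neq0 //; congr (v ^ _ * _); ring.
Qed.
End Stabilization.

(** * Generation *)

Section StepMatrices.
Variable n : nat.
Implicit Types (M A C : 'M[int]_(N n)) (a b c : 'I_(N n)) (h : nat).

Lemma EthetaE (k l : nat) a b : (k < N n)%N -> (l < N n)%N ->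
  Etheta n k l a b = ((a == k :> nat) && (b == l :> nat))%:R +
    ((a == (N n - k.+1)%N :> nat) && (b == (N n - l.+1)%N :> nat))%:R.
Proof.
move=> hk hl; rewrite /Etheta !mxE -!(inj_eq val_inj) /= !inordK //.
Qed.

Lemma stepE h c a b : (0 < h < N n)%N ->
  step h c a b = ((a.+1 == h) && (b == c))%:R - ((a == h :> nat) && (b == c))%:R
    + ((a == (N n - h)%N :> nat) && (b == rev_ord c))%:R
    - ((a == (N n - h.+1)%N :> nat) && (b == rev_ord c))%:R.
Proof.
move=> /andP[h0 hN]; rewrite /step !mxE -/(Etheta n h.-1 c a b) -/(Etheta n h c a b).
have := EthetaE (k := h.-1) (l := c) a b; have := EthetaE (k := h) (l := c) a b.
rewrite !mxE => -> // ->; rewrite ?(leq_ltn_trans (leq_pred h)) // prednK //.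
rewrite -!(inj_eq val_inj) /= (_ : (nat_of_ord a == h.-1) = (a.+1 == h)).
  by rewrite opprD !addrA; congr (_ - _); rewrite addrAC.
by move: h0; clear; lia.
Qed.

Lemma Etheta_mid h : (0 < h < N n)%N -> Etheta n h h.-1 (mid n) (mid n) = 0.
Proof.
move=> /andP[h0 hN]; rewrite EthetaE ?(leq_ltn_trans (leq_pred h)) //.
rewrite (prednK h0).
have -> : (mid n == h :> nat) && (mid n == h.-1 :> nat) = false by clear -h0; lia.
have -> // : (mid n == (N n - h.+1)%N :> nat) && (mid n == (N n - h)%N :> nat) = false.
by clear -hN; lia.
Qed.

Lemma rev_ord_eqC a b : (rev_ord a == b) = (a == rev_ord b).
Proof. by rewrite (can2_eq (@rev_ordK _) (@rev_ordK _)). Qed.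

Lemma Etheta_sym (k l : nat) : theta_sym (Etheta n k l).
Proof.
apply/theta_symP => a b; rewrite /Etheta !mxE !rev_ord_eqC !rev_ordK; exact: addrC.
Qed.

Lemma theta_symD A C : theta_sym A -> theta_sym C -> theta_sym (A + C).
Proof. by move=> /theta_symP hA /theta_symP hC; apply/theta_symP => a b; rewrite !mxE hA hC. Qed.
Lemma theta_symN A : theta_sym A -> theta_sym (- A).
Proof. by move=> /theta_symP hA; apply/theta_symP => a b; rewrite !mxE hA. Qed.
Lemma step_sym h c : theta_sym (step h c).
Proof. by apply: theta_symD (Etheta_sym _ _) (theta_symN (Etheta_sym _ _)). Qed.

Lemma row_sum_sym A a : theta_sym A -> row_sum A (rev_ord a) = row_sum A a.
Proof.
move/theta_symP => h; rewrite /row_sum (reindex_inj (@rev_ord_inj _)) /=.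
by apply: eq_bigr => b _; rewrite -h.
Qed.

Lemma row_sumD A C a : row_sum (A + C) a = row_sum A a + row_sum C a.
Proof. by rewrite /row_sum -big_split; apply: eq_bigr => b _; rewrite mxE. Qed.
Lemma col_sumD A C a : col_sum (A + C) a = col_sum A a + col_sum C a.
Proof. by rewrite /col_sum -big_split; apply: eq_bigr => b _; rewrite mxE. Qed.

Lemma row_sum_diag A a : is_diag_mx A -> row_sum A a = A a a.
Proof.
move/is_diag_mxP => dA; rewrite /row_sum (bigD1 a) //= big1 ?addr0 // => b ba.
by rewrite dA // eq_sym; apply: contraNN ba => /eqP/val_inj->.
Qed.
Lemma col_sum_diag A a : is_diag_mx A -> col_sum A a = A a a.
Proof.
move/is_diag_mxP => dA; rewrite /col_sum (bigD1 a) //= big1 ?addr0 // => b ba.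
by rewrite dA //; apply: contraNN ba => /eqP/val_inj->.
Qed.

Lemma row_sum_Etheta (k l : nat) a : (k < N n)%N -> (l < N n)%N ->
  row_sum (Etheta n k l) a = (a == k :> nat)%:R + (a == (N n - k.+1)%N :> nat)%:R.
Proof.
move=> hk hl; rewrite row_sum_psum !psum_Etheta //.
by have := ltn_ord a; move: hk hl; move: (nat_of_ord a) => b; clear; lia.
Qed.
Lemma col_sum_Etheta (k l : nat) a : (k < N n)%N -> (l < N n)%N ->
  col_sum (Etheta n k l) a = (a == l :> nat)%:R + (a == (N n - l.+1)%N :> nat)%:R.
Proof.
move=> hk hl; rewrite col_sum_psum !psum_Etheta //.
by have := ltn_ord a; move: hk hl; move: (nat_of_ord a) => b; clear; lia.
Qed.

Definition mx_total M : int := psum M (N n) (N n).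
Lemma mx_totalE M : mx_total M = \sum_i \sum_j M i j.
Proof.
rewrite /mx_total /psum; apply: eq_big => [a|a _]; first by rewrite ltn_ord.
by apply: eq_bigl => b; rewrite ltn_ord.
Qed.

Lemma mx_total_step h c : (0 < h < N n)%N -> mx_total (step h c) = 0.
Proof.
move=> hh; rewrite /mx_total psum_step //; have := ltn_ord c; move: hh; clear.
by rewrite /N; lia.
Qed.

Lemma row_weightS h (hN : (h < N n)%N) C c :
  row_weight h C c.+1 = row_weight h C c + C (Ordinal hN) c - ((h == n) && (c == n :> nat))%:R.
Proof.
have E j : psum C h.+1 j - psum C h j = \sum_(b < N n | (b < j)%N) C (Ordinal hN) b.
  by rewrite (psumSl C (Ordinal hN)) /= addrC addKr.
rewrite /row_weight !E sum_ordS.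
suff -> : ((h == n) && (n < c.+1)%N)%:R = ((h == n) && (n < c)%N)%:R + ((h == n) && (c == n :> nat))%:R :> int.
  by ring.
by case: (h == n) => //=; clear; lia.
Qed.

Lemma vexpz_inj : injective (fun z : int => v ^ z).
Proof.
have v0 : v != 0 := v_neq0.
move=> x y /= E; apply/eqP; rewrite -subr_eq0; apply/eqP.
have : v ^ (x - y) = 1 by rewrite expfzDr // E -expfzDr // subrr expr0z.
have X k : v ^+ k = 1 -> k = 0%N by move=> e; apply: vX_inj; rewrite e expr0.
case: (x - y) => k; first by move/X->.
by rewrite NegzE -exprnN => /eqP; rewrite invr_eq1 => /eqP/X.
Qed.

Lemma step_coef_single h c A C : (0 < h < N n)%N -> A = C + step h c ->
  step_coef h A C = (v ^ (2 * row_weight h C c.+1) - v ^ (2 * row_weight h C c)) / (v ^+ 2 - 1).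
Proof.
move=> hh AE; rewrite /step_coef (bigD1 c) //= AE eqxx big1 ?addr0 // => c' cc.
by case: eqP => // /addrI/(step_inj hh) e; rewrite e eqxx in cc.
Qed.

(** The coefficient is a multiple of v^(2w') - v^(2w), where w' - w is the entry (h, c) of C, less 1
    at the middle position. *)
Lemma step_coef_neq0 h (hN : (h < N n)%N) A C : (0 < h)%N -> step_coef h A C != 0 ->
  exists2 c, A = C + step h c & C (Ordinal hN) c != ((h == n) && (c == n :> nat))%:R.
Proof.
move=> h0 ne; have hh : (0 < h < N n)%N by rewrite h0.
case: (pickP (fun c => A == C + step h c)) => [c /eqP AE|noc]; last first.
  by rewrite /step_coef big1 ?eqxx // in ne => c _; rewrite noc.
exists c => //; apply: contraNneq ne => e.
by rewrite (step_coef_single hh AE) (row_weightS hN) e addrK subrr mul0r.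
Qed.

Lemma step_coef_single_neq0 h (hN : (h < N n)%N) c A C : (0 < h)%N -> A = C + step h c ->
  C (Ordinal hN) c != ((h == n) && (c == n :> nat))%:R -> step_coef h A C != 0.
Proof.
move=> h0 AE; have hh : (0 < h < N n)%N by rewrite h0.
rewrite (step_coef_single hh AE); apply: contraNneq => /eqP.
rewrite mulf_eq0 invr_eq0 (negPf v2_neq1) orbF subr_eq0 => /eqP/vexpz_inj.
rewrite (row_weightS hN) => e; rewrite -subr_eq0.
by apply/eqP; move: e; set x := C _ _; clear; lia.
Qed.

Lemma midE : mid n = n :> nat.
Proof. by rewrite inordK // /N; clear; lia. Qed.

(** The other terms pair up under rotation. This serves to compute parities. *)
Lemma sum_sym_mid (f : 'I_(N n) -> int) : (forall a, f (rev_ord a) = f a) ->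
  exists z, \sum_a f a = f (mid n) + 2 * z.
Proof.
move=> fr; exists (\sum_(a < N n | (a < n)%N) f a).
rewrite (bigD1 (mid n)) //= (bigID (fun a : 'I_(N n) => (a < n)%N)) /=; congr (_ + _).
have E (P : pred 'I_(N n)) : (forall a, P a = (a < n)%N) ->
    \sum_(a | P a) f a = \sum_(a < N n | (a < n)%N) f a.
  by move=> PE; apply: eq_bigl.
rewrite E; last first.
  by move=> a; rewrite -(inj_eq val_inj) /= midE; move: (nat_of_ord a) => k; clear; lia.
suff -> : \sum_(a < N n | (a != mid n) && ~~ (a < n)%N) f a = \sum_(a < N n | (a < n)%N) f a.
  by ring.
rewrite [LHS](reindex_inj (@rev_ord_inj _)); apply: eq_big => [a|a _]; last exact: fr.
rewrite -(inj_eq val_inj) /= midE; have := ltn_ord a.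
by move: (nat_of_ord a) => k; rewrite /N; clear; lia.
Qed.

Lemma row_sum_mid M : theta_sym M -> exists z, row_sum M (mid n) = M (mid n) (mid n) + 2 * z.
Proof.
by move=> /theta_symP Ms; apply: sum_sym_mid => a; rewrite [RHS]Ms rev_mid.
Qed.

Lemma mx_total_mid M : theta_sym M -> exists z, mx_total M = M (mid n) (mid n) + 2 * z.
Proof.
move=> Ms; rewrite mx_totalE.
have [z ->] := @sum_sym_mid (row_sum M) (fun a => row_sum_sym a Ms).
by have [z' ->] := row_sum_mid Ms; exists (z' + z); ring.
Qed.

(** The middle entry has the parity of the total D = 2d + 1. *)
Lemma in_Xi_Xit d M : in_Xi d M -> Xit_pred M.
Proof.
case/in_XiP => A <-; apply/and3P; split; last exact: Xi_mx_sym.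
  by apply/'forall_forallP => i j; apply/implyP => _; exact: Xi_mx_ge0.
have [z] := mx_total_mid (Xi_mx_sym A); rewrite mx_totalE Xi_mx_sum.
by move: (Xi_mx A _ _) => x; rewrite /dimD; clear; lia.
Qed.

(** A step lowers the entry (h, c) and its rotated copy by 1 each and no other entry. For h = c = n
    the two coincide and 2 is lost, whence the stronger bound there. *)
Lemma step_ge (h : nat) (hN : (h < N n)%N) c M : (0 < h)%N -> theta_sym M ->
  ((h == n) && (c == n :> nat))%:R + 1 <= M (Ordinal hN) c ->
  forall a b, M a b + step h c a b < 0 -> M a b < 0.
Proof.
move=> h0 /theta_symP Ms ge a b; rewrite stepE ?h0 //.
have Mr := Ms (Ordinal hN) c.
have [/andP[/eqP ea /eqP eb]|ne1] := boolP ((a == h :> nat) && (b == c)).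
  have e : a = Ordinal hN by apply: val_inj.
  rewrite -{}e -{}eb in ge Mr *; move: ge; rewrite ea !eqxx /=.
  rewrite (_ : b == rev_ord b = (b == n :> nat)); last first.
    by rewrite -(inj_eq val_inj) /=; have := ltn_ord b; rewrite /N; clear; lia.
  rewrite (_ : (h == (N n - h.+1)%N) = (h == n)); last by rewrite /N; clear -hN; lia.
  move: (M a b) => x; case: (h == n); case: (b == n :> nat); clear; lia.
have [/andP[/eqP ea /eqP eb]|ne2] := boolP ((a == (N n - h.+1)%N :> nat) && (b == rev_ord c)).
  have e : a = rev_ord (Ordinal hN) by apply: val_inj.
  move: ge; rewrite Mr -e -eb; move: (M a b) => x.
  do !case: (_ == _); clear; lia.
move: (M a b) => x; clear; lia.
Qed.

Section Positivity.
Variables (d h : nat) (hN : (h < N n)%N) (h0 : (0 < h)%N) (A : 'M[int]_(N n)) (C : Xi n d).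
Hypothesis ne : step_coef h A (Xi_mx C) != 0.

Lemma step_coef_ge : exists2 c, A = Xi_mx C + step h c
  & ((h == n) && (c == n :> nat))%:R + 1 <= Xi_mx C (Ordinal hN) c.
Proof.
have [c AE Cc] := step_coef_neq0 hN h0 ne; exists c => //.
have C0 := Xi_mx_ge0 C (Ordinal hN) c.
case: (boolP ((h == n) && (c == n :> nat))) Cc => [/andP[/eqP hE /eqP cE]|_] /=; last first.
  by move: C0; move: (Xi_mx C _ _) => x; clear; lia.
have -> : Ordinal hN = mid n by apply: val_inj; rewrite /= midE.
have -> : c = mid n by apply: val_inj; rewrite /= midE.
(* The middle entry of C is nonnegative, odd and different from 1, so at least 3. *)
have /and3P[_ + _] := in_Xi_Xit (in_Xi_mx C); have := Xi_mx_ge0 C (mid n) (mid n).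
by move: (Xi_mx C _ _) => x; clear; lia.
Qed.

Lemma step_coef_in_Xi : in_Xi d A.
Proof.
have [c AE ge] := step_coef_ge.
apply: in_Xi_intro.
- move=> a b; rewrite leNgt; apply/negP; rewrite AE mxE => /(step_ge h0 (Xi_mx_sym C) ge).
  by rewrite ltNge Xi_mx_ge0.
- by rewrite AE theta_symD ?Xi_mx_sym ?step_sym.
- have hh : (0 < h < N n)%N by rewrite h0.
  rewrite -mx_totalE AE /mx_total psumD -/(mx_total _) -/(mx_total (step _ _)) mx_total_step //.
  by rewrite mx_totalE Xi_mx_sum addr0.
Qed.

(** B has the row sums of C, so its diagonal could be negative only in row h and the rotated row,
    where 1 lies off the diagonal, or 2 if h = n and both boxes of E^theta share the row. Row h of C
    is large enough: it contains the box at c and, for h = n, also the rotated one or a middle entry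
    of at least 2. *)
Lemma step_coef_in_Xi_l (B l : 'M[int]_(N n)) : is_diag_mx l -> B = l + Etheta n h h.-1 ->
  theta_sym B -> composable_mx B A -> in_Xi d B.
Proof.
move=> ld BE Bs; have [c AE ge] := step_coef_ge; have hh : (0 < h < N n)%N by rewrite h0.
move=> /(composable_step hh ld BE AE) rows.
have hN' : (h.-1 < N n)%N by rewrite (leq_ltn_trans (leq_pred h)).
have rowsE a : row_sum B a = row_sum (Xi_mx C) a.
  by rewrite !row_sum_psum !rows // ltnW.
have Brow a : row_sum B a = l a a + (a == h :> nat)%:R + (a == (N n - h.+1)%N :> nat)%:R.
  by rewrite BE row_sumD row_sum_diag // row_sum_Etheta // addrA.
have C0 := Xi_mx_ge0 C.
have Ch1 : 1 + (h == n)%:R <= row_sum (Xi_mx C) (Ordinal hN).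
  rewrite /row_sum (bigD1 c) //=.
  have s0 (P : pred 'I_(N n)) : 0 <= \sum_(b | P b) Xi_mx C (Ordinal hN) b by apply: sumr_ge0.
  have [hE|hn] := eqVneq h n; last first.
    have := s0 (fun b => b != c); move: ge; rewrite (negPf hn) /=.
    by move: (Xi_mx C _ _) => x; move: (\sum_(_ | _) _) => y; clear; lia.
  have [cE|cn] := eqVneq (nat_of_ord c) n.
    have := s0 (fun b => b != c); move: ge; rewrite (introT eqP hE) cE eqxx /=.
    by move: (Xi_mx C _ _) => x; move: (\sum_(_ | _) _) => y; clear; lia.
  rewrite (bigD1 (rev_ord c)) /=; last first.
    by rewrite -(inj_eq val_inj) /=; have := ltn_ord c; move: cn; rewrite /N; clear; lia.
  have -> : Xi_mx C (Ordinal hN) (rev_ord c) = Xi_mx C (Ordinal hN) c.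
    rewrite [RHS](theta_symP _ (Xi_mx_sym C)); congr (Xi_mx C _ _).
    by apply: val_inj; rewrite /= hE /N; clear; lia.
  have := s0 (fun b => (b != c) && (b != rev_ord c)); move: ge; rewrite (negPf cn) andbF.
  by move: (Xi_mx C _ _) => x; move: (\sum_(_ | _) _) => y; rewrite /=; clear; lia.
apply: in_Xi_intro => //; last first.
  have := rows _ (leqnn _); rewrite -/(mx_total _) -/(mx_total (Xi_mx C)) mx_totalE => ->.
  by rewrite mx_totalE Xi_mx_sum.
move=> a b; have [<-|ab] := eqVneq a b; last first.
  rewrite BE mxE EthetaE // (is_diag_mxP ld) //.
  by rewrite add0r addr_ge0 // ler0n.
have -> : B a a = l a a.
  rewrite BE mxE EthetaE //.
  have b1 : (a == h :> nat) && (a == h.-1 :> nat) = false by move: h0; clear; lia.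
  have b2 : (a == (N n - h.+1)%N :> nat) && (a == (N n - h.-1.+1)%N :> nat) = false.
    by move: h0 hN; clear; lia.
  by rewrite b1 b2 !addr0.
have := Brow a; rewrite rowsE => E.
have r0 : 0 <= row_sum (Xi_mx C) a by apply: sumr_ge0.
have r1 : (a == h :> nat) || (a == (N n - h.+1)%N :> nat) ->
    1 + (h == n)%:R <= row_sum (Xi_mx C) a.
  case/orP => /eqP e; first by rewrite (_ : a = Ordinal hN) //; apply: val_inj.
  rewrite (_ : a = rev_ord (Ordinal hN)) ?(row_sum_sym _ (Xi_mx_sym C)) //.
  exact: val_inj.
move: E r0 r1; set x := row_sum _ _; set y := l a a.
by have := ltn_ord a; move: hN h0; move: (nat_of_ord a) => k; rewrite /N; clear; lia.
Qed.
End Positivity.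
End StepMatrices.

Section Generation.
Variable n : nat.
Implicit Types (M : 'M[int]_(N n)) (a b c : 'I_(N n)) (A B C : Xit n).

Definition spread M : int := \sum_(a < N n) \sum_(b < N n) ((a : nat)%:Z - (b : nat)%:Z) ^+ 2 * M a b.

Lemma spreadD M M' : spread (M + M') = spread M + spread M'.
Proof.
rewrite /spread -big_split; apply: eq_bigr => a _; rewrite -big_split.
by apply: eq_bigr => b _; rewrite mxE mulrDr.
Qed.

Lemma spreadN M : spread (- M) = - spread M.
Proof.
rewrite /spread -sumrN; apply: eq_bigr => a _; rewrite -sumrN.
by apply: eq_bigr => b _; rewrite mxE mulrN.
Qed.

Lemma spread_delta (i j : 'I_(N n)) :
  spread (delta_mx i j) = ((i : nat)%:Z - (j : nat)%:Z) ^+ 2.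
Proof.
rewrite /spread (bigD1 i) //= [X in _ + X]big1 ?addr0 => [|a ai]; last first.
  by rewrite big1 // => b _; rewrite mxE (negPf ai) mulr0.
rewrite (bigD1 j) //= big1 ?addr0 => [|b bj]; first by rewrite mxE !eqxx mulr1.
by rewrite mxE (negPf bj) andbF mulr0.
Qed.

(** Rotation preserves (a - b)^2, so this is 2 ((h - 1 - c)^2 - (h - c)^2). It is negative for c < h
    and increases with c. *)
Lemma spread_step h c : (0 < h < N n)%N -> spread (step h c) = 2 - 4 * (h%:Z - (c : nat)%:Z).
Proof.
move=> hh; have hN : (h < N n)%N by case/andP: hh.
have hN' : (h.-1 < N n)%N by rewrite (leq_ltn_trans (leq_pred h)).
rewrite /step /Etheta spreadD spreadN !spreadD !spread_delta /= !inordK //.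
have -> : (N n - h.-1.+1)%N%:Z = (N n)%:Z - h%:Z by move: hh; clear; lia.
have -> : (N n - h.+1)%N%:Z = (N n)%:Z - h%:Z - 1 by move: hh; clear; lia.
have -> : (N n - c.+1)%N%:Z = (N n)%:Z - (c : nat)%:Z - 1 by have := ltn_ord c; clear; lia.
have -> : h.-1%:Z = h%:Z - 1 by move: hh; clear; lia.
ring.
Qed.

Lemma spread_ge0 A : 0 <= spread (val A).
Proof.
apply: sumr_ge0 => a _; apply: sumr_ge0 => b _.
have [->|ab] := eqVneq a b; first by rewrite subrr expr0n mul0r.
by rewrite mulr_ge0 ?sqr_ge0 // Xit_ge0.
Qed.

Lemma lower_entry A : ~~ is_diag_mx (val A) ->
  exists p : 'I_(N n) * 'I_(N n), [&& (p.2 < p.1)%N & val A p.1 p.2 != 0].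
Proof.
move=> nd; have [[a b] /= /andP[ab Aab]] : exists p : 'I_(N n) * 'I_(N n), (p.1 != p.2) && (val A p.1 p.2 != 0).
  apply/existsP; apply: contraNT nd; rewrite negb_exists => /forallP nd.
  apply/is_diag_mxP => i j ij; have := nd (i, j); rewrite /= negb_and negbK => /orP[/eqP e|].
    by rewrite e eqxx in ij.
  by rewrite negbK => /eqP.
case: (ltnP b a) => ba; first by exists (a, b); rewrite /= ba.
exists (rev_ord a, rev_ord b) => /=; rewrite -(theta_symP _ (Xit_sym A)) Aab andbT.
have : (a : nat) != b by [].
by have := ltn_ord a; have := ltn_ord b; move: ba; clear; lia.
Qed.

Lemma generation_step A : ~~ is_diag_mx (val A) ->
  exists h B A' (l : 'M[int]_(N n)),
    [/\ (0 < h < N n)%N, is_diag_mx l, val B = l + Etheta n h h.-1, composable B A' &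
     [/\ spread (val A') < spread (val A), step_coef h (val A') (val A) != 0
      & forall C, C != A -> step_coef h (val A') (val C) != 0 ->
          spread (val C) < spread (val A)]].
Proof.
move=> /lower_entry[x0 Px0].
case: (@arg_minnP _ x0 (fun x : 'I_(N n) * 'I_(N n) => (x.2 < x.1)%N && (val A x.1 x.2 != 0))
   (fun x => nat_of_ord x.2) Px0) => -[h0 p] /= /andP[ph Ahp] pmin.
pose h := nat_of_ord h0.
have hh : (0 < h < N n)%N by rewrite /h ltn_ord andbT (leq_ltn_trans _ ph).
have hN : (h < N n)%N by case/andP: hh.
have hE : Ordinal hN = h0 by apply: val_inj.
have hN' : (h.-1 < N n)%N by rewrite (leq_ltn_trans (leq_pred h)).
have hpos : (0 < h)%N by case/andP: hh.
have Ahp1 : 1 <= val A h0 p.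
  have := Xit_ge0 A (i := h0) (j := p); rewrite -(inj_eq val_inj) gtn_eqF // => /(_ isT).
  by move: Ahp; move: (val A h0 p) => x; clear; lia.
pose M' := val A + step h p.
have M's : theta_sym M' by apply: theta_symD (Xit_sym A) (step_sym h p).
have M'0 a b : a != b -> 0 <= M' a b.
  move=> ab; rewrite leNgt; apply/negP; rewrite mxE => /(step_ge hpos (Xit_sym A) (hN := hN)).
  suff ge : ((h == n) && (p == n :> nat))%:R + 1 <= val A (Ordinal hN) p.
    by move/(_ ge); rewrite ltNge Xit_ge0.
  rewrite hE (_ : (h == n) && (p == n :> nat) = false) //.
  by move: ph; rewrite -/h; clear; lia.
have M'odd : odd `|M' (mid n) (mid n)|%N.
  have -> : M' (mid n) (mid n) = val A (mid n) (mid n)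
      + 2 * (((n.+1 == h) && (mid n == p))%:R - ((n == h) && (mid n == p))%:R).
    rewrite mxE stepE // midE -rev_ord_eqC rev_mid.
    have -> : (n == N n - h)%N = (n.+1 == h) by move: hh; rewrite /N; clear; lia.
    have -> : (n == N n - h.+1)%N = (n == h) by move: hh; rewrite /N; clear; lia.
    by ring.
  by have := Xit_odd A; move: (val A _ _) (_%:R - _) => x y; clear; lia.
have M'P : Xit_pred M'.
  apply/and3P; split=> //; apply/'forall_forallP => a b; apply/implyP; exact: M'0.
pose A' : Xit n := exist _ M' M'P.
pose E := Etheta n h h.-1.
(* The diagonal is chosen so that the column sums of B are the row sums of A'. *)
pose l : 'M[int]_(N n) := diag_mx (\row_a (row_sum M' a - col_sum E a)).
have ld : is_diag_mx l by exact: diag_mx_is_diag.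
have lE a : l a a = row_sum M' a - (a == h.-1 :> nat)%:R - (a == (N n - h)%N :> nat)%:R.
  by rewrite !mxE eqxx mulr1n /E col_sum_Etheta // prednK // opprD addrA.
have ls : theta_sym l.
  apply/theta_symP => a b; rewrite !mxE (inj_eq (@rev_ord_inj _)); congr (_ *+ _).
  rewrite row_sum_sym // /E !col_sum_Etheta //; congr (_ - _); rewrite addrC /=.
  by have := ltn_ord a; rewrite prednK //; move: hh; clear; lia.
have BP : Xit_pred (l + E).
  apply/and3P; split; last exact: (theta_symD ls (@Etheta_sym n h h.-1)).
    apply/'forall_forallP => a b; apply/implyP => ab.
    rewrite mxE (is_diag_mxP ld) // add0r /E EthetaE //.
    by rewrite addr_ge0 // ler0n.
  (* The middle entry of [l] is an odd row sum, less 2 if h = n + 1. *)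
  have [z] := row_sum_mid M's; rewrite [(l + E) _ _]mxE lE /E Etheta_mid // addr0 midE.
  have -> : (n == N n - h)%N = (n == h.-1) by move: hh; rewrite /N; clear; lia.
  by move: M'odd; move: (M' _ _) (row_sum _ _) => x y; case: (n == h.-1); clear; lia.
pose B : Xit n := exist _ (l + E) BP.
exists h, B, A', l; split=> //.
  apply/forallP => a; rewrite col_sumD col_sum_diag // lE /E col_sum_Etheta // prednK //.
  by apply/eqP; rewrite -[RHS]/(row_sum M' a); ring.
split.
- rewrite spreadD spread_step // gtrDl.
  by move: ph; rewrite -/h; clear; lia.
- apply: (@step_coef_single_neq0 n h hN p (val A') (val A) hpos (erefl _)).
  rewrite hE (_ : (h == n) && (p == n :> nat) = false) //.
  by move: ph; rewrite -/h; clear; lia.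
move=> C CA /(step_coef_neq0 hN hpos)[c /= CE _].
have CE' : val C = val A + step h p - step h c by apply: (canRL (addrK _)); rewrite -CE.
rewrite CE' (spreadD (val A + _)) (spreadD (val A)) spreadN !spread_step //.
(* The spread of C exceeds that of A by 4 (p - c), which is negative for c > p. *)
have [cp|] := leqP p c.
  have pc : p != c.
    by apply: contraNneq CA => pc; rewrite -(inj_eq val_inj) CE' pc addrK.
  move: pc cp; rewrite -(inj_eq val_inj) /=.
  by move: (spread _) => x; clear; lia.
(* A column c < p is impossible: C would have the entry -1 at (h - 1, c), where A is zero because p
   is the first column with a nonzero entry below the diagonal. *)
move=> cp; pose r := Ordinal hN'.
have rc : (c < r)%N by rewrite /= -ltnS prednK // (leq_trans _ ph).
have Arc : val A r c = 0.
  apply/eqP; apply: contraTT cp => Arc; rewrite -leqNgt.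
  by apply: (pmin (r, c)); rewrite /= Arc rc.
have := Xit_ge0 C (i := r) (j := c); rewrite -(inj_eq val_inj) (gtn_eqF rc) => /(_ isT).
have mxDB (M1 M2 M3 : 'M[int]_(N n)) : (M1 + M2 - M3) r c = M1 r c + M2 r c - M3 r c.
  by rewrite !mxE.
rewrite CE' mxDB Arc add0r !stepE // -!(inj_eq val_inj) /=.
have e1 : (h.-1.+1 == h)%N by rewrite prednK.
have e2 : (c == p :> nat) = false by rewrite ltn_eqF.
have e3 : (h.-1 == h)%N = false by move: hpos; clear; lia.
have e4 : (h.-1 == N n - h.+1)%N = false by move: hh; rewrite /N; clear; lia.
have e5 q : (q <= p)%N -> (h.-1 == N n - h)%N && (c == N n - q.+1 :> nat)%N = false.
  by move: hh cp ph; rewrite -/h /N; clear; lia.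
by rewrite e1 e2 e3 e4 !e5 // ?eqxx ?(ltnW cp).
Qed.
End Generation.

Lemma linear0E (R : nzRingType) (V W : lmodType R) (f : V -> W) : linear f -> f 0 = 0.
Proof. by move=> h; have := h (-1) 0 0; rewrite scaler0 addr0 scaleN1r addNr. Qed.

Lemma linearZE (R : nzRingType) (V W : lmodType R) (f : V -> W) : linear f ->
  forall a x, f (a *: x) = a *: f x.
Proof. by move=> h a x; have := h a x 0; rewrite (linear0E h) !addr0. Qed.

Lemma linear_sumE (R : nzRingType) (V W : lmodType R) (f : V -> W) (I : Type) (s : seq I)
    (c : I -> R) (F : I -> V) : linear f ->
  f (\sum_(i <- s) c i *: F i) = \sum_(i <- s) c i *: f (F i).
Proof.
move=> flin; elim: s => [|i s IH]; first by rewrite !big_nil linear0E.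
by rewrite !big_cons flin IH.
Qed.

Lemma lin_ext_comp (R : nzRingType) (I : choiceType) (V W : lmodType R) (f : V -> W)
    (F : I -> V) (x : {malg R[I]}) : linear f ->
  f (lin_ext F x) = lin_ext (fun k => f (F k)) x.
Proof. by move=> flin; apply: linear_sumE. Qed.

(** * The homomorphism *)

Section Convolution.
Variables (R : comNzRingType) (T : finType) (s : T -> T -> T -> R).
Hypothesis sA : forall A B C D, \sum_E s A B E * s E C D = \sum_E s B C E * s A E D.

(** The Schur product on coefficient functions, where associativity is a matter of exchanging finite
    sums. *)
Definition convolution (x y : T -> R) (C : T) : R :=
  \sum_A \sum_B x A * y B * s A B C.

Lemma convolutionA x y z D :
  convolution x (convolution y z) D = convolution (convolution x y) z D.
Proof.
transitivity (\sum_A \sum_B \sum_C x A * y B * z C * \sum_E s B C E * s A E D).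
  apply: eq_bigr => A _.
  transitivity (\sum_E \sum_B \sum_C x A * y B * z C * (s B C E * s A E D)).
    apply: eq_bigr => E _; rewrite mulr_sumr mulr_suml; apply: eq_bigr => B _.
    by rewrite mulr_sumr mulr_suml; apply: eq_bigr => C _; rewrite !mulrA.
  rewrite exchange_big; apply: eq_bigr => B _; rewrite exchange_big; apply: eq_bigr => C _.
  by rewrite mulr_sumr.
transitivity (\sum_A \sum_B \sum_C x A * y B * z C * \sum_E s A B E * s E C D).
  by do 3!(apply: eq_bigr => ? _); rewrite sA.
transitivity (\sum_A \sum_B \sum_E \sum_C x A * y B * s A B E * z C * s E C D).
  apply: eq_bigr => A _; apply: eq_bigr => B _; rewrite exchange_big; apply: eq_bigr => C _.
  by rewrite mulr_sumr; apply: eq_bigr => E _; rewrite !mulrA; congr (_ * _); rewrite mulrAC.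
transitivity (\sum_E \sum_A \sum_B \sum_C x A * y B * s A B E * z C * s E C D).
  by rewrite [RHS]exchange_big; apply: eq_bigr => A _; rewrite [RHS]exchange_big.
apply: eq_bigr => E _; rewrite [RHS](eq_bigr (fun C => \sum_A \sum_B x A * y B * s A B E * z C * s E C D)).
  rewrite [RHS]exchange_big; apply: eq_bigr => A _; rewrite [RHS]exchange_big //.
move=> C _; rewrite !mulr_suml; apply: eq_bigr => A _; rewrite !mulr_suml //.
Qed.
End Convolution.

Section SchurAlgebra.
Variables (n d : nat) (g : structure_constants n).
Implicit Types x y z : schur n d.

Lemma laurent_val_inj : injective laurent_val.
Proof. exact: val_inj. Qed.

Lemma laurent_val_eq0 (a : laurent) : (laurent_val a == 0) = (a == 0).
Proof. by rewrite -(inj_eq laurent_val_inj). Qed.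

Lemma laurent_mulfI (a : laurent) : a != 0 -> injective ( *%R a).
Proof.
move=> a0 x y /(congr1 laurent_val); rewrite !laurent_valM => E; apply: laurent_val_inj.
by apply: mulfI E; rewrite laurent_val_eq0.
Qed.

Lemma schur_scalerI (a : laurent) : a != 0 -> injective (fun x : schur n d => a *: x).
Proof.
move=> a0 x y /= E; apply/malgP => C; apply: (laurent_mulfI a0).
by rewrite -!schurZ_coef E.
Qed.

Definition schur_const (A A' C : Xi n d) : laurent := (map_poly intr (@g d A A' C)).[vexp 2].

Lemma schurP_coef a x y A : (a *: x + y)@_A = a * x@_A + y@_A.
Proof. by rewrite mcoeffD schurZ_coef. Qed.

Lemma schur_mulP a x y z :
  schur_mul g (a *: x + y) z = a *: schur_mul g x z + schur_mul g y z.
Proof.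
have E (V : lmodType laurent) (p q r k : laurent) (e : V) :
    ((a * p + q) * r * k) *: e = a *: ((p * r * k) *: e) + (q * r * k) *: e.
  by rewrite scalerA -scalerDl !mulrDl !mulrA.
rewrite /schur_mul scaler_sumr -big_split; apply: eq_bigr => A _ /=.
rewrite scaler_sumr -big_split; apply: eq_bigr => A' _ /=.
rewrite scaler_sumr -big_split; apply: eq_bigr => C _ /=.
rewrite schurP_coef; exact: E.
Qed.

Lemma schur_mulPr a x y z :
  schur_mul g z (a *: x + y) = a *: schur_mul g z x + schur_mul g z y.
Proof.
have E (V : lmodType laurent) (p q r k : laurent) (e : V) :
    (r * (a * p + q) * k) *: e = a *: ((r * p * k) *: e) + (r * q * k) *: e.
  by rewrite scalerA -scalerDl mulrDr mulrDl mulrCA !mulrA.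
rewrite /schur_mul scaler_sumr -big_split; apply: eq_bigr => A _ /=.
rewrite scaler_sumr -big_split; apply: eq_bigr => A' _ /=.
rewrite scaler_sumr -big_split; apply: eq_bigr => C _ /=.
rewrite schurP_coef; exact: E.
Qed.

Lemma schur_mul0l z : schur_mul g 0 z = 0.
Proof. exact: (linear0E (fun a x y => schur_mulP a x y z)). Qed.
Lemma schur_mul0r z : schur_mul g z 0 = 0.
Proof. exact: (linear0E (fun a x y => schur_mulPr a x y z)). Qed.

Lemma schur_mul_convolution x y C :
  (schur_mul g x y)@_C = convolution schur_const (fun A => x@_A) (fun A => y@_A) C.
Proof. exact: schur_mul_coef. Qed.

Lemma convolution_eq (x x' y y' : Xi n d -> laurent) C : x =1 x' -> y =1 y' ->
  convolution schur_const x y C = convolution schur_const x' y' C.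
Proof. by move=> Ex Ey; do 2!(apply: eq_bigr => ? _); rewrite Ex Ey. Qed.

Lemma schur_constA (hg : counts_flags (@g d)) A B C D :
  \sum_E schur_const A B E * schur_const E C D =
  \sum_E schur_const B C E * schur_const A E D.
Proof.
pose ev (P : {poly int}) : laurent := (map_poly intr P).[vexp 2].
have evM P Q : ev (P * Q) = ev P * ev Q by rewrite /ev rmorphM hornerM.
have evS (F : Xi n d -> {poly int}) : ev (\sum_E F E) = \sum_E ev (F E).
  by rewrite /ev rmorph_sum horner_sum.
have := congr1 ev (structure_constants_assoc hg A B C D).
by rewrite !evS; under eq_bigr do rewrite evM; under [RHS]eq_bigr do rewrite evM.
Qed.

Lemma schur_mulA (hg : counts_flags (@g d)) x y z :
  schur_mul g x (schur_mul g y z) = schur_mul g (schur_mul g x y) z.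
Proof.
apply/malgP => D; rewrite [LHS]schur_mul_convolution [RHS]schur_mul_convolution.
rewrite (convolution_eq D (fun A => erefl _) (schur_mul_convolution y z)).
rewrite (convolution_eq D (schur_mul_convolution x y) (fun A => erefl _)).
exact/convolutionA/schur_constA.
Qed.
End SchurAlgebra.

Section GeneratorProducts.
Variables (n : nat) (g : structure_constants n) (m : Xit n -> Xit n -> K n).
Hypotheses (hg : forall d, (0 < d)%N -> counts_flags (@g d)) (hm : is_stabilization g m).
Implicit Types A B C : Xit n.

Lemma composable_shift p A B : composable_mx (shift p A) (shift p B) = composable A B.
Proof.
have z (M : 'M[int]_(N n)) a k : row_sum (M + k%:M) a = row_sum M a + k.
  by rewrite row_sumD [row_sum k%:M a]row_sum_diag ?scalar_mx_is_diag // mxE eqxx.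
have z' (M : 'M[int]_(N n)) a k : col_sum (M + k%:M) a = col_sum M a + k.
  by rewrite col_sumD [col_sum k%:M a]col_sum_diag ?scalar_mx_is_diag // mxE eqxx.
by apply: eq_forallb => a; rewrite /shift z z' (inj_eq (addIr _)).
Qed.

(** The exponential polynomial is [step_coef] of the shifted matrices. It vanishes if the totals of
    A and C differ, since a step has total 0. *)
Lemma step_product h (l : 'M[int]_(N n)) B A C : (0 < h < N n)%N -> is_diag_mx l ->
  val B = l + Etheta n h h.-1 -> composable B A ->
  laurent_val (m B A)@_C =
    v ^ (dZ (val C) - dZ (val B) - dZ (val A)) * step_coef h (val A) (val C).
Proof.
move=> hh ld BE cBA; have hN : (h < N n)%N by case/andP: hh.
have h0 : (0 < h)%N by case/andP: hh.
pose f p := step_coef h (shift p A) (shift p C).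
have <- : f 0%N = step_coef h (val A) (val C) by rewrite /f !shift0.
apply: (stabilization_coef (f := f) hm cBA); first exact: step_coef_shift.
  move=> d p B' A' C' d0 EB EA EC.
  have ld' : is_diag_mx (l + (2 * p)%:Z%:M).
    apply/is_diag_mxP => i j ij; rewrite mxE (is_diag_mxP ld) // add0r.
    by move: ij; rewrite (inj_eq val_inj) mxE => /negPf ->.
  rewrite (schur_step (hg d0) A' C' hh ld' (B := B')); last by rewrite EB /shift BE addrAC.
  by rewrite EB EA EC composable_shift cBA.
rewrite /f !shift0; apply: contraNeq => /(step_coef_neq0 hN h0)[c -> _].
rewrite -!mx_totalE. by rewrite /mx_total psumD -/(mx_total (step h c)) mx_total_step // addr0.
Qed.

Lemma diag_product B A C : is_diag_mx (val B) -> composable B A ->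
  laurent_val (m B A)@_C = v ^ (dZ (val C) - dZ (val B) - dZ (val A)) * (A == C)%:R.
Proof.
move=> Bd cBA.
apply: (stabilization_coef (f := fun=> (A == C)%:R) hm cBA).
- exact: vexp_poly_cst.
- move=> d p B' A' C' d0 EB EA EC.
  rewrite (schur_diag (hg d0)); last first.
    apply/is_diag_mxP => i j ij; rewrite EB mxE (is_diag_mxP Bd) // add0r.
    by move: ij; rewrite (inj_eq val_inj) mxE => /negPf ->.
  rewrite EB EA composable_shift cBA -(inj_eq (@Xi_mx_inj n d)) EA EC.
  by rewrite (inj_eq (addIr _)) (inj_eq val_inj).
by case: (A =P C) => [->|_]; rewrite ?eqxx.
Qed.
End GeneratorProducts.

(** * Truncation to the matrices of size D *)

Section Phi.
Variables (n d : nat) (hd : (0 < d)%N) (g : structure_constants n).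
Variable m : Xit n -> Xit n -> K n.
Hypotheses (hg : forall d, (0 < d)%N -> counts_flags (@g d)) (hm : is_stabilization g m).
Implicit Types A B : Xit n.

Definition phi : K n -> schur n d := lin_ext (fun A : Xit n => schur_std d (val A)).

Lemma phi_linear : linear phi.
Proof. exact: lin_ext_linear. Qed.

Lemma phiU A : phi << A >> = schur_std d (val A).
Proof. exact: lin_extU. Qed.

Definition embed (C : Xi n d) : Xit n := exist _ (Xi_mx C) (in_Xi_Xit (in_Xi_mx C)).

Lemma sum_msupp_delta (R : nzRingType) (I : choiceType) (x : {malg R[I]}) k r :
  \sum_(i <- msupp x) x@_i * (if i == k then r else 0) = x@_k * r.
Proof.
have [kx|kx] := boolP (k \in msupp x).
  rewrite (big_fsetD1 k) //= eqxx big_seq big1 ?addr0 // => i.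
  by rewrite in_fsetD1 => /andP[/negPf -> _]; rewrite mulr0.
rewrite (mcoeff_outdom kx) mul0r big_seq big1 // => i ix.
by case: eqP ix => [->|_ _]; [rewrite (negPf kx)|rewrite mulr0].
Qed.

(** Up to powers of v, [phi] is a coordinate projection, so multiplicativity has to be tested only
    on the coefficients at C in [Xi n d]. *)
Lemma phi_coef (x : K n) C : (phi x)@_C = x@_(embed C) * vexp (- (dA C)%:Z).
Proof.
rewrite -sum_msupp_delta [LHS]mcoeff_sum; apply: eq_bigr => A _.
by rewrite schurZ_coef schur_std_coef -(inj_eq val_inj).
Qed.

Lemma schur_std_out (M : 'M[int]_(N n)) : ~~ in_Xi d M -> schur_std d M = 0.
Proof.
move=> nM; rewrite /schur_std; case: pickP => // A /eqP E.
by rewrite -E in_Xi_mx in nM.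
Qed.

Lemma phi0 : phi 0 = 0.
Proof. exact: linear0E phi_linear. Qed.

Lemma phi_std (M : 'M[int]_(N n)) : phi (K_std M) = if in_Xi d M then schur_std d M else 0.
Proof.
case: ifP => [iM|/negbT nM].
  rewrite /K_std; case: insubP => [A _ <-|]; first exact: phiU.
  by rewrite (in_Xi_Xit iM).
rewrite /K_std; case: insubP => [A _ E|_]; first by rewrite phiU E schur_std_out.
exact: phi0.
Qed.

(* cf gives the structure constants of multiplication by B, at v and up to the
   normalization of the standard basis *)
Lemma phi_product B A (cf : Xit n -> Xit n -> Qv) :
  (forall C, composable B A ->
     laurent_val (m B A)@_C = v ^ (dZ (val C) - dZ (val B) - dZ (val A)) * cf A C) ->
  (forall B' A' C' : Xi n d, Xi_mx B' = val B -> Xi_mx A' = val A ->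
     eval_v2 (@g d B' A' C') = if composable B A then cf A (embed C') else 0) ->
  (forall C, composable B A -> cf A (embed C) != 0 -> in_Xi d (val A) && in_Xi d (val B)) ->
  phi (m B A) = schur_mul g (schur_std d (val B)) (schur_std d (val A)).
Proof.
move=> ha hb hc; apply/malgP => C; rewrite phi_coef; apply: laurent_val_inj.
have m0 : ~~ composable B A -> m B A = 0 by case: hm => _ h _; exact: h.
have [/andP[/in_XiP[A' AE] /in_XiP[B' BE]]|out] := boolP (in_Xi d (val A) && in_Xi d (val B)).
  rewrite -BE -AE schur_mul_std !laurent_valM !laurent_vexp eval_v2E (hb _ _ C BE AE).
  have [cBA|ncBA] := boolP (composable B A); last by rewrite m0 // mcoeff0 mul0r mulr0.
  rewrite ha // -BE -AE -!dZ_Xi mulrAC -!expfzDr ?v_neq0 //; congr (v ^ _ * _).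
  by rewrite /=; ring.
have -> : schur_mul g (schur_std d (val B)) (schur_std d (val A)) = 0.
  have [iA|nA] := boolP (in_Xi d (val A)); last by rewrite (schur_std_out nA) schur_mul0r.
  by rewrite iA in out; rewrite (schur_std_out out) schur_mul0l.
rewrite mcoeff0 laurent_valM; have [cBA|ncBA] := boolP (composable B A).
  rewrite ha //; have [->|/(hc _ cBA) i] := eqVneq (cf A (embed C)) 0.
    by rewrite mulr0 mul0r.
  by rewrite i in out.
by rewrite m0 // mcoeff0 mul0r.
Qed.
End Phi.

Section Homomorphism.
Variables (n d : nat) (hd : (0 < d)%N) (g : structure_constants n).
Variable m : Xit n -> Xit n -> K n.
Hypotheses (hg : forall d, (0 < d)%N -> counts_flags (@g d)) (hm : is_stabilization g m).
Implicit Types (A B : Xit n) (x y z : K n).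

Definition step_gen B : Prop := exists h (l : 'M[int]_(N n)),
  [/\ (0 < h < N n)%N, is_diag_mx l & val B = l + Etheta n h h.-1].

Lemma phi_step_product B A : step_gen B ->
  phi d (m B A) = schur_mul g (schur_std d (val B)) (schur_std d (val A)).
Proof.
case=> h [l [hh ld BE]]; have hN : (h < N n)%N by case/andP: hh.
have h0 : (0 < h)%N by case/andP: hh.
apply: (phi_product hm (cf := fun A C => step_coef h (val A) (val C))).
- by move=> C cBA; apply: (step_product hg hm _ hh ld BE cBA).
- move=> B' A' C' EB EA; rewrite (schur_step (hg hd) A' C' hh ld); last by rewrite EB BE.
  by rewrite EB EA.
(* A nonzero coefficient at some C of [Xi n d] puts A and B in [Xi n d]; if one of them lies
   outside, both sides vanish. *)
move=> C cBA ne; rewrite (step_coef_in_Xi hN h0 ne) /=.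
exact: (step_coef_in_Xi_l hN h0 ne ld BE (Xit_sym B) cBA).
Qed.

Lemma phi_diag_product B A : is_diag_mx (val B) ->
  phi d (m B A) = schur_mul g (schur_std d (val B)) (schur_std d (val A)).
Proof.
move=> Bd; apply: (phi_product hm (cf := fun A C => (A == C)%:R)).
- by move=> C cBA; apply: (diag_product hg hm).
- move=> B' A' C' EB EA; rewrite (schur_diag (hg hd)) EB // EA.
  rewrite -(inj_eq (@Xi_mx_inj n d)) EA -[composable_mx _ _]/(composable B A).
  by rewrite -[val A == _]/(A == embed C'); case: (composable B A).
(* Here A = C, and the diagonal of B consists of the row sums of C, which are nonnegative. *)
move=> C cBA; have [AE _|_] := eqVneq A (embed C); last by rewrite eqxx.
rewrite AE in_Xi_mx /=; have C0 := Xi_mx_ge0 C.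
have BC a : val B a a = row_sum (Xi_mx C) a.
  by rewrite -(col_sum_diag _ Bd); move/forallP/(_ a)/eqP: cBA => ->; rewrite AE.
apply: in_Xi_intro => [i j||].
- have [<-|ij] := eqVneq i j; last by rewrite Xit_ge0.
  by rewrite BC; apply: sumr_ge0.
- exact: Xit_sym.
rewrite -(Xi_mx_sum C); apply: eq_bigr => i _.
by rewrite -/(row_sum (val B) i) row_sum_diag // BC.
Qed.

Lemma K_mul_gen B x : K_mul m << B >> x = lin_ext (m B) x.
Proof. by rewrite K_mulE lin_extU. Qed.

Lemma phi_gen_mul B x : is_diag_mx (val B) \/ step_gen B ->
  phi d (K_mul m << B >> x) = schur_mul g (phi d << B >>) (phi d x).
Proof.
move=> hB; rewrite K_mul_gen phiU [LHS](lin_ext_comp _ _ (@phi_linear n d)).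
rewrite /phi [RHS](lin_ext_comp (f := schur_mul g (schur_std d (val B)))); last first.
  by move=> a y z; exact: schur_mulPr.
apply: lin_ext_eq => A; case: hB => hB; [exact: phi_diag_product|exact: phi_step_product].
Qed.

Lemma K_mulP a x y z : K_mul m (a *: x + y) z = a *: K_mul m x z + K_mul m y z.
Proof. by rewrite !K_mulE lin_extP. Qed.

Lemma K_mulA x y z : K_mul m x (K_mul m y z) = K_mul m (K_mul m x y) z.
Proof. by case: hm => h _ _; exact: h. Qed.

(** Generation as an induction principle over Z[v, v^-1]: closure under division by nonzero scalars
    replaces the passage to Q(v). It serves both multiplicativity and uniqueness. *)
Lemma K_ind (P : K n -> Prop) :
  P 0 -> (forall a x y, P x -> P y -> P (a *: x + y)) ->
  (forall (a : laurent) x, a != 0 -> P (a *: x) -> P x) ->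
  (forall B, is_diag_mx (val B) -> P << B >>) ->
  (forall B x, step_gen B -> P x -> P (K_mul m << B >> x)) -> forall x, P x.
Proof.
move=> P0 Plin Ptors Pdiag Pstep.
have Psum (s : seq (Xit n)) (c : Xit n -> laurent) :
    (forall C, C \in s -> P << C >>) -> P (\sum_(C <- s) c C *: << C >>).
  elim: s => [|C s IH] h; first by rewrite big_nil.
  rewrite big_cons; apply: Plin; first by apply: h; rewrite mem_head.
  by apply: IH => C' C's; apply: h; rewrite in_cons C's orbT.
have xE (x : K n) : x = \sum_(C <- msupp x) x@_C *: << C >>.
  exact: (malg_lin_ext (idfun : {linear K n -> K n})).
suff PU A : P << A >> by move=> x; rewrite [x]xE; apply: Psum => C _.
have [k] := ubnP `|spread (val A)|%N; elim: k A => // k IH A Ak.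
have [/Pdiag //|nd] := boolP (is_diag_mx (val A)).
have [h [B [A' [l [hh ld BE cBA [lt neA lower]]]]]] := generation_step nd.
have coefE C := step_product hg hm C hh ld BE cBA.
have less C : spread (val C) < spread (val A) -> P << C >>.
  move=> CA; apply: IH; apply: leq_trans _ (_ : `|spread (val A)| <= k)%N; last by rewrite -ltnS.
  by have := spread_ge0 C; move: CA; move: (spread _) (spread _) => s t; clear; lia.
have PM : P (m B A') by rewrite -K_mulU; apply: Pstep (less _ lt); exists h, l.
have cA : (m B A')@_A != 0.
  rewrite -laurent_val_eq0 (coefE A).
  by apply: mulf_neq0; [apply: expfz_neq0; exact: v_neq0|exact: neA].
apply: (Ptors _ _ cA).
have Am : A \in msupp (m B A') by rewrite -mcoeff_neq0.
(* The terms of [m B A'] other than the leading one; all of them have smaller spread. *)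
pose r : K n := \sum_(C <- (msupp (m B A') `\ A)%fset) (m B A')@_C *: << C >>.
have -> : (m B A')@_A *: << A >> = (-1) *: r + m B A' :> K n.
  by rewrite [m B A' in RHS]xE (big_fsetD1 A) //= scaleN1r addrCA addNr addr0.
apply: Plin PM; apply: Psum => C; rewrite in_fsetD1 -mcoeff_neq0 => /andP[CA].
rewrite -laurent_val_eq0 coefE mulf_eq0 negb_or => /andP[_ neC].
exact/less/lower.
Qed.

(** The x that satisfy this for all y are closed under left multiplication by generators, by
    associativity of both products, and under division, the Schur algebra being torsion free. *)
Lemma phi_mul x y : phi d (K_mul m x y) = schur_mul g (phi d x) (phi d y).
Proof.
pose P x := forall y, phi d (K_mul m x y) = schur_mul g (phi d x) (phi d y).
have K_mul0 z : K_mul m 0 z = 0 := linear0E (fun a x y => K_mulP a x y z).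
have K_mulZ a x' z : K_mul m (a *: x') z = a *: K_mul m x' z.
  exact: (linearZE (fun a x y => K_mulP a x y z)).
have phiZ a z : phi d (a *: z) = a *: phi d z := linearZE (@phi_linear n d) a z.
have SZ a (s t : schur n d) : schur_mul g (a *: s) t = a *: schur_mul g s t.
  exact: (linearZE (f := fun s => schur_mul g s t) (fun a s s' => schur_mulP g a s s' t)).
have phiP a z t : phi d (a *: z + t) = a *: phi d z + phi d t := phi_linear d a z t.
apply: (K_ind (P := P)).
- by move=> z; rewrite K_mul0 phi0 schur_mul0l.
- move=> a z t Pz Pt u.
  have E1 := congr1 (phi d) (K_mulP a z t u).
  have E2 := phiP a (K_mul m z u) (K_mul m t u).
  have E3 := schur_mulP g a (phi d z) (phi d t) (phi d u).
  have E4 := congr1 (fun s => schur_mul g s (phi d u)) (phiP a z t).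
  have E5 := congr2 (fun s s' => a *: s + s') (Pz u) (Pt u).
  exact: etrans E1 (etrans E2 (etrans E5 (etrans (esym E3) (esym E4)))).
- move=> a z a0 Paz u; apply: (schur_scalerI a0).
  have E1 := esym (phiZ a (K_mul m z u)).
  have E2 := congr1 (phi d) (esym (K_mulZ a z u)).
  have E3 := congr1 (fun s => schur_mul g s (phi d u)) (phiZ a z).
  exact: etrans E1 (etrans E2 (etrans (Paz u) (etrans E3 (SZ a (phi d z) (phi d u))))).
- by move=> B Bd z; apply: phi_gen_mul; left.
move=> B z hB Pz u; have gB w := phi_gen_mul w (or_intror hB).
have E1 := congr1 (phi d) (K_mulA << B >> z u).
have E2 := etrans (gB (K_mul m z u)) (congr1 (schur_mul g (phi d << B >>)) (Pz u)).
have E3 := schur_mulA (hg hd) (phi d << B >>) (phi d z) (phi d u).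
have E4 := congr1 (fun s => schur_mul g s (phi d u)) (gB z).
exact: etrans (esym E1) (etrans E2 (etrans E3 (esym E4))).
Qed.
End Homomorphism.

(** * Integral forms, uniqueness and the composite with the isomorphism *)

Lemma laurent_valP (a b c : laurent) :
  laurent_val (a * b + c) = laurent_val a * laurent_val b + laurent_val c.
Proof. by []. Qed.

Section RationalForm.
Variable I : choiceType.
Implicit Types x y : {malg laurent[I]}.

Lemma toQ_linear (c : laurent) x y : toQ (c *: x + y) = (c : Qv) *: toQ x + toQ y.
Proof.
apply/malgP => k; rewrite toQE mcoeffD mcoeffZ [in RHS]mcoeffD [in RHS]mcoeffZ !toQE.
exact: laurent_valP.
Qed.

Lemma toQ_sum (J : Type) (s : seq J) (c : J -> laurent) (F : J -> {malg laurent[I]}) :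
  toQ (\sum_(j <- s) c j *: F j) = \sum_(j <- s) (c j : Qv) *: toQ (F j).
Proof.
elim: s => [|j s IH]; last by rewrite !big_cons toQ_linear IH.
by rewrite !big_nil; apply/malgP => k; rewrite toQE !mcoeff0.
Qed.

Lemma msupp_toQ x : msupp (toQ x) = msupp x.
Proof. by apply/fsetP => k; rewrite -!mcoeff_neq0 toQE laurent_val_eq0. Qed.

Lemma toQ_over x : toQ x \is a monalgOver laurent_pred.
Proof. by apply/monalgOverP => k; rewrite toQE; exact: laurentP. Qed.

Lemma ofQE (y : {malg Qv[I]}) k : (ofQ y)@_k = insubd (0 : laurent) y@_k.
Proof.
rewrite /ofQ mcoeffE; case: msuppP => // _.
by rewrite (_ : 0 = val (0 : laurent)) // valKd.
Qed.

Lemma toQK : cancel (@toQ I) (@ofQ I).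
Proof. by move=> x; apply/malgP => k; rewrite ofQE toQE; exact: (valKd (0 : laurent)). Qed.

Lemma ofQK (y : {malg Qv[I]}) : y \is a monalgOver laurent_pred -> toQ (ofQ y) = y.
Proof.
by move/monalgOverP => h; apply/malgP => k; rewrite toQE ofQE; exact: (insubdK _ (h k)).
Qed.
End RationalForm.

Section Characterization.
Variables (n d : nat).

Lemma KQ_mul_toQ (m : Xit n -> Xit n -> K n) (x y : K n) :
  KQ_mul m (toQ x) (toQ y) = toQ (K_mul m x y).
Proof.
have E : K_mul m x y =
    \sum_(A <- msupp x) x@_A *: \sum_(B <- msupp y) y@_B *: m A B.
  apply: eq_bigr => A _; rewrite scaler_sumr; apply: eq_bigr => B _.
  by rewrite scalerA.
rewrite E toQ_sum /KQ_mul !msupp_toQ; apply: eq_bigr => A _.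
rewrite toQ_sum scaler_sumr; apply: eq_bigr => B _.
by rewrite !toQE scalerA.
Qed.

HB.instance Definition _ :=
  GRing.isLinear.Build laurent (K n) (schur n d) *:%R (@phi n d) (@phi_linear n d).

Lemma K_std_val (A : Xit n) : K_std (val A) = << A >>.
Proof. by rewrite /K_std valK. Qed.

Lemma vexpNK (z : int) : vexp z * vexp (- z) = 1.
Proof.
by apply: laurent_val_inj; rewrite laurent_valM !laurent_vexp -expfzDr ?v_neq0 // subrr.
Qed.

Lemma phi_surjective (s : schur n d) : exists x, phi d x = s.
Proof.
(* The factor is there because e_C = v^(d_C) [C]. *)
exists (\sum_(C : Xi n d) (s@_C * vexp (dA C)%:Z) *: << embed C >>).
have E := linear_sumE (index_enum _) (fun C : Xi n d => s@_C * vexp (dA C)%:Z)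
  (fun C => << embed C >> : K n) (@phi_linear n d).
apply: etrans E _; apply/malgP => D; rewrite schur_sum_coef (bigD1 D) //=.
rewrite big1 => [|C CD]; last first.
  rewrite schurZ_coef phiU schur_std_coef (inj_eq (@Xi_mx_inj n d)) (negPf CD).
  exact: mulr0.
rewrite addr0 schurZ_coef phiU schur_std_coef eqxx.
by rewrite -mulrA vexpNK mulr1.
Qed.

Lemma Etheta_rev (k l : nat) : (k < N n)%N -> (l < N n)%N ->
  Etheta n (N n - k.+1) (N n - l.+1) = Etheta n k l.
Proof.
move=> hk hl; have E i : (i < N n)%N -> (N n - (N n - i.+1).+1)%N = i by move: (N n) => k'; lia.
by apply/matrixP => a b; rewrite !EthetaE ?E ?ltn_subrL //; exact: addrC.
Qed.

(** With indices from 0, E^theta_{h,h-1} is E^theta_{i+1,i} with i = h - 1 for h <= n, and by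
    rotation E^theta_{i,i+1} with i = N - h - 1 for h > n. Both occur with R = 1, and diagonal
    matrices are the case R = 0. *)
Lemma gen_value (g : structure_constants n) (m : Xit n -> Xit n -> K n) (hn : (0 < n)%N)
    (f : K n -> schur n d) (B : Xit n) : is_phi g m f ->
  is_diag_mx (val B) \/ step_gen B -> f << B >> = phi d << B >>.
Proof.
case=> _ _ f1 f2 hB; rewrite -K_std_val phi_std.
have mkdiag (l : 'M[int]_(N n)) : Xit_pred l -> is_diag_mx l -> exists l' : Xitdiag n, val l' = l.
  move=> h1 h2; have h : Xit_pred l && is_diag_mx l by rewrite h1.
  by exists (exist _ l h).
case: hB => [Bd|[h [l [hh ld BE]]]].
  have [l lE] := mkdiag _ (valP B) Bd.
  by have := f1 0%N (Ordinal hn) l; rewrite mulr0n addr0 lE.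
have hN : (h < N n)%N by case/andP: hh.
have hN' : (h.-1 < N n)%N by rewrite (leq_ltn_trans (leq_pred h)).
have lP : Xit_pred l.
  have lE : l = val B - Etheta n h h.-1 by rewrite BE addrK.
  apply/and3P; split.
  - by apply/'forall_forallP => i j; apply/implyP => ij; rewrite (is_diag_mxP ld).
  - by have := Xit_odd B; rewrite BE mxE Etheta_mid // addr0.
  by rewrite lE; apply: theta_symD (Xit_sym B) (theta_symN (@Etheta_sym n _ _)).
have [l' l'E] := mkdiag _ lP ld.
case: (leqP h n) => hn'.
  have i_lt : (h.-1 < n)%N by move: hh hn'; clear; lia.
  have := f2 1%N (Ordinal i_lt) l'; rewrite /= mulr1n l'E prednK; last by case/andP: hh.
  by rewrite -BE.
have i_lt : (N n - h.+1 < n)%N by move: hh hn'; rewrite /N; clear; lia.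
have := f1 1%N (Ordinal i_lt) l'; rewrite /= mulr1n l'E.
have -> : (N n - h.+1).+1 = (N n - h.-1.+1)%N by move: hh; clear; lia.
by rewrite Etheta_rev // -BE.
Qed.

Lemma phi_is_phi (hd : (0 < d)%N) (g : structure_constants n) (m : Xit n -> Xit n -> K n)
    (hg : forall d', (0 < d')%N -> counts_flags (@g d')) (hm : is_stabilization g m) :
  is_phi g m (@phi n d).
Proof.
split; first exact: phi_mul.
- exact: phi_surjective.
- by move=> R i l; exact: phi_std.
by move=> R i l; exact: phi_std.
Qed.

Lemma phi_unique (hn : (0 < n)%N) (hd : (0 < d)%N) (g : structure_constants n)
    (m : Xit n -> Xit n -> K n)
    (hg : forall d', (0 < d')%N -> counts_flags (@g d')) (hm : is_stabilization g m)
    (psi : {linear K n -> schur n d}) : is_phi g m psi -> psi =1 @phi n d.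
Proof.
move=> hpsi; have [psiM _ _ _] := hpsi.
have psiP a x y : psi (a *: x + y) = a *: psi x + psi y := linearP psi a x y.
have phiP a (x y : K n) : phi d (a *: x + y) = a *: phi d x + phi d y := phi_linear d a x y.
apply: (K_ind hg hm (P := fun x => psi x = phi d x)).
- by rewrite phi0; exact: linear0E psiP.
- move=> a x y Ex Ey; have E := congr2 (fun s t => a *: s + t) Ex Ey.
  exact: etrans (psiP a x y) (etrans E (esym (phiP a x y))).
- move=> a x a0 E; apply: (schur_scalerI a0).
  exact: etrans (esym (linearZE psiP a x)) (etrans E (linearZE phiP a x)).
- by move=> B Bd; apply: (gen_value hn hpsi); left.
move=> B x hB Ex; have E := congr2 (@schur_mul n g d) (gen_value hn hpsi (or_intror hB)) Ex.
exact: etrans (psiM _ _) (etrans E (esym (phi_mul hd hg hm _ _))).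
Qed.
End Characterization.

Theorem proposition4p11 (n d : nat) (hn : (0 < n)%N) (hd : (0 < d)%N)
    (g : structure_constants n)
    (hg : forall d', (0 < d')%N -> counts_flags (g d'))
    (m : Xit n -> Xit n -> K n) (hm : is_stabilization g m) :
  exists phi : {linear K n -> schur n d},
    [/\ is_phi g m phi,
        (forall psi : {linear K n -> schur n d}, is_phi g m psi -> psi =1 phi)
      & forall aleph : {linear Udot n -> KQ n}, is_aleph m aleph ->
          let AU := AUdot aleph in
          let phi_aleph := fun x : Udot n => phi (ofQ (aleph x)) in
          [/\ {in AU &, forall x y, forall c : laurent, (c : Qv) *: x + y \in AU},
              {in AU &, forall x y, Udot_mul x y \in AU},
              {in AU &, forall x y, forall c : laurent,
                 phi_aleph ((c : Qv) *: x + y) = c *: phi_aleph x + phi_aleph y},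
              {in AU &, {morph phi_aleph : x y / Udot_mul x y >-> schur_mul g x y}}
            & forall s : schur n d, exists2 x, x \in AU & phi_aleph x = s]].
Proof.
exists (@phi n d); have hphi := phi_is_phi hd hg hm.
split=> [//||aleph hal AU phi_aleph]; first exact: phi_unique.
have [[aleph' alephK alephK'] alephM _ _ _] := hal; have [phiM phi_onto _ _] := hphi.
have AUP x : (x \in AU) = (aleph x \is a monalgOver laurent_pred) by [].
have AUE x : x \in AU -> aleph x = toQ (ofQ (aleph x)).
  by rewrite AUP => /ofQK ->.
(* Expressing [aleph] of the results through elements of K^j gives at once the closure of [AU] and
   the compatibility of [phi_aleph]. *)
have lin x y (c : laurent) : x \in AU -> y \in AU ->
    aleph ((c : Qv) *: x + y) = toQ (c *: ofQ (aleph x) + ofQ (aleph y)).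
  move=> xA yA; rewrite toQ_linear -!AUE //; exact: linearP.
have mul x y : x \in AU -> y \in AU ->
    aleph (Udot_mul x y) = toQ (K_mul m (ofQ (aleph x)) (ofQ (aleph y))).
  by move=> xA yA; rewrite alephM {1}(AUE x xA) {1}(AUE y yA) KQ_mul_toQ.
split.
- by move=> x y xA yA c; rewrite AUP lin // toQ_over.
- by move=> x y xA yA; rewrite AUP mul // toQ_over.
- move=> x y xA yA c; rewrite /phi_aleph lin // toQK; exact: linearP.
- by move=> x y xA yA; rewrite /phi_aleph mul // toQK; exact: phiM.
move=> s; have [X XE] := phi_onto s; exists (aleph' (toQ X)).
  by rewrite AUP alephK' toQ_over.
by rewrite /phi_aleph alephK' toQK.
Qed.
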